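(* Let $B$ be an $(n,n-1)$-blocker of a convex $n$-gon with vertices $0,\dots,n-1$ (indices mod $n$) which contains at least one vertex $u$ with $\deg_B(u)=2$ and $(u-1,u+1)\notin B$. Then, up to a cyclic rotation of the labels, $B$ is of one of the following three types. Type 1: $B=B_{\mathrm{Sea}}\cup B_1\cup B_2$, where for some $4\le m\le n-3$ and $2<\ell<m$: $B_{\mathrm{Sea}}=\{(\ell-2,\ell),(\ell-2,\ell+1),(\ell-1,\ell+2),(\ell,\ell+2)\}$; $B_1=\{(0,2),\dots,(\ell-3,\ell-1),(\ell+1,\ell+3),\dots,(m,m+2)\}$; $B_2=\{(m+3,i_1),\dots,(n-1,i_{n-3-m})\}$ with all $i_j\in\{1,\dots,\ell-1,\ell+1,\dots,m+1\}$, such that whenever $|i_{j_1}-i_{j_2}|\ge2$, $(m+2+j_1,i_{j_1})$ and $(m+2+j_2,i_{j_2})$ do not cross. Type 2: $B=B_{\mathrm{Buf}}\cup B_1\cup B_2$, where for some $5\le m\le n-3$ and $2<\ell<m-1$: $B_{\mathrm{Buf}}=\{(\ell-2,\ell),(\ell-2,\ell+1),(\ell-1,\ell+2),(\ell,\ell+3),(\ell+1,\ell+3)\}$; $B_1=\{(0,2),\dots,(\ell-3,\ell-1),(\ell+2,\ell+4),\dots,(m,m+2)\}$; $B_2=\{(m+3,i_1),\dots,(n-1,i_{n-3-m})\}$ with all $i_j\in\{1,\dots,\ell-1,\ell+2,\dots,m+1\}$, such that whenever $|i_{j_1}-i_{j_2}|\ge2$, $(m+2+j_1,i_{j_1})$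 and $(m+2+j_2,i_{j_2})$ do not cross. Type 3: $B=B_{\mathrm{Bouq}}\cup B_{1,L}\cup B_{1,R}\cup B_{2,L}\cup B_{2,R}$, where for integers with $0<\ell<m+2<k<k+1<k+t\le n-1$: $B_{\mathrm{Bouq}}=\{(\ell-1,\ell+1),(k,\ell-1),(k+t,\ell+1),(k,k+t),(k+1,\ell),\dots,(k+t-1,\ell)\}$; $B_{1,L}=\{(\ell,\ell+2),\dots,(m,m+2)\}$ if $\ell<m+1$, $\emptyset$ if $\ell=m+1$; $B_{1,R}=\{(0,2),\dots,(\ell-2,\ell)\}$ if $\ell>1$, $\emptyset$ if $\ell=1$; $B_{2,L}=\{(m+3,i_1),\dots,(k-1,i_{k-m-3})\}$ if $k>m+3$, $\emptyset$ if $k=m+3$; $B_{2,R}=\{(k+t+1,i_{k+t-m-1}),\dots,(n-1,i_{n-3-m})\}$ if $k+t<n-1$, $\emptyset$ if $k+t=n-1$; with $i_1,\dots,i_{k-m-3}\in\{\ell,\dots,m+1\}$, $i_{k+t-m-1},\dots,i_{n-3-m}\in\{1,\dots,\ell\}$, and whenever $|i_{j_1}-i_{j_2}|\ge2$, $(m+2+j_1,i_{j_1})$ and $(m+2+j_2,i_{j_2})$ do not cross.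
   Context: An edge $(i,j)$ is the segment between vertices $i,j$ of the convex polygon; sides are $(i,i+1)$ and diagonals are the other edges. Two edges cross if they share an interior point. A triangulation is a maximal set of pairwise non-crossing diagonals. A blocker is a set $B$ of diagonals having a diagonal in common with every triangulation; it is saturated if for every $e\in B$, $B\setminus\{e\}$ is not a blocker. An $(n,k)$-blocker is a saturated blocker of size $k$ for a convex $n$-gon. $\deg_B(u)$ is the number of edges of $B$ incident to $u$. *)

(* Defs.v *)
From mathcomp Require Import all_boot.
Set Implicit Arguments. Unset Strict Implicit. Unset Printing Implicit Defensive.

(* Vertices of the convex n-gon are 'I_n (labels 0..n-1, in convex order).
   An edge is the 2-element vertex set {a,b}. *)

Definition ed (n a b : nat) : {set 'I_n} :=
  [set x : 'I_n | (val x == a %% n) || (val x == b %% n)].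

Definition is_diag (n : nat) (e : {set 'I_n}) : bool :=
  [exists a : 'I_n, exists b : 'I_n,
     [&& e == [set a; b], a.+1 < b & ~~ ((val a == 0) && (val b == n.-1))]].

Definition interleave (n : nat) (e f : {set 'I_n}) : bool :=
  [exists a : 'I_n, exists b : 'I_n, exists c : 'I_n, exists d : 'I_n,
     [&& e == [set a; b], f == [set c; d], a < c, c < b & b < d]].

(* two edges of a convex polygon share an interior point *)
Definition cross (n : nat) (e f : {set 'I_n}) : bool :=
  interleave e f || interleave f e.

Definition is_triangulation (n : nat) (T : {set {set 'I_n}}) : Prop :=
  (forall e, e \in T -> is_diag e) /\
  (forall e f, e \in T -> f \in T -> ~~ cross e f) /\
  (forall d, is_diag d -> d \notin T -> exists2 f, f \in T & cross d f).

Definition is_blocker (n : nat) (B : {set {set 'I_n}}) : Prop :=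
  (forall e, e \in B -> is_diag e) /\
  (forall T, is_triangulation T -> exists e, e \in B /\ e \in T).

Definition saturated (n : nat) (B : {set {set 'I_n}}) : Prop :=
  forall e, e \in B -> ~ is_blocker (B :\ e).

Definition nk_blocker (n k : nat) (B : {set {set 'I_n}}) : Prop :=
  is_blocker B /\ saturated B /\ #|B| = k.

Definition deg (n : nat) (B : {set {set 'I_n}}) (u : 'I_n) : nat :=
  #|[set e in B | u \in e]|.

Definition rotE (n r : nat) (e : {set 'I_n}) : {set 'I_n} :=
  [set y : 'I_n | [exists x in e, val y == (val x + r) %% n]].
Definition rotB (n r : nat) (B : {set {set 'I_n}}) : {set {set 'I_n}} :=
  [set rotE r e | e in B].

Definition edges (n : nat) (P : pred nat) (f g : nat -> nat) : {set {set 'I_n}} :=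
  [set e : {set 'I_n} | [exists j : 'I_n, P j && (e == ed n (f j) (g j))]].

Definition dist2 (a b : nat) : bool := (a + 2 <= b) || (b + 2 <= a).

Definition type1 (n : nat) (B : {set {set 'I_n}}) : Prop :=
  exists (m l : nat) (i : nat -> nat),
    [/\ 4 <= m <= n - 3, 2 < l < m,
     (forall j, 1 <= j <= n - 3 - m ->
        (1 <= i j <= l - 1) || (l + 1 <= i j <= m + 1)),
     (forall j1 j2, 1 <= j1 <= n - 3 - m -> 1 <= j2 <= n - 3 - m ->
        dist2 (i j1) (i j2) ->
        ~~ cross (ed n (m + 2 + j1) (i j1)) (ed n (m + 2 + j2) (i j2))) &
     B = [set ed n (l-2) l; ed n (l-2) (l+1); ed n (l-1) (l+2); ed n l (l+2)]
         :|: edges n (fun j => (j + 3 <= l) || (l + 1 <= j <= m)) id (fun j => j + 2)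
         :|: edges n (fun j => 1 <= j <= n - 3 - m) (fun j => m + 2 + j) i].

Definition type2 (n : nat) (B : {set {set 'I_n}}) : Prop :=
  exists (m l : nat) (i : nat -> nat),
    [/\ 5 <= m <= n - 3, 2 < l < m - 1,
     (forall j, 1 <= j <= n - 3 - m ->
        (1 <= i j <= l - 1) || (l + 2 <= i j <= m + 1)),
     (forall j1 j2, 1 <= j1 <= n - 3 - m -> 1 <= j2 <= n - 3 - m ->
        dist2 (i j1) (i j2) ->
        ~~ cross (ed n (m + 2 + j1) (i j1)) (ed n (m + 2 + j2) (i j2))) &
     B = [set ed n (l-2) l; ed n (l-2) (l+1); ed n (l-1) (l+2); ed n l (l+3);
              ed n (l+1) (l+3)]
         :|: edges n (fun j => (j + 3 <= l) || (l + 2 <= j <= m)) id (fun j => j + 2)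
         :|: edges n (fun j => 1 <= j <= n - 3 - m) (fun j => m + 2 + j) i].

Definition type3 (n : nat) (B : {set {set 'I_n}}) : Prop :=
  exists (l m k t : nat) (i : nat -> nat),
    let idxL := fun j => 1 <= j <= k - m - 3 in
    let idxR := fun j => k + t - m - 1 <= j <= n - 3 - m in
    [/\ [&& 0 < l, l < m + 2, m + 2 < k, k.+1 < k + t & k + t <= n - 1],
     (forall j, idxL j -> l <= i j <= m + 1),
     (forall j, idxR j -> 1 <= i j <= l),
     (forall j1 j2, idxL j1 || idxR j1 -> idxL j2 || idxR j2 ->
        dist2 (i j1) (i j2) ->
        ~~ cross (ed n (m + 2 + j1) (i j1)) (ed n (m + 2 + j2) (i j2))) &
     B = ([set ed n (l-1) (l+1); ed n k (l-1); ed n (k+t) (l+1); ed n k (k+t)]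
          :|: edges n (fun s => 1 <= s <= t - 1) (fun s => k + s) (fun _ => l))
         :|: edges n (fun j => l <= j <= m) id (fun j => j + 2)
         :|: edges n (fun j => j + 2 <= l) id (fun j => j + 2)
         :|: edges n idxL (fun j => m + 2 + j) i
         :|: edges n idxR (fun j => m + 2 + j) i].

(* Main.v *)
(* Call a vertex an ear of B if the diagonal joining its two neighbours is in B.
   Deleting a non-ear vertex from a blocker leaves a blocker of the smaller
   polygon, and a vertex of a blocker has degree at least 1; hence a blocker of an
   N-gon has at least N - 2 edges, and in a blocker with exactly N - 2 edges every
   non-ear vertex has degree 1 and no edge joins two non-ears.  Take a maximal run
   of ears 1, ..., M - 1 between non-ears 0 and M.  The vertex before 0 is a non-ear,
   since the only neighbour of 0 is 2; deleting it and iterating shows that each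
   vertex y outside the arc 0..M sends its single edge (a spoke) to a vertex f y
   inside the arc.  Two spokes that cross must end at adjacent arc vertices, as
   otherwise a triangulation can be zigzagged between them; conversely such a
   configuration always blocks.

   In the theorem, deleting u leaves such a minimum blocker, into which u is
   inserted with two edges.  If u lies outside the arc, the arc ends that a single
   spoke could use would make the other edge redundant, and the remaining choices
   give type 3.  If u lies inside the arc, deleting a neighbour of u which becomes a
   non-ear, and comparing degrees, gives types 1 and 2, or type 3 when u is close to
   an end of the arc. *)

Require Import Defs.
From mathcomp Require Import all_boot.
From mathcomp Require Import zify.
Set Implicit Arguments. Unset Strict Implicit. Unset Printing Implicit Defensive.

(** * Triangulability by ear removal *)

(** Until sets of diagonals return at the end, a blocker is a symmetric relation E on natural
    numbers and a polygon is a set V of surviving labels. Crossing depends only on the order of the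
    labels, so deleting vertices may leave gaps without any relabelling. Every cut along a chord
    outside E preserves the blocking property; contradictions are therefore reached by cutting off
    fans until some vertex is isolated or at most three vertices remain. The converse statement,
    that arc configurations block, is indispensable for the classification: saturation is exploited
    only by exhibiting a full arc configuration that survives the deletion of one edge. Edges are
    counted through degree sums, so N - 2 and n - 1 edges appear as 2N - 4 and 2n - 2. Deleting a
    vertex of degree 2 lowers the sum by 4, from 2n - 2 to 2(n - 1) - 4, which is the minimum for n
    - 1 vertices. The statement permits rotations only, whereas the case analysis also uses
    reflections; these are absorbed because each of the three shapes is symmetric under reversal of
    its own arc. *)

Definition btw (a v b : nat) : bool := (a < v < b) || (b < v < a).

(* The chords ab and cd cross; meaningful for four distinct vertices only. *)
Definition crs (a b c d : nat) : bool := btw a c b != btw a d b.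

(* The chord ab cuts c off from the rest of the polygon V. *)
Definition ear (V : pred nat) (c a b : nat) : Prop :=
  [/\ V c, V a, V b, [&& a != b, c != a & c != b] &
      forall v, V v -> v != c -> v != a -> v != b -> crs a b c v].

(* V has a triangulation without diagonals in E: every triangulation is obtained
   by cutting off ears one at a time. *)
Inductive tri (E : rel nat) : pred nat -> Prop :=
| tri_small (V : pred nat) x y z :
    (forall v, V v -> [\/ v = x, v = y | v = z]) -> tri E V
| tri_ear (V V' : pred nat) c a b :
    ear V c a b -> ~~ E a b -> (forall v, V' v = V v && (v != c)) ->
    tri E V' -> tri E V.

(** The blocking property of [E] for the polygon [V], free of sets of diagonals; it passes to every
    polygon obtained by cuts outside [E]. *)
Definition nt (E : rel nat) (V : pred nat) : Prop := ~ tri E V.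

Lemma tri_ext E (V W : pred nat) : V =1 W -> tri E V -> tri E W.
Proof.
move=> VW t; case: t VW => {V} [V x y z sm VW|V V' c a b [Vc Va Vb d cr] nE V'E t VW].
  by apply: (@tri_small E W x y z) => v; rewrite -VW; apply: sm.
apply: (@tri_ear E W V' c a b) => //; last by move=> v; rewrite V'E VW.
split; rewrite -?VW // => v; rewrite -VW; exact: cr.
Qed.

Lemma nt_ext E (V W : pred nat) : V =1 W -> nt E V -> nt E W.
Proof. by move=> VW nV tW; apply: nV; apply: tri_ext tW => v; rewrite VW. Qed.

Lemma tri_mono (E F : rel nat) (V : pred nat) :
  (forall x y, V x -> V y -> E x y -> F x y) -> tri F V -> tri E V.
Proof.
move=> EF t; elim: t EF => {V} [V x y z sm _|V V' c a b e nF V'E _ IH EF].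
  exact: (@tri_small E V x y z).
have [_ Va Vb _ _] := e.
apply: (tri_ear e _ V'E); first by apply: contra nF; exact: (EF a b Va Vb).
by apply: IH => x y; rewrite !V'E => /andP[Vx _] /andP[Vy _]; apply: EF.
Qed.

Lemma nt_mono (E F : rel nat) (V : pred nat) :
  (forall x y, V x -> V y -> E x y -> F x y) -> nt E V -> nt F V.
Proof. by move=> EF nE tF; apply: nE; apply: tri_mono tF. Qed.

Lemma nt_ear E (V V' : pred nat) c a b :
  nt E V -> ear V c a b -> ~~ E a b -> (forall v, V' v = V v && (v != c)) ->
  nt E V'.
Proof. by move=> nV e nE V'E t; apply: nV; exact: (tri_ear e nE V'E t). Qed.

(** In terms of labels, an ear either lies between its two neighbours or is the least or greatest
    vertex, and then its neighbours are the two extreme remaining ones. The next two lemmas are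
    these wrap-around cases. *)
Lemma nt_mid E (V V' : pred nat) a c b :
  nt E V -> V a -> V c -> V b -> a < c < b ->
  (forall v, V v -> [\/ v <= a, v = c | b <= v]) -> ~~ E a b ->
  (forall v, V' v = V v && (v != c)) -> nt E V'.
Proof.
move=> nV Va Vc Vb acb VP nE V'E; apply: (nt_ear nV _ nE V'E); split=> //.
  by lia.
by move=> v /VP H *; rewrite /crs /btw; case: H => H; lia.
Qed.

Lemma nt_min E (V V' : pred nat) c a b :
  nt E V -> V c -> V a -> V b -> c < a < b ->
  (forall v, V v -> v = c \/ a <= v <= b) -> ~~ E a b ->
  (forall v, V' v = V v && (v != c)) -> nt E V'.
Proof.
move=> nV Vc Va Vb cab VP nE V'E; apply: (nt_ear nV _ nE V'E); split=> //.
  by lia.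
by move=> v /VP H *; rewrite /crs /btw; case: H => H; lia.
Qed.

Lemma nt_max E (V V' : pred nat) a b c :
  nt E V -> V a -> V b -> V c -> a < b < c ->
  (forall v, V v -> v = c \/ a <= v <= b) -> ~~ E a b ->
  (forall v, V' v = V v && (v != c)) -> nt E V'.
Proof.
move=> nV Va Vb Vc cab VP nE V'E; apply: (nt_ear nV _ nE V'E); split=> //.
  by lia.
by move=> v /VP H *; rewrite /crs /btw; case: H => H; lia.
Qed.

(** * Cutting off fans *)

Lemma next_exists (V : pred nat) a b :
  V b -> a < b -> exists2 x, V x & a < x <= b /\ forall v, V v -> a < v -> x <= v.
Proof.
move=> Vb ab.
have ex : exists x, V x && (a < x) by exists b; rewrite Vb.
case: (ex_minnP ex) => x /andP[Vx ax] mn; exists x => //; split.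
  by rewrite ax /=; apply: mn; rewrite Vb.
by move=> v Vv av; apply: mn; rewrite Vv.
Qed.

Lemma prev_exists (V : pred nat) a b :
  V a -> a < b -> exists2 x, V x & a <= x < b /\ forall v, V v -> v < b -> v <= x.
Proof.
move=> Va ab.
have ex : exists x, V x && (x < b) by exists a; rewrite Va.
have ub : forall x, V x && (x < b) -> x <= b by move=> x /andP[_ /ltnW].
case: (ex_maxnP ex ub) => x /andP[Vx ax] mx; exists x => //; split.
  by rewrite ax andbT; apply: mx; rewrite Va.
by move=> v Vv av; apply: mx; rewrite Vv.
Qed.

(** The vertices between [a] and [b] are cut off in increasing order; each cut is a chord from [a]
    to the next survivor, so only the fan centred at [a] has to avoid [E]. In [fan_down] the centre
    is [b]. *)
Lemma fan_up E (V V' : pred nat) a b :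
  nt E V -> V a -> V b -> a < b ->
  (forall x, V x -> a < x <= b -> ~~ E a x) ->
  (forall v, V' v = V v && ~~ (a < v < b)) -> nt E V'.
Proof.
move=> nV Va Vb ab nE V'E.
suff H k : a + k < b -> nt E (fun v => V v && ~~ (a < v <= a + k)).
  apply: nt_ext (H (b - a - 1) _); last by lia.
  by move=> v /=; rewrite V'E; congr (_ && ~~ _); lia.
elim: k => [|k IH] kb.
  by apply: nt_ext nV => v /=; lia.
have {}IH := IH ltac:(lia).
case Vk: (V (a + k.+1)); last first.
  apply: nt_ext IH => v /=.
  case: (eqVneq v (a + k.+1)) => [->|ne]; first by rewrite Vk.
  by congr (_ && ~~ _); lia.
have [x Vx [xb xm]] := next_exists Vb kb.
apply: (nt_mid IH (a := a) (c := a + k.+1) (b := x)) => /=.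
- by rewrite Va; lia.
- by rewrite Vk; lia.
- by rewrite Vx; lia.
- by lia.
- move=> v /andP[Vv h]; case: (ltnP (a + k.+1) v) => hv.
    by constructor 3; apply: xm.
  by case: (eqVneq v (a + k.+1)) => [->|ne]; [constructor 2|constructor 1; lia].
- by apply: nE => //; lia.
- by move=> v; rewrite -andbA; congr (_ && _); lia.
Qed.

Lemma fan_down E (V V' : pred nat) a b :
  nt E V -> V a -> V b -> a < b ->
  (forall x, V x -> a <= x < b -> ~~ E x b) ->
  (forall v, V' v = V v && ~~ (a < v < b)) -> nt E V'.
Proof.
move=> nV Va Vb ab nE V'E.
suff H k : a + k < b -> nt E (fun v => V v && ~~ (b - k <= v < b)).
  apply: nt_ext (H (b - a - 1) _); last by lia.
  by move=> v /=; rewrite V'E; congr (_ && ~~ _); lia.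
elim: k => [|k IH] kb.
  by apply: nt_ext nV => v /=; lia.
have {}IH := IH ltac:(lia).
case Vk: (V (b - k.+1)); last first.
  apply: nt_ext IH => v /=.
  case: (eqVneq v (b - k.+1)) => [->|ne]; first by rewrite Vk.
  by congr (_ && ~~ _); lia.
have [x Vx [xb xm]] := @prev_exists V a (b - k.+1) Va ltac:(lia).
apply: (nt_mid IH (a := x) (c := b - k.+1) (b := b)) => /=.
- by rewrite Vx; lia.
- by rewrite Vk; lia.
- by rewrite Vb; lia.
- by lia.
- move=> v /andP[Vv h]; case: (ltnP v (b - k.+1)) => hv.
    by constructor 1; apply: xm.
  by case: (eqVneq v (b - k.+1)) => [->|ne]; [constructor 2|constructor 3; lia].
- by apply: nE => //; lia.
- by move=> v; rewrite -andbA; congr (_ && _); lia.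
Qed.

(** The centre is the greatest vertex [z], and the least vertices are cut off one by one up to [h].
    In [fan_first] the centre is the least vertex and the greatest ones are removed. *)
Lemma fan_last E (V V' : pred nat) h z :
  nt E V -> V h -> V z -> h < z ->
  (forall v, V v -> v <= z) ->
  (forall x, V x -> x <= h -> ~~ E x z) ->
  (forall v, V' v = V v && (h <= v)) -> nt E V'.
Proof.
move=> nV Vh Vz hz Vm nE V'E.
suff H k : k <= h -> nt E (fun v => V v && (k <= v)).
  by apply: nt_ext (H h _) => // v /=; rewrite V'E.
elim: k => [|k IH] kh.
  by apply: nt_ext nV => v /=; rewrite andbT.
have {}IH := IH ltac:(lia).
case Vk: (V k); last first.
  apply: nt_ext IH => v /=.
  case: (eqVneq v k) => [->|ne]; first by rewrite Vk.
  by congr (_ && _); lia.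
have [x Vx [xb xm]] := next_exists Vh kh.
apply: (nt_min IH (c := k) (a := x) (b := z)) => /=.
- by rewrite Vk; lia.
- by rewrite Vx; lia.
- by rewrite Vz; lia.
- by lia.
- move=> v /andP[Vv h']; case: (ltnP k v) => hv.
    by right; rewrite xm //= Vm.
  by left; lia.
- by apply: nE => //; lia.
- by move=> v; rewrite -andbA; congr (_ && _); lia.
Qed.

Lemma fan_first E (V V' : pred nat) a z n :
  nt E V -> V a -> V z -> a < z ->
  (forall v, V v -> a <= v < n) ->
  (forall x, V x -> z <= x -> ~~ E a x) ->
  (forall v, V' v = V v && (v <= z)) -> nt E V'.
Proof.
move=> nV Va Vz az Vm nE V'E.
have zn : z < n by case/andP: (Vm _ Vz).
suff H k : z + k < n -> nt E (fun v => V v && (v < n - k)).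
  apply: nt_ext (H (n - z - 1) _); last by lia.
  by move=> v /=; rewrite V'E; congr (_ && _); lia.
elim: k => [|k IH] kh.
  apply: nt_ext nV => v /=; case Vv: (V v) => //=.
  by move: (Vm v Vv); lia.
have {}IH := IH ltac:(lia).
case Vk: (V (n - k.+1)); last first.
  apply: nt_ext IH => v /=.
  case: (eqVneq v (n - k.+1)) => [->|ne]; first by rewrite Vk.
  by congr (_ && _); lia.
have [x Vx [xb xm]] := @prev_exists V z (n - k.+1) Vz ltac:(lia).
apply: (nt_max IH (a := a) (b := x) (c := n - k.+1)) => /=.
- by rewrite Va; lia.
- by rewrite Vx; lia.
- by rewrite Vk; lia.
- by lia.
- move=> v /andP[Vv h']; case: (ltnP v (n - k.+1)) => hv.
    right; rewrite xm // andbT.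
    by case/andP: (Vm v Vv).
  by left; lia.
- by apply: nE => //; lia.
- by move=> v; rewrite -andbA; congr (_ && _); lia.
Qed.

Lemma nt_small E (V : pred nat) x y z :
  nt E V -> (forall v, V v -> [\/ v = x, v = y | v = z]) -> False.
Proof. by move=> nV sm; apply: nV; exact: (@tri_small E V x y z). Qed.

(** Were [c] isolated, the complete fan centred at [c] would be a triangulation avoiding [E]. *)
Lemma nt_neighbour E (V : pred nat) n c :
  nt E V -> symmetric E -> V c -> (forall v, V v -> v < n) ->
  exists2 x, V x & E c x.
Proof.
move=> nV Es Vc Vn.
case: (boolP [exists x : 'I_n, V x && E c x]) => [/existsP[x /andP[Vx Ex]]|].
  by exists x.
move/existsPn => no; exfalso.
have nE x : V x -> ~~ E c x.
  by move=> Vx; have := no (Ordinal (Vn x Vx)); rewrite /= Vx.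
have ex : exists x, V x by exists c.
have ub x : V x -> x <= n by move/Vn/ltnW.
case: (ex_maxnP ex ub) => z Vz zm; case: (ex_minnP ex) => a Va am.
have ac := am _ Vc; have cz := zm _ Vc.
pose V1 v := V v && ~~ (c < v < z).
have n1 : nt E V1.
  case: (ltnP c z) => h; last by apply: nt_ext nV => v; rewrite /V1; lia.
  by apply: (fan_up (a := c) (b := z) nV) => // x Vx _; apply: nE.
pose V2 v := V1 v && ~~ (a < v < c).
have n2 : nt E V2.
  case: (ltnP a c) => h; last by apply: nt_ext n1 => v; rewrite /V2; lia.
  apply: (fan_down (a := a) (b := c) n1) => //.
  - by rewrite /V1 Va; lia.
  - by rewrite /V1 Vc; lia.
  - by move=> x /andP[Vx _] _; rewrite Es; apply: nE.
apply: (nt_small (x := a) (y := c) (z := z) n2) => v.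
rewrite /V2 /V1 -andbA => /andP[Vv h].
have h1 := zm _ Vv; have h2 := am _ Vv.
have [->|e1] := eqVneq v a; first by constructor 1.
have [->|e2] := eqVneq v c; first by constructor 2.
by constructor 3; lia.
Qed.

(** * Rotations and reflections of the labels *)

Definition rt (n r x : nat) : nat := if x + r < n then x + r else x + r - n.

(** The reflection x -> c - x modulo n. Like the rotation, it is written by cases instead of with a
    remainder, so that linear arithmetic can treat it. *)
Definition mr (n c x : nat) : nat := if x <= c then c - x else c + n - x.

Lemma rt_spec n r x : (x + r < n /\ rt n r x = x + r) \/
                      (n <= x + r /\ rt n r x = x + r - n).
Proof. by rewrite /rt; case: ltnP; [left|right]. Qed.

Lemma mr_spec n c x : (x <= c /\ mr n c x = c - x) \/
                      (c < x /\ mr n c x = c + n - x).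
Proof. by rewrite /mr; case: leqP; [left|right]. Qed.

(* [lia] on goals in which [rt] and [mr], possibly nested, occur. *)
Ltac rtlia :=
  repeat match goal with
  | |- context [rt ?n ?r ?x] =>
    lazymatch x with
    | context [rt _ _ _] => fail
    | context [mr _ _ _] => fail
    | _ => move: (rt_spec n r x); generalize (rt n r x); intro
    end
  | |- context [mr ?n ?r ?x] =>
    lazymatch x with
    | context [rt _ _ _] => fail
    | context [mr _ _ _] => fail
    | _ => move: (mr_spec n r x); generalize (mr n r x); intro
    end
  end; lia.

Definition pull (E : rel nat) (g : nat -> nat) : rel nat :=
  fun x y => E (g x) (g y).

(** Ears are defined through crossing alone, so an injective relabelling that preserves crossings
    carries an ear decomposition along. *)
Lemma tri_iso E (g : nat -> nat) (V W : pred nat) :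
  (forall v, V v -> W (g v)) ->
  (forall w, W w -> exists2 v, V v & g v = w) ->
  {in V &, injective g} ->
  (forall a b c d, V a -> V b -> V c -> V d ->
     [&& a != b, c != a, c != b, d != c, d != a & d != b] ->
     crs a b c d -> crs (g a) (g b) (g c) (g d)) ->
  tri (pull E g) V -> tri E W.
Proof.
move=> VW WV gi gc t.
elim: t W VW WV gi gc => {V} [V x y z sm|V V' c a b e nE V'E _ IH] W VW WV gi gc.
  apply: (@tri_small E W (g x) (g y) (g z)) => w /WV[v Vv <-].
  by case: (sm v Vv) => ->; [constructor 1|constructor 2|constructor 3].
have [Vc Va Vb d cr] := e.
have gne x y : V x -> V y -> (g x == g y) = (x == y).
  by move=> Vx Vy; apply/eqP/eqP => [/gi|->] //; apply.
apply: (@tri_ear E W (fun w => W w && (w != g c)) (g c) (g a) (g b)) => //.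
  split; rewrite ?VW ?gne //.
  move=> w /WV[v Vv <-]; rewrite !gne // => vc va vb.
  by apply: gc => //; [lia|exact: cr].
apply: IH => [v|w||a' b' c' d'].
- by rewrite V'E => /andP[Vv vc]; rewrite VW ?gne.
- move=> /andP[/WV[v Vv <-]]; rewrite gne // => vc.
  by exists v; rewrite // V'E Vv.
- move=> x y; rewrite !unfold_in !V'E => /andP[Vx _] /andP[Vy _].
  exact: gi.
- rewrite !V'E => /andP[Va' _] /andP[Vb' _] /andP[Vc' _] /andP[Vd' _].
  exact: gc.
Qed.

Lemma rt_lt n r x : x < n -> r < n -> rt n r x < n.
Proof. by rewrite /rt; case: ifP; lia. Qed.

Lemma mr_lt n c x : x < n -> c < n -> mr n c x < n.
Proof. by rewrite /mr; case: ifP; lia. Qed.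

(** A rotation may exchange the two sides of the chord ab as seen by [btw]. Whether it does depends
    on [a] and [b] only, so the exchange cancels in [crs]. *)
Lemma btw_rt n r a v b : a < n -> v < n -> b < n -> r < n -> v != a -> v != b ->
  btw (rt n r a) (rt n r v) (rt n r b) =
  (btw a v b != ((a + r < n) != (b + r < n))).
Proof.
rewrite /rt /btw => *; case: (ltnP (a + r) n) => ?; case: (ltnP (b + r) n) => ?;
  by case: ifP => ? /=; lia.
Qed.

Lemma btw_mr n c a v b : a < n -> v < n -> b < n -> c < n -> v != a -> v != b ->
  btw (mr n c a) (mr n c v) (mr n c b) =
  (btw a v b != ((a <= c) != (b <= c))).
Proof.
rewrite /mr /btw => *; case: (leqP a c) => ?; case: (leqP b c) => ?;
  by case: ifP => ? /=; lia.
Qed.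

Lemma tri_rt E n r : r < n ->
  tri (pull E (rt n r)) (fun v => v < n) -> tri E (fun v => v < n).
Proof.
move=> rn; apply: tri_iso => [v /= vn|w /= wn|x y|a b c d an bn cn dn].
- exact: rt_lt.
- by exists (rt n (n - r) w); rewrite /rt /=; case: (ltnP (w + (n - r)) n) => ?; try case: ltnP => ?; lia.
- by rewrite !unfold_in /rt => xn yn; repeat case: ifP => ?; lia.
- case/and5P=> ab ca cb dc /andP[da db]; rewrite /crs !btw_rt //.
  by case: (btw a c b); case: (btw a d b); case: (a + r < n); case: (b + r < n).
Qed.

Lemma tri_mr E n c : c < n ->
  tri (pull E (mr n c)) (fun v => v < n) -> tri E (fun v => v < n).
Proof.
move=> rn; apply: tri_iso => [v /= vn|w /= wn|x y|a b v d an bn cn dn].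
- exact: mr_lt.
- by exists (mr n c w); rewrite /mr /=; case: (leqP w c) => ?; try case: leqP => ?; lia.
- by rewrite !unfold_in /mr => xn yn; repeat case: ifP => ?; lia.
- case/and5P=> ab ca cb dc /andP[da db]; rewrite /crs !btw_mr //.
  by case: (btw a v b); case: (btw a d b); case: (a <= c); case: (b <= c).
Qed.

Lemma nt_rt E n r : r < n ->
  nt E (fun v => v < n) -> nt (pull E (rt n r)) (fun v => v < n).
Proof. by move=> rn nE t; apply: nE; apply: tri_rt t. Qed.

Lemma nt_mr E n c : c < n ->
  nt E (fun v => v < n) -> nt (pull E (mr n c)) (fun v => v < n).
Proof. by move=> rn nE t; apply: nE; apply: tri_mr t. Qed.

Lemma rt_inv n r x : x < n -> r < n -> rt n (n - r) (rt n r x) = x.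
Proof. by rewrite /rt => *; case: (ltnP (x + r) n) => ?; case: ltnP => ?; lia. Qed.

Lemma mr_inv n c x : x < n -> c < n -> mr n c (mr n c x) = x.
Proof. by rewrite /mr => *; case: (leqP x c) => ?; case: leqP => ?; lia. Qed.

Definition one_of (p q w : nat) : Prop := w = p \/ w = q.

(** The cut pq separates [c] from a third vertex [w], hence cw separates [p] from [q]; this is
    impossible when all other vertices lie on one side of cw. *)
Lemma ear_adjacent V c p q w :
  ear V c p q -> V w -> w != c ->
  (forall v, V v -> v != c -> v != w -> btw c v w = false) \/
  (forall v, V v -> v != c -> v != w -> btw c v w) ->
  one_of p q w.
Proof.
case=> Vc Vp Vq d cr Vw wc H.
have [->|wp] := eqVneq w p; first by left.
have [->|wq] := eqVneq w q; first by right.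
exfalso; move: (cr w Vw wc wp wq).
by case: H => H; move: (H p Vp) (H q Vq); rewrite /crs /btw; lia.
Qed.

(** * Arc configurations block *)

Section ArcBlocks.

Variables (E : rel nat) (M n : nat) (f : nat -> nat).
Hypothesis Esym : symmetric E.
Hypothesis arc : forall x, x + 2 <= M -> E x (x + 2).
Hypothesis spoke : forall y, M < y < n -> E (f y) y.
Hypothesis compat : forall y y', M < y -> y < y' -> y' < n -> f y' <= f y + 1.

(* The shape of the polygon is stable under removing unblocked ears: its upper
   chain is an interval [a, b] of the arc, and the two lower vertices next to
   its ends are attached strictly on the far side of those ends. *)
Lemma arc_tri_false V a b :
  tri E V -> b <= M -> a < b ->
  (forall v, v <= M -> V v = (a <= v <= b)) -> (forall v, V v -> v < n) ->
  ((forall v, V v -> v <= M) -> a + 3 <= b) ->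
  (forall R, V R -> M < R -> (forall v, V v -> v <= R) -> a < f R) ->
  (forall L, V L -> M < L -> (forall v, V v -> M < v -> L <= v) -> f L < b) ->
  False.
Proof.
move=> t; elim: t a b => {V} [V x y z sm|V V' c p q e nE V'E _ IH] a b bM ab VT Vn Ve VR VL.
  have Va : V a by rewrite VT; lia.
  have Vb : V b by rewrite VT; lia.
  (* Such a polygon is not small: besides [a] and [b] there are two inner arc vertices, or two lower
     vertices, or the single lower vertex [L] and [a.+1], which is below [b] since a < f L < b. *)
  have [w4 [w5 [V4 V5 h]]] : exists w4 w5, [/\ V w4, V w5 & [&& w4 != w5, w4 != a, w4 != b, w5 != a & w5 != b]].
    case: (boolP [exists s : 'I_n, V s && (M < s)]) => [/existsP[s /andP[Vs Ms]]|]; last first.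
      move/existsPn => no; have h : a + 3 <= b.
        apply: Ve => v Vv; rewrite leqNgt.
        by move: (no (Ordinal (Vn v Vv))); rewrite /= Vv.
      by exists a.+1, a.+2; split; rewrite ?VT; lia.
    have ex : exists s, V s && (M < s) by exists s; rewrite Vs.
    have ub s' : V s' && (M < s') -> s' <= n by case/andP=> /Vn; lia.
    case: (ex_maxnP ex ub) => R /andP[VR' MR] Rm.
    case: (ex_minnP ex) => L /andP[VL' ML] Lm.
    have fR : a < f R.
      apply: VR => // v Vv; case: (leqP v M) => h; first by lia.
      by apply: Rm; rewrite Vv.
    have fL : f L < b by apply: VL => // v Vv Mv; apply: Lm; rewrite Vv.
    case: (ltnP L R) => LR.
      by exists L, R; split => //; lia.
    have LR' : L = R by move: (Lm R); rewrite VR' MR /=; lia.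
    have Va1 : V a.+1 by rewrite VT; lia.
    by exists L, a.+1; split => //; subst; lia.
  move: (sm _ Va) (sm _ Vb) (sm _ V4) (sm _ V5) h => {sm}.
  have ne : a != b by lia.
  move=> A B C D /and5P[]; move: ne.
  by case: A => ->; case: B => ->; rewrite ?eqxx //; case: C => ->; rewrite ?eqxx //;
    case: D => ->; rewrite ?eqxx.
have [Vc Vp Vq d cr] := e.
(* The cut at [c] joins its neighbours and avoids [E]. The contradictions below each exhibit an edge
   of [E] between these neighbours. *)
have nE2 u v : E u v -> one_of p q u -> one_of p q v -> u != v -> False.
  move=> Euv [] ? [] ?; subst => uv; move: uv nE; rewrite ?eqxx //.
    by rewrite Euv.
  by rewrite Esym Euv.
have adj := ear_adjacent e; move: (Vn _ Vc) => cn {d cr Vp Vq}.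
have Va : V a by rewrite VT; lia.
have Vb : V b by rewrite VT; lia.
case: (leqP c M) => cM; last first.
  apply: (IH a b) => //.
  - by move=> v vM; rewrite V'E VT //; lia.
  - by move=> v; rewrite V'E => /andP[/Vn].
  (* Here [c] was the only lower vertex, with a < f c < b. If b = a + 2, the arc edge ab would join
     the neighbours of [c]. *)
  - move=> only; have V'v v : V v -> v <= M \/ v = c.
      by move=> Vv; have := only v; rewrite V'E Vv /=; case: eqVneq => [->|_ /(_ isT)]; auto.
    have fa : a < f c by apply: VR => // v /V'v; lia.
    have fb : f c < b by apply: VL => // v /V'v; lia.
    have [?|?] := leqP (a + 3) b => //; exfalso.
    have ab2 : b = a + 2 by lia.
    apply: (@nE2 a b); try lia; first by rewrite ab2; apply: arc; lia.
      apply: adj => //; first by lia.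
      by right=> v Vv vc va; case: (V'v v Vv) => h; move: (VT v); rewrite ?Vv /btw; lia.
    apply: adj => //; first by lia.
    by left=> v Vv vc va; case: (V'v v Vv) => h; move: (VT v); rewrite ?Vv /btw; lia.
  - move=> R; rewrite V'E => /andP[VR' Rc] MR Rm.
    have Rm' v : V v -> v != c -> v <= R by move=> Vv vc; apply: Rm; rewrite V'E Vv.
    case: (ltnP c R) => cR.
      by apply: VR => // v Vv; case: (eqVneq v c) => [->|/Rm']; [lia|exact].
    have Rc' : R < c by lia.
    have fc : a < f c.
      by apply: VR => // v Vv; case: (eqVneq v c) => [->|/(Rm' _ Vv)]; lia.
    (* Passing from [c] to [R] costs at most one, so a <= f R; equality would make the spoke at [R]
       join the neighbours [a] and [R] of [c]. *)
    have fR := compat MR Rc' cn.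
    case: (ltnP a (f R)) => // h; exfalso; have fRa : f R = a by lia.
    apply: (@nE2 a R); try lia; first by rewrite -{1}fRa; apply: spoke; rewrite MR; lia.
      apply: adj => //; first by lia.
      right=> v Vv vc va; have := Rm' v Vv vc; move: (VT v); rewrite Vv /btw.
      by case: (leqP v M) => h1; [move/(_ isT)|move=> _]; lia.
    apply: adj => //; left=> v Vv vc va; have := Rm' v Vv vc; rewrite /btw; lia.
  - move=> L; rewrite V'E => /andP[VL' Lc] ML Lm.
    have Lm' v : V v -> M < v -> v != c -> L <= v by move=> Vv Mv vc; apply: Lm; rewrite ?V'E ?Vv.
    case: (ltnP L c) => cL.
      by apply: VL => // v Vv Mv; case: (eqVneq v c) => [->|/(Lm' _ Vv Mv)]; lia.
    have Lc' : c < L by lia.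
    have fc : f c < b.
      by apply: VL => // v Vv Mv; case: (eqVneq v c) => [->|/(Lm' _ Vv Mv)]; lia.
    have fL := compat cM Lc' (Vn _ VL').
    case: (ltnP (f L) b) => // h; exfalso; have fLb : f L = b by lia.
    have Ln := Vn _ VL'.
    apply: (@nE2 b L); try lia; first by rewrite -{1}fLb; apply: spoke; rewrite ML.
      apply: adj => //; first by lia.
      left=> v Vv vc va; move: (VT v) (Lm' v Vv); rewrite Vv /btw.
      by case: (leqP v M) => h1; [move=> /(_ isT)|move=> _ /(_ isT vc)]; lia.
    apply: adj => //; left=> v Vv vc va; move: (VT v) (Lm' v Vv); rewrite Vv /btw.
    by case: (leqP v M) => h1; [move=> /(_ isT)|move=> _ /(_ isT vc)]; lia.
have acb : a <= c <= b by rewrite -VT.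
have bot : (forall v, V v -> v <= M) \/ exists L R, [/\ V L, V R, M < L <= R,
    (forall v, V v -> v <= R) & (forall v, V v -> M < v -> L <= v)].
  case: (boolP [exists s : 'I_n, V s && (M < s)]) => [/existsP[s /andP[Vs Ms]]|]; last first.
    move/existsPn => no; left=> v Vv; rewrite leqNgt.
    by move: (no (Ordinal (Vn v Vv))); rewrite /= Vv.
  have ex : exists s, V s && (M < s) by exists s; rewrite Vs.
  have ub s' : V s' && (M < s') -> s' <= n by case/andP=> /Vn; lia.
  case: (ex_maxnP ex ub) => R /andP[VR' MR] Rm.
  case: (ex_minnP ex) => L /andP[VL' ML] Lm; right; exists L, R; split => //.
  - by rewrite ML; apply: Lm; rewrite VR'.
  - move=> v Vv; case: (leqP v M) => h; first by lia.
    by apply: Rm; rewrite Vv.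
  - by move=> v Vv Mv; apply: Lm; rewrite Vv.
have botf L R : V L -> V R -> M < L <= R -> (forall v, V v -> v <= R) ->
    (forall v, V v -> M < v -> L <= v) -> [/\ a < f R, f L < b & f R <= f L + 1].
  move=> VL' VR' /andP[ML LR] Rm Lm; split; [by apply: (VR R VR' _ Rm); lia|exact: (VL L VL' ML Lm)|].
  case: (ltnP L R) => h; last by have -> : L = R; lia.
  by apply: compat => //; apply: Vn.
(* An inner [c] of the arc is protected by an arc edge. If [c] is an end, the interval shrinks by
   one; the missing cut excludes f L = b - 1, respectively f R = a + 1, so the attachment stays
   strict. *)
case: (ltnP a c) => ac.
  case: (ltnP c b) => cb.
    have V1 : V c.-1 by rewrite VT; lia.
    have V2 : V c.+1 by rewrite VT; lia.
    apply: (@nE2 c.-1 c.+1); try lia.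
    - have -> : c.+1 = c.-1 + 2 by lia.
      by apply: arc; lia.
    - by apply: adj => //; [lia|left=> v *; rewrite /btw; lia].
    - by apply: adj => //; [lia|left=> v *; rewrite /btw; lia].
  have cb' : c = b by lia.
  subst c.
  have V1 : V b.-1 by rewrite VT; lia.
  have A1 : one_of p q b.-1 by apply: adj => //; [lia|left=> v *; rewrite /btw; lia].
  case: bot => [only|[L [R [VL' VR' MLR Rm Lm]]]].
    have ab3 := Ve only.
    have A2 : one_of p q a.
      apply: adj => //; first by lia.
      by right=> v Vv *; move: (VT v (only v Vv)); rewrite Vv /btw; lia.
    have nab : b.-1 != a + 2.
      apply/eqP => h; apply: (@nE2 a b.-1) => //; last by lia.
      by rewrite h; apply: arc; lia.
    have [b1M ab1] : b.-1 <= M /\ a < b.-1 by lia.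
    apply: (IH a b.-1) => //.
    - by move=> v vM; rewrite V'E VT //; lia.
    - by move=> v; rewrite V'E => /andP[/Vn].
    - by move=> _; lia.
    - by move=> R; rewrite V'E => /andP[/only]; lia.
    - by move=> R; rewrite V'E => /andP[/only]; lia.
  have [fR fL fRL] := botf L R VL' VR' MLR Rm Lm.
  have A2 : one_of p q L.
    apply: adj => //; first by lia.
    left=> v Vv vb vL; move: (VT v) (Lm v Vv); rewrite Vv /btw.
    by case: (leqP v M) => h1; [move=> /(_ isT)|move=> _ /(_ isT)]; lia.
  have nfL : f L != b.-1.
    apply/eqP => h; apply: (@nE2 b.-1 L) => //; last by lia.
    by rewrite -{1}h; apply: spoke; move: (Vn _ VL'); lia.
  have [b1M ab1] : b.-1 <= M /\ a < b.-1 by lia.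
  apply: (IH a b.-1) => //.
  - by move=> v vM; rewrite V'E VT //; lia.
  - by move=> v; rewrite V'E => /andP[/Vn].
  - by move=> only; move: (only L); rewrite V'E VL'; lia.
  - move=> R'; rewrite V'E => /andP[VR1 _] MR1 Rm1.
    have -> : R' = R by move: (Rm1 R) (Rm R' VR1); rewrite V'E VR'; lia.
    by [].
  - move=> L'; rewrite V'E => /andP[VL1 _] ML1 Lm1.
    have -> : L' = L by move: (Lm1 L) (Lm L' VL1 ML1); rewrite V'E VL'; lia.
    by lia.
have ac' : c = a by lia.
subst c.
have V1 : V a.+1 by rewrite VT; lia.
have A1 : one_of p q a.+1 by apply: adj => //; [lia|left=> v *; rewrite /btw; lia].
case: bot => [only|[L [R [VL' VR' MLR Rm Lm]]]].
  have ab3 := Ve only.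
  have A2 : one_of p q b.
    apply: adj => //; first by lia.
    by right=> v Vv *; move: (VT v (only v Vv)); rewrite Vv /btw; lia.
  have nab : b != a.+1 + 2.
    apply/eqP => h; apply: (@nE2 a.+1 b) => //; last by lia.
    by rewrite h; apply: arc; lia.
  have ab1 : a.+1 < b by lia.
  apply: (IH a.+1 b) => //.
  - by move=> v vM; rewrite V'E VT //; lia.
  - by move=> v; rewrite V'E => /andP[/Vn].
  - by move=> _; lia.
  - by move=> R; rewrite V'E => /andP[/only]; lia.
  - by move=> R; rewrite V'E => /andP[/only]; lia.
have [fR fL fRL] := botf L R VL' VR' MLR Rm Lm.
have A2 : one_of p q R.
  apply: adj => //; first by lia.
  right=> v Vv vb vL; move: (VT v) (Rm v Vv); rewrite Vv /btw.
  by case: (leqP v M) => h1; [move=> /(_ isT)|move=> _]; lia.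
have nfR : f R != a.+1.
  apply/eqP => h; apply: (@nE2 a.+1 R) => //; last by lia.
  by rewrite -{1}h; apply: spoke; move: (Vn _ VR'); lia.
have ab1 : a.+1 < b by lia.
apply: (IH a.+1 b) => //.
- by move=> v vM; rewrite V'E VT //; lia.
- by move=> v; rewrite V'E => /andP[/Vn].
- by move=> only; move: (only L); rewrite V'E VL'; lia.
- move=> R'; rewrite V'E => /andP[VR1 _] MR1 Rm1.
  have -> : R' = R by move: (Rm1 R) (Rm R' VR1); rewrite V'E VR'; lia.
  by lia.
- move=> L'; rewrite V'E => /andP[VL1 _] ML1 Lm1.
  have -> : L' = L by move: (Lm1 L) (Lm L' VL1 ML1); rewrite V'E VL'; lia.
  by [].
Qed.

(** Used against saturation: an edge whose removal leaves such a configuration intact is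
    redundant. *)
Lemma arc_nt : 3 <= M < n -> (forall y, M < y < n -> 0 < f y < M) ->
  nt E (fun v => v < n).
Proof.
move=> Mn ff t; apply: (arc_tri_false t (a := 0) (b := M)) => //=; try lia.
- by move=> R Rn MR _; move: (ff R); rewrite Rn MR; lia.
- by move=> R Rn MR _; move: (ff R); rewrite Rn MR; lia.
Qed.

End ArcBlocks.

(** * Minimum blockers *)

Definition deg_in (n : nat) (E : rel nat) (x : nat) : nat := \sum_(y < n) E x y.

(** Twice the number of edges when [E] is symmetric and irreflexive; counting ordered pairs avoids
    sets of unordered ones. *)
Definition deg_sum (n : nat) (E : rel nat) : nat := \sum_(x < n) deg_in n E x.

Lemma sum_nat_inj n (F : nat -> nat) (g : nat -> nat) :
  (forall x, x < n -> g x < n) ->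
  (forall x y, x < n -> y < n -> g x = g y -> x = y) ->
  \sum_(x < n) F (g x) = \sum_(x < n) F x.
Proof.
move=> gn gi; pose h (x : 'I_n) := Ordinal (gn x (ltn_ord x)).
rewrite [RHS](reindex_inj (h := h)) //.
by move=> x y /(congr1 val) /= /gi e; apply: val_inj; apply: e.
Qed.

Lemma rt_inj n r x y : r < n -> x < n -> y < n -> rt n r x = rt n r y -> x = y.
Proof. by move=> rn xn yn /(congr1 (rt n (n - r))); rewrite !rt_inv. Qed.

Lemma deg_in_rt n E r x : r < n ->
  deg_in n (pull E (rt n r)) x = deg_in n E (rt n r x).
Proof.
move=> rn; apply: (sum_nat_inj (E (rt n r x))); first by move=> *; apply: rt_lt.
by move=> y z yn zn; apply: rt_inj.
Qed.

Lemma deg_sum_rt n E r : r < n -> deg_sum n (pull E (rt n r)) = deg_sum n E.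
Proof.
move=> rn; rewrite /deg_sum; under eq_bigr => x _ do rewrite deg_in_rt //.
apply: (sum_nat_inj (deg_in n E)); first by move=> *; apply: rt_lt.
by move=> y z yn zn; apply: rt_inj.
Qed.

Lemma mr_inj n c x y : c < n -> x < n -> y < n -> mr n c x = mr n c y -> x = y.
Proof. by move=> rn xn yn /(congr1 (mr n c)); rewrite !mr_inv. Qed.

Lemma deg_in_mr n E c x : c < n ->
  deg_in n (pull E (mr n c)) x = deg_in n E (mr n c x).
Proof.
move=> cn; apply: (sum_nat_inj (E (mr n c x))); first by move=> *; apply: mr_lt.
by move=> y z yn zn; apply: mr_inj.
Qed.

Lemma deg_sum_mr n E c : c < n -> deg_sum n (pull E (mr n c)) = deg_sum n E.
Proof.
move=> cn; rewrite /deg_sum; under eq_bigr => x _ do rewrite deg_in_mr //.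
apply: (sum_nat_inj (deg_in n E)); first by move=> *; apply: mr_lt.
by move=> y z yn zn; apply: mr_inj.
Qed.

Lemma deg_in_recr n E x : deg_in n.+1 E x = deg_in n E x + E x n.
Proof. by rewrite /deg_in big_ord_recr. Qed.

Lemma deg_sum_recr n E : symmetric E -> irreflexive E ->
  deg_sum n.+1 E = deg_sum n E + (deg_in n.+1 E n).*2.
Proof.
move=> Es Ei; rewrite /deg_sum big_ord_recr /=.
under eq_bigr => x _ do rewrite deg_in_recr.
rewrite big_split /= deg_in_recr Ei addn0 -addnn addnA; congr (_ + _ + _).
by apply: eq_bigr => x _; rewrite Es.
Qed.

Lemma deg_in_ge1 n (E : rel nat) x y : y < n -> E x y -> 1 <= deg_in n E x.
Proof.
by move=> yn Exy; rewrite /deg_in (bigD1 (Ordinal yn)) //= Exy.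
Qed.

Lemma deg_in_ge2 n (E : rel nat) x y z : y < n -> z < n -> y != z -> E x y -> E x z ->
  2 <= deg_in n E x.
Proof.
move=> yn zn yz Exy Exz; rewrite /deg_in (bigD1 (Ordinal yn)) //= Exy.
rewrite (bigD1 (Ordinal zn)) /=; last by rewrite -val_eqE /= eq_sym.
by rewrite Exz addnA; lia.
Qed.

Lemma deg_in_ge3 n (E : rel nat) x y z w : y < n -> z < n -> w < n ->
  y != z -> y != w -> z != w ->
  E x y -> E x z -> E x w -> 3 <= deg_in n E x.
Proof.
move=> yn zn wn yz yw zw Exy Exz Exw; rewrite /deg_in (bigD1 (Ordinal yn)) //= Exy.
rewrite (bigD1 (Ordinal zn)) /=; last by rewrite -val_eqE /= eq_sym.
rewrite (bigD1 (Ordinal wn)) /=; last by rewrite -!val_eqE /= eq_sym yw eq_sym.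
by rewrite Exz Exw; lia.
Qed.

Lemma deg_in1_uniq n (E : rel nat) x y z : deg_in n E x = 1 -> y < n -> z < n ->
  E x y -> E x z -> y = z.
Proof.
move=> d yn zn Ey Ez; have [//|yz] := eqVneq y z.
by have := deg_in_ge2 yn zn yz Ey Ez; rewrite d.
Qed.

Lemma pull_sym (E : rel nat) g : symmetric E -> symmetric (pull E g).
Proof. by move=> Es x y; apply: Es. Qed.

Lemma pull_irr (E : rel nat) g : irreflexive E -> irreflexive (pull E g).
Proof. by move=> Es x; apply: Es. Qed.

Lemma nt_min_size E n : nt E (fun v => v < n) -> 4 <= n.
Proof.
move=> nV; rewrite leqNgt; apply/negP => n4.
apply: (nt_small (x := 0) (y := 1) (z := 2) nV) => v vn.
have : v < 3 by lia.
by case: v {vn} => [|[|[|v]]] // _; [constructor 1|constructor 2|constructor 3].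
Qed.

Lemma nt_drop_last E n : 2 < n -> nt E (fun v => v < n) -> ~~ E 0 (n - 2) ->
  nt E (fun v => v < n - 1).
Proof.
move=> n2 nV nE; apply: (nt_max nV (a := 0) (b := n - 2) (c := n - 1)) => //=; lia.
Qed.

Lemma deg_sum_lb n E : symmetric E -> irreflexive E -> nt E (fun v => v < n) ->
  n.*2 <= deg_sum n E + 4.
Proof.
elim: n E => [|n IH] E Es Ei nV //.
have n4 := nt_min_size nV.
case: (boolP [exists r : 'I_n.+1, ~~ pull E (rt n.+1 r) 0 (n.+1 - 2)]).
  case/existsP=> r nE; rewrite -(deg_sum_rt E (ltn_ord r)).
  have nV' := nt_rt (ltn_ord r) nV.
  set E' := pull E (rt n.+1 r) in nE nV' *.
  have Es' : symmetric E' by apply: pull_sym.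
  have Ei' : irreflexive E' by apply: pull_irr.
  have nV2 : nt E' (fun v => v < n).
    by apply: nt_ext (nt_drop_last _ nV' nE) => [v|]; lia.
  have := IH E' Es' Ei' nV2; rewrite (deg_sum_recr _ Es' Ei').
  have [x xn Ex] := nt_neighbour nV' Es' (ltnSn n) (fun _ => id).
  by have := deg_in_ge1 xn Ex; lia.
(* No rotation puts a non-ear last, so each x is joined to x + 2 and x - 2. These coincide for four
   vertices only, where degree 1 already suffices. *)
move/existsPn => all.
have Eall x : x < n.+1 -> E x (rt n.+1 x (n.+1 - 2)).
  move=> xn; have := all (Ordinal xn); rewrite negbK /pull /=.
  by rewrite {1}/rt add0n xn.
have back x : x < n.+1 -> E x (rt n.+1 2 x).
  move=> xn; rewrite Es.
  have r2 : rt n.+1 2 x < n.+1 by apply: rt_lt; lia.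
  have := Eall _ r2; suff -> : rt n.+1 (rt n.+1 2 x) (n.+1 - 2) = x by [].
  by rewrite /rt; case: (ltnP (x + 2) n.+1) => ?; case: ifP; lia.
have [n5|n5] := leqP 4 n.
  suff : \sum_(x < n.+1) 2 <= deg_sum n.+1 E by rewrite sum_nat_const card_ord; lia.
  apply: leq_sum => x _.
  have xn := ltn_ord x.
  apply: (deg_in_ge2 _ _ _ (Eall x xn) (back x xn)); rewrite ?rt_lt //; try lia.
  by rewrite /rt; do 2 case: ifP; lia.
suff : \sum_(x < n.+1) 1 <= deg_sum n.+1 E by rewrite sum_nat_const card_ord; lia.
apply: leq_sum => x _; apply: (deg_in_ge1 _ (Eall x (ltn_ord x))).
by apply: rt_lt => //; lia.
Qed.

(** * Zigzag triangulations between the arc and a few lower vertices *)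

Section Staircases.

Variables (E : rel nat) (M : nat).

(** Fans centred at 0, M, p and q strip off all lower vertices except p, q, r. Equalities among
    these are allowed, so that two lower vertices can be kept as well. *)
Lemma keep3 (V : pred nat) n p q r :
  nt E V -> (forall v, V v -> v < n) -> (forall v, v <= M -> V v) ->
  V p -> V q -> V r -> M < p -> p <= q -> q <= r ->
  (forall x, V x -> M < x <= p -> ~~ E M x) ->
  (forall x, V x -> p < x <= q -> ~~ E p x) ->
  (forall x, V x -> q < x <= r -> ~~ E q x) ->
  (forall x, V x -> r <= x -> ~~ E 0 x) ->
  nt E (fun v => [|| v <= M, v == p, v == q | v == r]).
Proof.
move=> nV Vn VM Vp Vq Vr Mp pq qr EM Ep Eq E0.
have V0 : V 0 by apply: VM.
have VM' : V M by apply: VM.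
have n1 : nt E (fun v => V v && (v <= r)).
  by apply: (fan_first (a := 0) (z := r) (n := n) nV) => //=; lia.
have n2 : nt E (fun v => V v && (v <= r) && ~~ (M < v < p)).
  apply: (fan_up (a := M) (b := p) n1) => //=; rewrite ?VM' ?Vp; try lia.
  by move=> x /andP[Vx _]; apply: EM.
have n3 : nt E (fun v => V v && (v <= r) && ~~ (M < v < p) && ~~ (p < v < q)).
  case: (ltnP p q) => h; last by apply: nt_ext n2 => v; lia.
  apply: (fan_up (a := p) (b := q) n2) => //=; rewrite ?Vp ?Vq; try lia.
  by move=> x /andP[/andP[Vx _] _]; apply: Ep.
have n4 : nt E (fun v => V v && (v <= r) && ~~ (M < v < p) && ~~ (p < v < q)
                                  && ~~ (q < v < r)).
  case: (ltnP q r) => h; last by apply: nt_ext n3 => v; lia.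
  apply: (fan_up (a := q) (b := r) n3) => //=; rewrite ?Vr ?Vq; try lia.
  by move=> x /andP[/andP[/andP[Vx _] _] _]; apply: Eq.
apply: nt_ext n4 => v; have := VM v.
have [->|?] := eqVneq v p; first by rewrite Vp; lia.
have [->|?] := eqVneq v q; first by rewrite Vq; lia.
have [->|?] := eqVneq v r; first by rewrite Vr; lia.
by case: (leqP v M) => [?|? _]; [move=> ->|]; lia.
Qed.

Lemma last_column p h : h < M < p ->
  nt E (fun v => (h <= v <= M) || (v == p)) ->
  (forall x, h <= x < M -> ~~ E x p) -> False.
Proof.
move=> hMp nV nE.
have n1 : nt E (fun v => ((h <= v <= M) || (v == p)) && (M - 1 <= v)).
  apply: (fan_last (h := M - 1) (z := p) nV) => //=; try lia.
  by move=> x xV xh; apply: nE; lia.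
apply: (nt_small (x := M - 1) (y := M) (z := p) n1) => v vV.
by have [->|e] := eqVneq v p; [constructor 3|have [->|e'] := eqVneq v M; [constructor 2|constructor 1; lia]].
Qed.

(** The zigzag joins [r] to the arc vertices 0..h and [p] to h..M; [h] is its turning point. In
    [stair3] the middle vertex [q] takes the stretch between two turning points. *)
Lemma stair2 p r h : h < M < p -> p < r ->
  nt E (fun v => [|| v <= M, v == p | v == r]) ->
  (forall x, x <= h -> ~~ E x r) -> (forall x, h <= x < M -> ~~ E x p) -> False.
Proof.
move=> hMp pr nV E1 E2.
have n1 : nt E (fun v => [|| v <= M, v == p | v == r] && (h <= v)).
  apply: (fan_last (h := h) (z := r) nV) => //=; try lia.
  by move=> x xV; apply: E1.
apply: (@last_column p h) => //.
apply: (nt_max n1 (a := h) (b := p) (c := r)) => //=; try lia.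
by apply: E2; lia.
Qed.

Lemma stair3 p q r h h' : h <= h' -> h' < M < p -> p < q < r ->
  nt E (fun v => [|| v <= M, v == p, v == q | v == r]) ->
  (forall x, x <= h -> ~~ E x r) -> (forall x, h <= x <= h' -> ~~ E x q) ->
  (forall x, h' <= x < M -> ~~ E x p) -> False.
Proof.
move=> hh hMp pr nV E1 E2 E3.
have n1 : nt E (fun v => [|| v <= M, v == p, v == q | v == r] && (h <= v)).
  apply: (fan_last (h := h) (z := r) nV) => //=; try lia.
  by move=> x xV; apply: E1.
have n2 : nt E (fun v => [|| v <= M, v == p | v == q] && (h <= v)).
  apply: (nt_max n1 (a := h) (b := q) (c := r)) => //=; try lia.
  by apply: E2; lia.
have n3 : nt E (fun v => [|| v <= M, v == p | v == q] && (h' <= v)).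
  apply: (fan_last (h := h') (z := q) n2) => //=; try lia.
  by move=> x xV xh; apply: E2; lia.
apply: (@last_column p h') => //.
apply: (nt_max n3 (a := h') (b := p) (c := q)) => //=; try lia.
by apply: E3; lia.
Qed.

End Staircases.

(** * Normal form of minimum blockers *)

Definition nonear (n : nat) (E : rel nat) (c : nat) : bool :=
  ~~ E (rt n (n - 1) c) (rt n 1 c).

(** The equality case of [deg_sum_lb], that is, blockers with n - 2 edges. *)
Definition tight (n : nat) (E : rel nat) : Prop :=
  nt E (fun v => v < n) /\ deg_sum n E + 4 = n.*2.

(** The last vertex has degree at least 1, and the lower bound for the n - 1 remaining vertices
    permits no more. *)
Lemma tight_drop_last n E : symmetric E -> irreflexive E -> tight n E ->
  ~~ E 0 (n - 2) -> tight (n - 1) E /\ deg_in n E (n - 1) = 1.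
Proof.
move=> Es Ei [nV ds] nE; have n4 := nt_min_size nV.
have n2 : 2 < n by lia.
have nV1 := nt_drop_last n2 nV nE.
have lb := deg_sum_lb Es Ei nV1.
case: n nV ds nE n4 n2 nV1 lb => // n nV ds nE n4 n2; rewrite subn1 /= => nV1 lb.
have [x xn Ex] := nt_neighbour nV Es (ltnSn n) (fun _ => id).
have d1 := deg_in_ge1 xn Ex.
by move: ds; rewrite (deg_sum_recr _ Es Ei) => ds; split; [split => //|]; lia.
Qed.

Lemma rtC n r s x : r < n -> s < n -> x < n ->
  rt n r (rt n s x) = rt n s (rt n r x).
Proof.
by move=> *; rtlia.
Qed.

Lemma nonear_rt n E r c : 1 < n -> r < n -> c < n ->
  nonear n (pull E (rt n r)) c = nonear n E (rt n r c).
Proof.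
move=> n1 rn cn; rewrite /nonear /pull (rtC rn _ cn); last by lia.
by rewrite (rtC rn n1 cn).
Qed.

Lemma tight_rt n E r : r < n -> tight n E -> tight n (pull E (rt n r)).
Proof. by move=> rn [nV ds]; split; [apply: nt_rt|rewrite deg_sum_rt]. Qed.

Lemma nonear_last n E c : 2 < n -> c < n -> nonear n E c ->
  exists2 r, r < n & rt n r (n - 1) = c /\
                     (symmetric E -> ~~ pull E (rt n r) 0 (n - 2)).
Proof.
move=> n2 cn ne; exists (rt n 1 c); first by apply: rt_lt; lia.
split; first by rtlia.
move=> Es; move: ne; rewrite /nonear Es /pull.
have -> : rt n (rt n 1 c) 0 = rt n 1 c.
  by rtlia.
suff -> : rt n (rt n 1 c) (n - 2) = rt n (n - 1) c by [].
by rtlia.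
Qed.

Lemma tight_nonear_deg n E c : symmetric E -> irreflexive E -> tight n E ->
  c < n -> nonear n E c -> deg_in n E c = 1.
Proof.
move=> Es Ei tE cn ne; have n4 := nt_min_size tE.1.
have n2 : 2 < n by lia.
have [r rn [rc /(_ Es) nE]] := nonear_last n2 cn ne.
have [_] := tight_drop_last (pull_sym _ Es) (pull_irr _ Ei) (tight_rt rn tE) nE.
by rewrite deg_in_rt // rc.
Qed.

(** After deletion of [c] the rest still blocks, so [d] keeps a neighbour; but its only edge went to
    [c]. *)
Lemma tight_nonear_edge n E c d : symmetric E -> irreflexive E -> tight n E ->
  c < n -> d < n -> nonear n E c -> nonear n E d -> ~~ E c d.
Proof.
move=> Es Ei tE cn dn nc nd; apply/negP => Ecd; have n4 := nt_min_size tE.1.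
have d1 := tight_nonear_deg Es Ei tE dn nd.
have n2 : 2 < n by lia.
have [r rn [rc /(_ Es) nE]] := nonear_last n2 cn nc.
have [[nV _] _] := tight_drop_last (pull_sym _ Es) (pull_irr _ Ei) (tight_rt rn tE) nE.
have dc : d != c by apply/eqP => h; move: Ecd; rewrite h Ei.
have [d' d'n d'd] : exists2 d', d' < n & rt n r d' = d.
  exists (rt n (n - r) d); rtlia.
have d'n1 : d' < n - 1.
  by have [e|] := eqVneq d' (n - 1); [move: dc; rewrite -d'd -rc e eqxx|lia].
have [x xn Ex] := nt_neighbour nV (pull_sym _ Es) d'n1 (fun _ => id).
have xn' : x < n by lia.
have : rt n r x = c.
  apply: (deg_in1_uniq d1) => //; first exact: rt_lt.
    by move: Ex; rewrite /pull d'd.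
  by rewrite Es.
by rewrite -rc => /rt_inj; lia.
Qed.

(** Provides a non-ear in every tight blocker with at least five vertices. A quadrilateral with both
    diagonals is tight and has none. *)
Lemma all_ears_deg_sum n E : 4 < n -> symmetric E ->
  (forall x, x < n -> ~~ nonear n E x) -> n.*2 <= deg_sum n E.
Proof.
move=> n4 Es all.
have E2 x : x < n -> E x (rt n 2 x).
  move=> xn; have := all _ (@rt_lt n 1 x xn ltac:(lia)).
  rewrite /nonear negbK.
  suff [-> ->] : rt n (n - 1) (rt n 1 x) = x /\ rt n 1 (rt n 1 x) = rt n 2 x by [].
  by rtlia.
have E3 x : x < n -> E x (rt n (n - 2) x).
  move=> xn; have := E2 _ (@rt_lt n (n - 2) x xn ltac:(lia)); rewrite Es.
  suff -> : rt n 2 (rt n (n - 2) x) = x by [].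
  by rtlia.
suff : \sum_(x < n) 2 <= deg_sum n E by rewrite sum_nat_const card_ord; lia.
apply: leq_sum => x _; have xn := ltn_ord x.
apply: (deg_in_ge2 _ _ _ (E2 x xn) (E3 x xn)); rewrite ?rt_lt //; try lia.
by rtlia.
Qed.

(* All vertices 1..M-1 of the arc 0..M are ears, and y > M has a spoke to f y. *)
Definition arc_rel (M : nat) (f : nat -> nat) (x y : nat) : bool :=
  ((y == x + 2) && (y <= M)) || ((M < y) && (x == f y)).

(** Spokes at y < y' cross exactly when f y < f y'; the inequality thus says that crossing spokes
    end at adjacent arc vertices. *)
Definition compatible (n M : nat) (f : nat -> nat) : Prop :=
  forall y y', M < y -> y < y' -> y' < n -> f y' <= f y + 1.

Definition std (n M : nat) (f : nat -> nat) (E : rel nat) : Prop :=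
  [/\ 3 <= M < n,
      forall x y, x < y -> y < n -> E x y = arc_rel M f x y,
      forall y, M < y < n -> 0 < f y < M &
      compatible n M f].

(** The excluded values are those for which M or 0 would be an ear, so the arc is a complete run. *)
Definition maximal_arc (n M : nat) (f : nat -> nat) : Prop :=
  M.+1 < n -> (f M.+1 != M - 1) && (f (n - 1) != 1).

Lemma std_compatible n M f E : symmetric E -> irreflexive E ->
  nt E (fun v => v < n) -> 3 <= M < n ->
  (forall x y, x < y -> y < n -> E x y = arc_rel M f x y) ->
  (forall y, M < y < n -> 0 < f y < M) -> compatible n M f.
Proof.
move=> Es Ei nV Mn EE fM y y' My yy' y'n; rewrite leqNgt; apply/negP => ff.
have fy := fM y; have fy' := fM y'.
(* The turning point f y' - 1 lies strictly between f y and f y', so both fans miss the spokes. *)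
apply: (@stair2 E M y y' (f y' - 1)) => //; first by lia.
- suff: nt E (fun v => [|| v <= M, v == y, v == y | v == y']).
    by apply: nt_ext => v; lia.
  apply: (keep3 (n := n) nV) => //=; try lia.
  + by move=> x xn xy; rewrite EE /arc_rel; have := fM x; lia.
  + by move=> x xn xy; rewrite EE /arc_rel; have := fM x; lia.
  + by move=> x xn xy; rewrite EE /arc_rel; have := fM x; lia.
- by move=> x xh; rewrite EE /arc_rel; lia.
- by move=> x xh; rewrite EE /arc_rel; lia.
Qed.

Section PeelRun.

Variables (n : nat) (E : rel nat).
Hypotheses (n5 : 5 <= n) (Es : symmetric E) (Ei : irreflexive E).
Hypotheses (tE : tight n E) (noside : forall x, x.+1 < n -> ~~ E x x.+1).
Hypotheses (ne0 : nonear n E 0) (e1 : ~~ nonear n E 1).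

Let nV : nt E (fun v => v < n) := tE.1.

Lemma nonearE c : 0 < c -> c.+1 < n -> nonear n E c = ~~ E c.-1 c.+1.
Proof.
move=> c0 cn; rewrite /nonear.
suff [-> ->] : rt n (n - 1) c = c.-1 /\ rt n 1 c = c.+1 by [].
by rtlia.
Qed.

Lemma nbr0 x : x < n -> E 0 x -> x = 2.
Proof.
move=> xn Ex; have e02 : E 0 2 by move: e1; rewrite nonearE ?negbK //; lia.
have d := tight_nonear_deg Es Ei tE (ltac:(lia) : 0 < n) ne0.
by apply: (deg_in1_uniq d) => //; lia.
Qed.

(** If no k >= 2 were a non-ear, n - 1 would be an ear and n - 2 a second neighbour of 0. The first
    such k is not 2, because the edge 02 would join two non-ears. *)
Lemma run_end : exists M, [/\ 3 <= M < n, nonear n E M &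
                              forall k, 0 < k < M -> E k.-1 k.+1].
Proof.
have ex : exists k, [&& 2 <= k, k < n & nonear n E k].
  case: (boolP [exists k : 'I_n, (2 <= k) && nonear n E k]) => [/existsP[k /andP[k2 ne]]|].
    by exists k; rewrite k2 ltn_ord.
  move/existsPn => all.
  have := all (Ordinal (ltac:(lia) : n - 1 < n)); rewrite /= /nonear.
  have -> : rt n (n - 1) (n - 1) = n - 2 by rtlia.
  have -> : rt n 1 (n - 1) = 0 by rtlia.
  by rewrite negb_and negbK Es => /orP[|e]; [|have := @nbr0 (n - 2) _ e]; lia.
case: (ex_minnP ex) => M /and3P[M2 Mn neM] Mm.
have ears k : 0 < k < M -> E k.-1 k.+1.
  move=> kM; have [->|k1] := eqVneq k 1; first by move: e1; rewrite nonearE ?negbK //; lia.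
  by have := Mm k; rewrite nonearE; lia.
exists M; split => //; rewrite Mn andbT ltn_neqAle M2 andbT; apply/eqP => h.
have := tight_nonear_edge Es Ei tE (ltac:(lia) : 0 < n) Mn ne0 neM.
by rewrite -h (ears 1); lia.
Qed.

Variable M : nat.
Hypotheses (M3 : 3 <= M < n) (neM : nonear n E M).
Hypothesis ears : forall k, 0 < k < M -> E k.-1 k.+1.

Lemma nbrM x : x < n -> E M x -> x = M - 2.
Proof.
move=> xn Ex.
have eM : E M (M - 2).
  have kM : 0 < M - 1 < M by lia.
  have := ears kM; have -> : (M - 1).-1 = M - 2 by lia.
  have -> : (M - 1).+1 = M by lia.
  by rewrite Es.
have d := tight_nonear_deg Es Ei tE (ltac:(lia) : M < n) neM.
by apply: (deg_in1_uniq d) => //; lia.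
Qed.

Lemma peel K : 4 <= K <= n -> tight K E.
Proof.
move=> Kn; have -> : K = n - (n - K) by lia.
have : n - K <= n - 4 by lia.
elim: (n - K) => [|d IH] dn; first by rewrite subn0.
have [t _] : tight (n - d - 1) E /\ deg_in (n - d) E (n - d - 1) = 1.
  apply: tight_drop_last => //; first by apply: IH; lia.
  by apply/negP => e; have := nbr0 _ e; lia.
by have -> : n - d.+1 = n - d - 1 by lia.
Qed.

Lemma peel_deg y : 4 <= y < n -> deg_in y.+1 E y = 1.
Proof.
move=> yn; have [] := @tight_drop_last y.+1 E Es Ei.
- by apply: peel; lia.
- by apply/negP => e; have := nbr0 _ e; lia.
- by rewrite subn1.
Qed.

(** Cut the polygon down to 0..y. There [y] is a non-ear, as 0 is joined to 2 only, and [x] is one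
    because by induction its neighbours are not joined; two non-ears are never joined. The case x =
    M is [nbrM]. *)
Lemma no_lower_edge K x y : M < K <= n -> M <= x < y -> y < K -> ~~ E x y.
Proof.
elim: K x y => [|K IH] x y Kn xy yK; first by lia.
have [yK'|yK'] := ltnP y K; first by apply: (IH x y) => //; lia.
have ?: y = K by lia.
subst y; apply/negP => Exy.
have [xM|xM] := eqVneq x M.
  by have := @nbrM K; rewrite -xM Exy; lia.
have [xK|xK] := eqVneq x.+1 K.
  by have := @noside x; rewrite xK Exy; lia.
have t : tight K.+1 E by apply: peel; lia.
have := tight_nonear_edge Es Ei t (ltac:(lia) : x < K.+1) (ltac:(lia) : K < K.+1).
rewrite Exy /nonear => H; apply: notF; apply: H.
  have -> : rt K.+1 (K.+1 - 1) x = x.-1 by rtlia.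
  have -> : rt K.+1 1 x = x.+1 by rtlia.
  by apply: IH; lia.
have -> : rt K.+1 (K.+1 - 1) K = K.-1 by rtlia.
have -> : rt K.+1 1 K = 0 by rtlia.
by rewrite Es; apply/negP => /nbr0; lia.
Qed.

(** For y >= 4, the vertex [y] has a single edge towards smaller labels, and the ear [y - 1]
    supplies it. *)
Lemma top_edge x y : x < y <= M -> E x y = (y == x + 2).
Proof.
move=> xy; have arc z : z.+2 <= M -> E z z.+2 by move=> zM; apply: (@ears z.+1); lia.
apply/idP/eqP => [Exy|yx]; last first.
  by rewrite yx addn2; apply: arc; lia.
have side := @noside x.
have [y4|y4] := leqP 4 y.
  have d : deg_in y.+1 E y = 1 by apply: peel_deg; lia.
  have := deg_in1_uniq (y := x) (z := y - 2) d.
  have e : E y (y - 2).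
    rewrite Es; have := arc (y - 2); have -> : (y - 2).+2 = y by lia.
    by apply; lia.
  rewrite Es Exy => /(_ ltac:(lia) ltac:(lia) isT e) => ?; lia.
have [x0|x0] := eqVneq x 0.
  by rewrite x0 in Exy *; apply: nbr0; [lia|].
have [?|yx] := eqVneq y x.+1; last by lia.
by subst y; move: side; rewrite Exy; lia.
Qed.

Lemma lower_nbr y : M < y < n ->
  exists2 x, 0 < x < M & forall z, z < y -> E z y = (z == x).
Proof.
move=> My; have t : tight y.+1 E by apply: peel; lia.
have [x xn Eyx] := nt_neighbour t.1 Es (ltnSn y) (fun _ => id).
have d : deg_in y.+1 E y = 1 by apply: peel_deg; lia.
have xy : x != y by apply/eqP => h; move: Eyx; rewrite h Ei.
have x0 : x != 0.
  by apply/eqP => h; have := @nbr0 y; rewrite -h Es Eyx; lia.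
have xM : x != M.
  by apply/eqP => h; have := @nbrM y; rewrite -h Es Eyx; lia.
have xlM : x < M.
  rewrite ltnNge; apply/negP => h.
  have := @no_lower_edge y.+1 x y; rewrite Es Eyx => H.
  by have := H ltac:(lia) ltac:(lia) ltac:(lia).
exists x => [|z zy]; first by lia.
apply/idP/eqP => [Ezy|->]; last by rewrite Es.
by apply: (deg_in1_uniq d); rewrite // ?[E y z]Es //; lia.
Qed.

End PeelRun.

Lemma nat_choice n (P : nat -> nat -> Prop) :
  (forall y, y < n -> exists x, P y x) -> exists f, forall y, y < n -> P y (f y).
Proof.
elim: n => [|n IH] H; first by exists id.
have [f fP] := IH (fun y yn => H y (ltnW yn)).
have [x xP] := H n (ltnSn n).
exists (fun y => if y == n then x else f y) => y.
by rewrite ltnS leq_eqVlt; case: eqVneq => [->|_ /fP].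
Qed.

Lemma std_of_run n E : 5 <= n -> symmetric E -> irreflexive E -> tight n E ->
  (forall x, x.+1 < n -> ~~ E x x.+1) -> nonear n E 0 -> ~~ nonear n E 1 ->
  exists M f, std n M f E /\ maximal_arc n M f.
Proof.
move=> n5 Es Ei tE noside ne0 e1.
have [M [Mn neM ears]] := run_end n5 Es Ei tE ne0 e1.
have low := lower_nbr n5 Es Ei tE noside ne0 e1 Mn neM ears.
have top := top_edge n5 Es Ei tE noside ne0 e1 Mn neM ears.
have [f fP] : exists f, forall y, y < n -> M < y ->
    0 < f y < M /\ forall z, z < y -> E z y = (z == f y).
  apply: (@nat_choice n (fun y x => M < y -> 0 < x < M /\ forall z, z < y -> E z y = (z == x))) => y yn.
  case: (ltnP M y) => h; last by exists 0.
  by have [x] := low y ltac:(lia); exists x.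
have EE x y : x < y -> y < n -> E x y = arc_rel M f x y.
  move=> xy yn; rewrite /arc_rel; have [My|My] := ltnP M y; last first.
    by rewrite top; lia.
  by rewrite (fP y yn My).2 //; lia.
have fM y : M < y < n -> 0 < f y < M.
  by case/andP=> My yn; have [] := fP y yn My.
exists M, f; split; first by split => //; apply: (std_compatible Es Ei tE.1 Mn EE fM).
move=> Mn1; apply/andP; split; apply/eqP => h.
  move: neM; rewrite (nonearE) //; try lia.
  by rewrite EE /arc_rel ?h; lia.
move: ne0; rewrite /nonear.
have -> : rt n (n - 1) 0 = n - 1 by rtlia.
have -> : rt n 1 0 = 1 by rtlia.
by rewrite Es EE /arc_rel ?h; lia.
Qed.

Lemma tight_std n E : 5 <= n -> symmetric E -> irreflexive E -> tight n E ->
  (forall x, x < n -> ~~ E x (rt n 1 x)) ->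
  exists r M f, [/\ r < n, std n M f (pull E (rt n r)) & maximal_arc n M f].
Proof.
move=> n5 Es Ei tE noside.
have [c0 c0n ne0] : exists2 c, c < n & nonear n E c.
  case: (boolP [exists c : 'I_n, nonear n E c]) => [/existsP[c]|/existsPn all].
    by exists c.
  have := @all_ears_deg_sum n E n5 Es; have := tE.2 => ds H; exfalso.
  by have := H (fun x xn => all (Ordinal xn)); lia.
(* An ear exists since a neighbour of a non-ear is an ear. *)
have [x1 x1n e1] : exists2 c, c < n & ~~ nonear n E c.
  have [y yn E0y] := nt_neighbour tE.1 Es (ltac:(lia) : 0 < n) (fun _ => id).
  have [ne|] := boolP (nonear n E 0); last by exists 0; [lia|].
  have [ne'|] := boolP (nonear n E y); last by exists y.
  by have := tight_nonear_edge Es Ei tE (ltac:(lia) : 0 < n) yn ne ne'; rewrite E0y.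
(* Otherwise being a non-ear would propagate round the polygon from [c0] to the ear [x1]. *)
have [r rn [ner er]] : exists2 r, r < n & nonear n E r /\ ~~ nonear n E (rt n 1 r).
  case: (boolP [exists r : 'I_n, nonear n E r && ~~ nonear n E (rt n 1 r)]).
    by case/existsP=> r /andP[]; exists r.
  move/existsPn => all; exfalso.
  have step c : c < n -> nonear n E c -> nonear n E (rt n 1 c).
    by move=> cn ne; have := all (Ordinal cn); rewrite /= ne negbK.
  have it k : k < n -> nonear n E (rt n k c0).
    elim: k => [|k IH] kn; first by have -> : rt n 0 c0 = c0 by rtlia.
    have -> : rt n k.+1 c0 = rt n 1 (rt n k c0) by rtlia.
    by apply: step; [apply: rt_lt; lia|apply: IH; lia].
  have := it (rt n (n - c0) x1); have -> : rt n (rt n (n - c0) x1) c0 = x1 by rtlia.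
  by rewrite (negbTE e1) => /(_ ltac:(rtlia)).
have [M [f [s mx]]] : exists M f, std n M f (pull E (rt n r)) /\ maximal_arc n M f.
  apply: std_of_run => //.
  - exact: pull_sym.
  - exact: pull_irr.
  - exact: tight_rt.
  - move=> x xn; rewrite /pull; have -> : rt n r x.+1 = rt n 1 (rt n r x) by rtlia.
    by apply: noside; apply: rt_lt; lia.
  - by rewrite nonear_rt //; try lia; have -> : rt n r 0 = r by rtlia.
  - by rewrite nonear_rt //; try lia; have -> : rt n r 1 = rt n 1 r by rtlia.
by exists r, M, f.
Qed.

(** * Insertion of a vertex of degree two *)

Definition del (x y : nat) (E : rel nat) : rel nat :=
  fun a b => E a b && ~~ (((a == x) && (b == y)) || ((a == y) && (b == x))).

(** The blocker of the theorem as a relation: 2n - 2 is twice its n - 1 edges, and [nm_side] records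
    that sides are not diagonals. *)
Record near_min (n : nat) (E : rel nat) : Prop := NearMin {
  nm_sym : symmetric E;
  nm_irr : irreflexive E;
  nm_nt : nt E (fun v => v < n);
  nm_side : forall x, x < n -> ~~ E x (rt n 1 x);
  nm_deg : deg_sum n E + 2 = n.*2;
  nm_sat : forall x y, x < n -> y < n -> E x y -> ~ nt (del x y E) (fun v => v < n)
}.

(* In the three shapes P is the m + 2 of the statement, and [g y] is the arc end of
   the spoke at y = m + 2 + j, that is i_j. *)
Definition shape1 (n : nat) (E : rel nat) : Prop :=
  exists P l g, [/\ 6 <= P < n, 2 < l < P - 2,
    forall y, P < y < n -> (0 < g y < P) && (g y != l),
    compatible n P g &
    forall x y, x < y -> y < n -> E x y =
      if y <= P then
        [|| (x == l - 2) && (y == l), (x == l - 2) && (y == l + 1),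
            (x == l - 1) && (y == l + 2), (x == l) && (y == l + 2) |
            (y == x + 2) && ((y < l) || (l < x))]
      else x == g y].

Definition shape2 (n : nat) (E : rel nat) : Prop :=
  exists P l g, [/\ 7 <= P < n, 2 < l < P - 3,
    forall y, P < y < n -> [&& 0 < g y < P, g y != l & g y != l + 1],
    compatible n P g &
    forall x y, x < y -> y < n -> E x y =
      if y <= P then
        [|| (x == l - 2) && (y == l), (x == l - 2) && (y == l + 1),
            (x == l - 1) && (y == l + 2), (x == l) && (y == l + 3),
            (x == l + 1) && (y == l + 3) |
            (y == x + 2) && ((y < l) || (l + 1 < x))]
      else x == g y].

(** Here [k'] is k + t, and the bouquet spokes are absorbed into [g]. Compatibility is asked on each
    side of the bouquet separately; across it, g y >= l >= g y' holds anyway. *)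
Definition shape3 (n : nat) (E : rel nat) : Prop :=
  exists P l k k' g, [/\ [&& 0 < l, l < P, P < k, k + 1 < k' & k' < n],
    forall y, P < y < n ->
      [/\ y < k -> l <= g y < P, y = k -> g y = l - 1,
          k < y < k' -> g y = l, y = k' -> g y = l + 1 &
          k' < y -> 0 < g y <= l],
    forall y y', P < y -> y < y' -> y' < n -> y' < k \/ k' < y -> g y' <= g y + 1 &
    forall x y, x < y -> y < n -> E x y =
      if y <= P then y == x + 2
      else (x == g y) || ((x == k) && (y == k'))].

Definition classified (n : nat) (E : rel nat) : Prop :=
  exists2 r, r < n & let F := pull E (rt n r) in
    shape1 n F \/ shape2 n F \/ shape3 n F.

Lemma del_pull E g n x y : symmetric E -> x < n -> y < n ->
  (forall a b, a < n -> b < n -> g a = g b -> a = b) ->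
  forall a b, a < n -> b < n ->
  del x y (pull E g) a b = del (g x) (g y) E (g a) (g b).
Proof.
move=> Es xn yn gi a b an bn; rewrite /del /pull.
have ge c d : c < n -> d < n -> (g c == g d) = (c == d).
  by move=> cn dn; apply/eqP/eqP => [/gi|->] //; apply.
by rewrite !ge.
Qed.

Lemma near_min_rt n E r : r < n -> near_min n E -> near_min n (pull E (rt n r)).
Proof.
move=> rn [Es Ei nV sd ds sat]; split.
- exact: pull_sym.
- exact: pull_irr.
- exact: nt_rt.
- move=> x xn; rewrite /pull; have -> : rt n r (rt n 1 x) = rt n 1 (rt n r x) by rtlia.
  by apply: sd; apply: rt_lt.
- by rewrite deg_sum_rt.
- move=> x y xn yn Exy nd.
  apply: (sat (rt n r x) (rt n r y)) => //; try exact: rt_lt.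
  move=> t; apply: nd.
  (* [rt n (n - r) 0] is n - r reduced modulo n, hence a legitimate rotation also for r = 0. *)
  have sn : rt n (n - r) 0 < n by rtlia.
  apply: (tri_rt sn); apply: tri_mono t => a b an bn.
  have an' := @rt_lt n (rt n (n - r) 0) a an sn.
  have bn' := @rt_lt n (rt n (n - r) 0) b bn sn.
  rewrite {1}/pull (del_pull Es xn yn (fun a b => @rt_inj n r a b rn)) //.
  have inv c : c < n -> rt n r (rt n (rt n (n - r) 0) c) = c by move=> cn; rtlia.
  by rewrite !inv.
Qed.

Lemma near_min_mr n E c : c < n -> near_min n E -> near_min n (pull E (mr n c)).
Proof.
move=> cn [Es Ei nV sd ds sat]; have n4 := nt_min_size nV; split.
- exact: pull_sym.
- exact: pull_irr.
- exact: nt_mr.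
- move=> x xn; rewrite /pull Es.
  have -> : mr n c x = rt n 1 (mr n c (rt n 1 x)) by rtlia.
  by apply: sd; apply: mr_lt => //; apply: rt_lt; lia.
- by rewrite deg_sum_mr.
- move=> x y xn yn Exy nd.
  apply: (sat (mr n c x) (mr n c y)) => //; try exact: mr_lt.
  move=> t; apply: nd.
  apply: (tri_mr cn); apply: tri_mono t => a b an bn.
  have an' := @mr_lt n c a an cn.
  have bn' := @mr_lt n c b bn cn.
  rewrite {1}/pull (del_pull Es xn yn (fun a b => @mr_inj n c a b cn)) //.
  by rewrite !mr_inv.
Qed.

Lemma shape_ext n (E F : rel nat) : (forall x y, x < n -> y < n -> E x y = F x y) ->
  shape1 n E \/ shape2 n E \/ shape3 n E -> shape1 n F \/ shape2 n F \/ shape3 n F.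
Proof.
move=> EF [[P [l [g [A B C D EE]]]]|[[P [l [g [A B C D EE]]]]|[P [l [k [k' [g [A B C EE]]]]]]]].
- by left; exists P, l, g; split=> // x y xy yn; rewrite -EF ?EE //; lia.
- by right; left; exists P, l, g; split=> // x y xy yn; rewrite -EF ?EE //; lia.
- by right; right; exists P, l, k, k', g; split=> // x y xy yn; rewrite -EF ?EE //; lia.
Qed.

Lemma classified_rt n E r : r < n -> classified n (pull E (rt n r)) -> classified n E.
Proof.
move=> rn [s sn H]; exists (rt n r s); first exact: rt_lt.
apply: shape_ext H => x y xn yn; rewrite /pull.
have e z : z < n -> rt n r (rt n s z) = rt n (rt n r s) z by move=> zn; rtlia.
by rewrite !e.
Qed.

Lemma mr_low n P y : P < y < n -> P < mr n P y < n /\ mr n P y = P + n - y.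
Proof. by move=> h; rtlia. Qed.

Lemma mr_top n P y : y <= P -> mr n P y = P - y.
Proof. by move=> h; rtlia. Qed.

Lemma compatible_mr n P g : (forall y, P < y < n -> 0 < g y < P) ->
  compatible n P g -> compatible n P (fun y => P - g (mr n P y)).
Proof.
move=> gP co y y' Py yy' y'n.
have [m1 e1] := @mr_low n P y ltac:(lia); have [m2 e2] := @mr_low n P y' ltac:(lia).
have := gP _ m1; have := gP _ m2.
by have := co (mr n P y') (mr n P y); lia.
Qed.

Lemma mirror_shape n P (E R R' : rel nat) g : P < n -> symmetric E ->
  (forall y, P < y < n -> 0 < g y < P) ->
  (forall x y, x < y -> y < n -> E x y = if y <= P then R x y else x == g y) ->
  (forall x y, x < y <= P -> R (P - y) (P - x) = R' x y) ->
  forall x y, x < y -> y < n -> pull E (mr n P) x y =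
    if y <= P then R' x y else x == P - g (mr n P y).
Proof.
move=> Pn Es gP EE RR x y xy yn; rewrite /pull.
case: leqP => yP.
  rewrite !mr_top; try lia; rewrite Es EE; try lia.
  have -> : P - x <= P by lia.
  by rewrite RR // xy.
have [m1 e1] := @mr_low n P y ltac:(lia).
have gy := gP _ m1.
have [xP|xP] := leqP x P.
  rewrite mr_top // EE; try lia.
  have -> : (mr n P y <= P) = false by lia.
  by lia.
have [m2 e2] := @mr_low n P x ltac:(lia); have := gP _ m2.
rewrite Es EE; try lia.
have -> : (mr n P x <= P) = false by lia.
by lia.
Qed.

Lemma shape1_mr n E : symmetric E -> shape1 n E ->
  exists2 P, P < n & shape1 n (pull E (mr n P)).
Proof.
move=> Es [P [l [g [Pn lP gP co EE]]]]; exists P; first by lia.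
have gP' y : P < y < n -> 0 < g y < P by move/gP/andP=> [].
exists P, (P - l), (fun y => P - g (mr n P y)); split => //; first by lia.
- by move=> y /mr_low[] /gP; lia.
- exact: compatible_mr.
- apply: (mirror_shape _ Es gP' EE); first by lia.
  move=> x y xy.
  have -> : (P - y == l - 2) && (P - x == l) = (x == P - l) && (y == P - l + 2) by lia.
  have -> : (P - y == l - 2) && (P - x == l + 1) = (x == P - l - 1) && (y == P - l + 2) by lia.
  have -> : (P - y == l - 1) && (P - x == l + 2) = (x == P - l - 2) && (y == P - l + 1) by lia.
  have -> : (P - y == l) && (P - x == l + 2) = (x == P - l - 2) && (y == P - l) by lia.
  have -> : (P - x == P - y + 2) = (y == x + 2) by lia.
  have -> : (P - x < l) || (l < P - y) = (y < P - l) || (P - l < x) by lia.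
  by do 5 case: (_ && _).
Qed.

Lemma shape2_mr n E : symmetric E -> shape2 n E ->
  exists2 P, P < n & shape2 n (pull E (mr n P)).
Proof.
move=> Es [P [l [g [Pn lP gP co EE]]]]; exists P; first by lia.
have gP' y : P < y < n -> 0 < g y < P by move/gP/andP=> [].
exists P, (P - l - 1), (fun y => P - g (mr n P y)); split => //; first by lia.
- by move=> y /mr_low[] /gP; lia.
- exact: compatible_mr.
- apply: (mirror_shape _ Es gP' EE); first by lia.
  move=> x y xy; set l' := P - l - 1.
  have -> : (P - y == l - 2) && (P - x == l) = (x == l' + 1) && (y == l' + 3) by lia.
  have -> : (P - y == l - 2) && (P - x == l + 1) = (x == l') && (y == l' + 3) by lia.
  have -> : (P - y == l - 1) && (P - x == l + 2) = (x == l' - 1) && (y == l' + 2) by lia.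
  have -> : (P - y == l) && (P - x == l + 3) = (x == l' - 2) && (y == l' + 1) by lia.
  have -> : (P - y == l + 1) && (P - x == l + 3) = (x == l' - 2) && (y == l') by lia.
  have -> : (P - x == P - y + 2) = (y == x + 2) by lia.
  have -> : (P - x < l) || (l + 1 < P - y) = (y < l') || (l' + 1 < x) by lia.
  by do 6 case: (_ && _).
Qed.

Lemma shape3_mr n E : symmetric E -> shape3 n E ->
  exists2 P, P < n & shape3 n (pull E (mr n P)).
Proof.
move=> Es [P [l [k [k' [g [lP gP co EE]]]]]]; exists P; first by lia.
have gP' y : P < y < n -> g y <= P.
  move/gP=> [h1 h2 h3 h4 h5].
  case: (ltngtP y k) => [/h1|yk|/h2]; try (clear h1 h2 h3 h4 h5; lia).
  case: (ltngtP y k') => [yk'|/h5|/h4]; try (clear h1 h2 h3 h4 h5; lia).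
  by rewrite h3 ?yk //; clear h1 h2 h3 h4 h5; lia.
exists P, (P - l), (P + n - k'), (P + n - k), (fun y => P - g (mr n P y)).
split => //; first by lia.
- move=> y /mr_low[m1 e1] /=; move: (gP _ m1); move: (mr n P y) m1 e1 => z m1 e1.
  move: (g z) => gz [h1 h2 h3 h4 h5].
  split=> h; [clear h1 h2 h3 h4|clear h1 h2 h3 h5|clear h1 h2 h4 h5|
              clear h1 h3 h4 h5|clear h2 h3 h4 h5]; lia.
- move=> y y' Py yy' y'n H.
  have [m1 e1] := @mr_low n P y ltac:(lia); have [m2 e2] := @mr_low n P y' ltac:(lia).
  have := gP' _ m1; have := gP' _ m2.
  by have := co (mr n P y') (mr n P y); lia.
- move=> x y xy yn; rewrite /pull.
  case: leqP => yP.
    rewrite !mr_top; try lia; rewrite Es EE; try lia.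
    have -> : P - x <= P by lia.
    by lia.
  have [m1 e1] := @mr_low n P y ltac:(lia).
  have gy := gP' _ m1.
  have [xP|xP] := leqP x P.
    rewrite mr_top // EE; try lia.
    have -> : (mr n P y <= P) = false by lia.
    by lia.
  have [m2 e2] := @mr_low n P x ltac:(lia); have gx := gP' _ m2.
  rewrite Es EE; try lia.
  have -> : (mr n P x <= P) = false by lia.
  have -> : (mr n P y == g (mr n P x)) = false by lia.
  have -> : (x == P - g (mr n P y)) = false by lia.
  by lia.
Qed.

Lemma rt_mr n r c z : r < n -> c < n -> z < n ->
  rt n r (mr n c z) = mr n (rt n r c) z.
Proof.
move=> rn cn zn; case: (mr_spec n c z) => -[h ->]; case: (rt_spec n r c) => -[h' ->];
  rtlia.
Qed.

Lemma mr_mr n c d z : c < n -> d < n -> z < n ->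
  mr n c (mr n d z) = rt n (mr n c d) z.
Proof.
move=> cn dn zn; case: (mr_spec n d z) => -[h ->]; case: (mr_spec n c d) => -[h' ->];
  rtlia.
Qed.

(** Each shape survives the reflection x -> P - x reversing its arc, and two reflections compose to
    a rotation; so a reflected classification is a classification. *)
Lemma classified_mr n E c : symmetric E -> c < n ->
  classified n (pull E (mr n c)) -> classified n E.
Proof.
move=> Es cn [r rn H].
set F := pull _ _ in H.
have Fs : symmetric F by do 2 apply: pull_sym.
have [P Pn H'] : exists2 P, P < n &
    let G := pull F (mr n P) in shape1 n G \/ shape2 n G \/ shape3 n G.
  case: H => [/(shape1_mr Fs)|[/(shape2_mr Fs)|/(shape3_mr Fs)]] [P Pn H]; exists P => //; cbv zeta; tauto.
exists (mr n c (rt n r P)); first by apply: mr_lt => //; apply: rt_lt.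
apply: shape_ext H' => x y xn yn; rewrite /F /pull.
have e z : z < n -> mr n c (rt n r (mr n P z)) = rt n (mr n c (rt n r P)) z.
  by move=> zn; rewrite rt_mr // mr_mr // rt_lt.
by rewrite !e.
Qed.

(** An arc configuration with one extra lower vertex [U] whose edges are left open. The last clause
    says that 0 and M are non-ears, except where [U] has become their neighbour. *)
Definition bottom_form (n M U : nat) (g : nat -> nat) (E : rel nat) : Prop :=
  [/\ 3 <= M < U /\ U < n,
      forall x y, x < y -> y < n -> x != U -> y != U -> E x y = arc_rel M g x y,
      forall y, M < y < n -> y != U -> 0 < g y < M,
      forall y y', M < y -> y < y' -> y' < n -> y != U -> y' != U -> g y' <= g y + 1 &
      (U != n - 1 -> g (n - 1) != 1) /\ (U != M + 1 -> g (M + 1) != M - 1)].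

(** * The inserted vertex lies outside the arc *)

Section Bottom.

Variables (n M U : nat) (g : nat -> nat) (E : rel nat).
Hypotheses (nm : near_min n E) (bf : bottom_form n M U g E).
Variables (a b : nat).
Hypotheses (an : a < n) (bn : b < n) (ab : a != b).
Hypothesis EU : forall v, v < n -> E U v = (v == a) || (v == b).

Let Es : symmetric E := nm_sym nm.
Let nV : nt E (fun v => v < n) := nm_nt nm.

Lemma bottom_arc : 3 <= M < U /\ U < n. Proof. by case: bf. Qed.

Lemma bottom_range y : M < y < n -> y != U -> 0 < g y < M.
Proof. by case: bf => _ _ + _ _; apply. Qed.

Lemma bottom_edge x y : x < y -> y < n -> E x y =
  [|| (x == U) && ((y == a) || (y == b)), (y == U) && ((x == a) || (x == b)) |
      [&& x != U, y != U & arc_rel M g x y]].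
Proof.
move=> xy yn; have [_ EE _ _ _] := bf; have := bottom_arc => MU.
have [->|xU] := eqVneq x U; first by rewrite EU //=; lia.
have [->|yU] := eqVneq y U; first by rewrite Es EU //=; lia.
by rewrite EE.
Qed.

Lemma bottom_nbr : [/\ a != U, a.+1 != U, a != U.+1 & a = 0 -> U != n - 1].
Proof.
have := bottom_arc => MU.
have sU := nm_side nm (ltac:(lia) : U < n); have sU' := nm_side nm (ltac:(lia) : U - 1 < n).
have e : E U a by rewrite EU ?eqxx.
split; [apply/negP => h|apply/negP => h|apply/negP => h|move=> a0; apply/negP => h].
- by move: e; rewrite (eqP h) (nm_irr nm).
- by move: sU'; have -> : rt n 1 (U - 1) = U; [rtlia|have -> : U - 1 = a by lia]; rewrite Es e.
- by move: sU; have -> : rt n 1 U = a; [rtlia|]; rewrite e.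
- by move: sU; have -> : rt n 1 U = a; [rtlia|]; rewrite e.
Qed.

End Bottom.

Section Bottom2.

Variables (n M U : nat) (g : nat -> nat) (E : rel nat).
Hypotheses (nm : near_min n E) (bf : bottom_form n M U g E).
Variables (a b : nat).
Hypotheses (an : a < n) (bn : b < n) (ab : a != b).
Hypothesis EU : forall v, v < n -> E U v = (v == a) || (v == b).

Let Es : symmetric E := nm_sym nm.
Let nV : nt E (fun v => v < n) := nm_nt nm.
Let MU : 3 <= M < U /\ U < n := bottom_arc bf.
Let gM := bottom_range bf.
Let Ef := bottom_edge nm bf an bn ab EU.

Let EU' v : v < n -> E U v = (v == b) || (v == a).
Proof. by move=> vn; rewrite EU // orbC. Qed.

Let aU := bottom_nbr nm bf an bn ab EU.
Let ba : b != a. Proof. by rewrite eq_sym. Qed.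
Let bU := bottom_nbr nm bf bn an ba EU'.

(** The tool for locating [a] and [b]: cuts that remove both of them but keep [U] are
    contradictory. *)
Lemma bottom_isolated (V : pred nat) :
  nt E V -> V U -> (forall v, V v -> v < n) -> V a || V b.
Proof.
move=> nV' VU Vn; have [x Vx] := nt_neighbour nV' Es VU Vn.
by rewrite EU ?Vn // => /orP[] /eqP <-; rewrite Vx ?orbT.
Qed.

(* If there is no such s, the spoke (U, a) alone would complete the arc structure, making
   (U, b) redundant. *)
Lemma bottom_sat : 0 < a < M -> exists2 s, M < s < n /\ s != U &
  (U < s /\ a + 2 <= g s) \/ (s < U /\ g s + 2 <= a).
Proof.
move=> aM.
case: (boolP [exists s : 'I_n, [&& M < s, s != U :> nat &
    ((U < s) && (a + 2 <= g s)) || ((s < U) && (g s + 2 <= a))]]).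
  case/existsP=> s /and3P[Ms sU H]; exists s; first by split; rewrite ?Ms ?ltn_ord.
  by case/orP: H => /andP[? ?]; [left|right].
move/existsPn => no; exfalso.
apply: (nm_sat nm (x := U) (y := b)) => //; first by lia.
  by rewrite EU // eqxx orbT.
have noP s : M < s < n -> s != U ->
    (U < s -> g s <= a + 1) /\ (s < U -> a <= g s + 1).
  move=> /andP[Ms sn] sU; have := no (Ordinal sn); rewrite /= Ms sU; lia.
have [_ _ _ co _] := bf.
have bUn : b != U by case: bU.
apply: (@arc_nt _ M n (fun v => if v == U then a else g v)).
- by move=> x y; rewrite /del Es; congr (_ && ~~ _); lia.
- move=> x xM; rewrite /del Ef /arc_rel; lia.
- move=> y My; rewrite /del; case: eqVneq => [yU|yU].
    by rewrite yU Es EU ?eqxx /=; lia.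
  by have := gM My yU => ?; rewrite Ef /arc_rel; lia.
- move=> y y' My yy' y'n; case: eqVneq => [yU|yU]; case: eqVneq => [y'U|y'U]; try lia.
  + by have [] := @noP y ltac:(lia) ltac:(lia); lia.
  + by have [] := @noP y' ltac:(lia) ltac:(lia); lia.
  + exact: co.
- lia.
- by move=> y My; case: eqVneq => [//|]; apply: gM.
Qed.

(** Fans centred at 0 and M remove every lower vertex except [U], which would then be isolated. *)
Lemma bottom_low : M < a -> M < b -> False.
Proof.
move=> Ma Mb.
have n1 : nt E (fun v => v <= U).
  apply: (fan_first (a := 0) (z := U) (n := n) nV) => //=; try lia.
  by move=> x xn Ux; rewrite Ef /arc_rel; have := @gM x; lia.
have n2 : nt E (fun v => (v <= U) && ~~ (M < v < U)).
  apply: (fan_up (a := M) (b := U) n1) => //=; try lia.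
  by move=> x xn Ux; rewrite Ef /arc_rel; have := @gM x; lia.
have := bottom_isolated n2; case: aU bU => ? ? ? ? [? ? ? ?].
by move/(_ ltac:(lia) ltac:(lia)); lia.
Qed.

Lemma bottom_no_edge x y : (x == 0) || (M <= x) -> M < y -> x < y -> y < n ->
  x != U -> y != U -> ~~ E x y.
Proof.
have [_ EE _ _ _] := bf; move=> xM My xy yn xU yU; rewrite EE // /arc_rel.
have := gM (y := y) ltac:(lia) yU; move: xM My xy; clear; lia.
Qed.

Lemma bottom_U_no_edge y : y < n -> y != a -> y != b -> ~~ E y U.
Proof. by move=> yn ya yb; rewrite Es EU // negb_or ya. Qed.

Lemma bottom_keep p q r : 0 < a < M -> 0 < b < M ->
  M < p -> p <= q -> q <= r -> r < n ->
  nt E (fun v => [|| v <= M, v == p, v == q | v == r]).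
Proof.
move=> aM bM Mp pq qr rn; apply: (keep3 (n := n) nV) => //=; try lia.
- by move=> x xn xp; rewrite Ef /arc_rel; have := @gM x; lia.
- by move=> x xn xp; rewrite Ef /arc_rel; have := @gM x; lia.
- by move=> x xn xp; rewrite Ef /arc_rel; have := @gM x; lia.
- by move=> x xn xp; rewrite Ef /arc_rel; have := @gM x; lia.
Qed.

(** The zigzag with turning point g s - 1 joins [s] to smaller arc vertices than g s and [U] to
    larger ones than [a] and [b]. In [bottom_left], where s < U, the turning point is g s + 1. *)
Lemma bottom_right s : a < M -> b < M -> U < s < n ->
  a + 2 <= g s -> b + 2 <= g s -> False.
Proof.
move=> aM bM Us ags bgs; have gs := @gM s.
apply: (@stair2 E M U s (g s - 1)); try lia.
- suff: nt E (fun v => [|| v <= M, v == U, v == U | v == s]).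
    by apply: nt_ext => v; lia.
  apply: (keep3 (n := n) nV) => //=; try lia.
  + by move=> x xn xp; rewrite Ef /arc_rel; have := @gM x; lia.
  + by move=> x xn xp; rewrite Ef /arc_rel; have := @gM x; lia.
  + by move=> x xn xp; rewrite Ef /arc_rel; have := @gM x; lia.
- by move=> x xh; rewrite Ef /arc_rel; lia.
- by move=> x xh; rewrite Ef /arc_rel; lia.
Qed.

Lemma bottom_left s : 0 < a < M -> 0 < b < M -> M < s < U ->
  g s + 2 <= a -> g s + 2 <= b -> False.
Proof.
move=> aM bM Us ags bgs; have gs := @gM s.
apply: (@stair2 E M s U (g s + 1)); try lia.
- suff: nt E (fun v => [|| v <= M, v == s, v == s | v == U]).
    by apply: nt_ext => v; lia.
  by apply: bottom_keep; lia.
- by move=> x xh; rewrite Ef /arc_rel; lia.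
- by move=> x xh; rewrite Ef /arc_rel; lia.
Qed.

Lemma bottom_between s s' : 0 < a < M -> 0 < b < M -> M < s' < U -> U < s < n ->
  a + 2 <= g s -> g s' + 2 <= b -> False.
Proof.
move=> aM bM s'U Us ags bgs; have gs := @gM s; have gs' := @gM s'.
have [_ _ _ co _] := bf.
have gg : g s <= g s' + 1 by apply: co; lia.
(* The stretch of [U] from g s - 1 to g s' + 1 lies strictly between [a] and [b]; it is nonempty
   because g s <= g s' + 1. *)
apply: (@stair3 E M s' U s (g s - 1) (g s' + 1)); try lia.
- by apply: bottom_keep; lia.
- by move=> x xh; rewrite Ef /arc_rel; lia.
- by move=> x xh; rewrite Ef /arc_rel; lia.
- by move=> x xh; rewrite Ef /arc_rel; lia.
Qed.

(* Removing b leaves (U, a) as the only edge at U. *)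
Lemma bottom_mixed_compat v : 0 < a < M -> M < b -> M < v < n -> v != U -> v != b ->
  (U < v -> g v <= a + 1) /\ (v < U -> a <= g v + 1).
Proof.
move=> aM Mb Mv vU vb; have gv := @gM v; case: bU => bUn ? ? _.
(* [b] is a lower vertex and not next to [U], so its neighbours are not joined and it can be cut
   off. *)
have nb : nt E (fun v => (v < n) && (v != b)).
  have [bl|bl] := eqVneq b (n - 1).
    apply: (nt_max nV (a := 0) (b := n - 2) (c := b)) => //=; try lia.
    by rewrite Ef /arc_rel; have := @gM (n - 2); lia.
  apply: (nt_mid nV (a := b - 1) (b := b + 1) (c := b)) => //=; try lia.
    by move=> w wn; case: (ltngtP w b) => h; [constructor 1|constructor 3|constructor 2]; lia.
  by rewrite Ef /arc_rel; have := @gM (b + 1); lia.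
have low x y : (x == 0) || (M <= x) -> M < y -> x < y -> y < n ->
    x != b -> y != b -> ~~ E x y.
  move=> xM My xy yn xb yb.
  have [xU|xU] := eqVneq x U.
    by rewrite Es xU bottom_U_no_edge //; lia.
  have [yU|yU] := eqVneq y U; last exact: bottom_no_edge.
  by rewrite yU bottom_U_no_edge //; lia.
have k3 p q r : M < p -> p <= q -> q <= r -> r < n -> p != b -> q != b -> r != b ->
    nt E (fun v => [|| v <= M, v == p, v == q | v == r]).
  move=> Mp pq qr rn pb qb rb; move: MU.1 bUn => MU1 bUn'.
  apply: (keep3 (n := n) nb); rewrite /= ?pb ?qb ?rb; clear - low Mp pq qr rn MU1 Mb pb qb rb; try lia.
  - by move=> x xn xp; apply: low; lia.
  - by move=> x xn xp; apply: low; lia.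
  - by move=> x xn xp; apply: low; lia.
  - by move=> x xn xp; apply: low; lia.
split=> Uv; rewrite leqNgt; apply/negP => h.
- apply: (@stair2 E M U v (g v - 1)); try lia.
  + have := k3 U U v ltac:(lia) ltac:(lia) ltac:(lia) ltac:(lia).
    by move=> K; apply: nt_ext (K _ _ _) => [w|||]; lia.
  + by move=> x xh; rewrite Ef /arc_rel; lia.
  + by move=> x xh; rewrite Ef /arc_rel; lia.
- apply: (@stair2 E M v U (g v + 1)); try lia.
  + have := k3 v v U ltac:(lia) ltac:(lia) ltac:(lia) ltac:(lia).
    by move=> K; apply: nt_ext (K _ _ _) => [w|||]; lia.
  + by move=> x xh; rewrite Ef /arc_rel; lia.
  + by move=> x xh; rewrite Ef /arc_rel; lia.
Qed.

(** By [bottom_mixed_compat] the obstruction from [bottom_sat] can only be the spoke at [b]. The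
    spokes at [b] and [U] then end two apart, and with the edge Ub they delimit the bouquet, whose
    centre l is the arc vertex in between. *)
Lemma bottom_mixed : 0 < a < M -> M < b -> shape3 n E.
Proof.
move=> aM Mb; have [_ _ _ co _] := bf; case: bU => bUn bU1 bU2 _.
have cmp v := @bottom_mixed_compat v aM Mb.
have [s [/andP[Ms sn] sU] H] := bottom_sat aM.
have [sb|sb] := eqVneq s b; last by have := cmp s; lia.
subst s; have gb := @gM b.
have [bU'|bU'] := ltnP b U.
  have h1 v : b < v < U -> a <= g v + 1 /\ g v <= g b + 1.
    by move=> bv; have [_ ] := cmp v ltac:(lia) ltac:(lia) ltac:(lia); have := co b v; lia.
  (* Since Ub is not a side, [b.+1] lies strictly between them; its spoke is within one of both g b
     and [a]. *)
  have ga : a = g b + 2 by have := h1 b.+1; lia.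
  exists M, (a - 1), b, U, (fun v => if v == U then a else g v); split; first by lia.
  - move=> y yn; case: eqVneq => [yU|yU]; first by split; lia.
    have gy := @gM y.
    have := cmp y; have := h1 y; have := co y b; have := co b y => *.
    by split => *; try lia; subst y; lia.
  - move=> y y' My yy' y'n H'; case: eqVneq => [y'U|y'U]; case: eqVneq => [yU|yU]; try lia.
    by apply: co.
  - move=> x y xy yn; rewrite Ef // /arc_rel; case: leqP => yM; first by lia.
    by have := @gM y; case: eqVneq => [yU|yU] ; lia.
have h1 v : U < v < b -> g v <= a + 1 /\ g b <= g v + 1.
  by move=> bv; have [] := cmp v ltac:(lia) ltac:(lia) ltac:(lia); have := co v b; lia.
have ga : g b = a + 2 by have := h1 U.+1; lia.
exists M, (a + 1), U, b, (fun v => if v == U then a else g v); split; first by lia.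
- move=> y yn; case: eqVneq => [yU|yU]; first by split; lia.
  have gy := @gM y.
  have := cmp y; have := h1 y; have := co y b; have := co b y => *.
  by split => *; try lia; subst y; lia.
- move=> y y' My yy' y'n H'; case: eqVneq => [y'U|y'U]; case: eqVneq => [yU|yU]; try lia.
  by apply: co.
- move=> x y xy yn; rewrite Ef // /arc_rel; case: leqP => yM; first by lia.
  by have := @gM y; case: eqVneq => [yU|yU] ; lia.
Qed.

End Bottom2.

(** * The inserted vertex is joined to an end of the arc *)

Section BottomZero.

Variables (n M U : nat) (g : nat -> nat) (E : rel nat).
Hypotheses (nm : near_min n E) (bf : bottom_form n M U g E).
Variable b : nat.
Hypotheses (n0 : 0 < n) (bn : b < n) (b0 : 0 != b).
Hypothesis EU : forall v, v < n -> E U v = (v == 0) || (v == b).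

Let Es : symmetric E := nm_sym nm.
Let nV : nt E (fun v => v < n) := nm_nt nm.
Let MU : 3 <= M < U /\ U < n := bottom_arc bf.
Let gM := bottom_range bf.
Let Ef := bottom_edge nm bf n0 bn b0 EU.

Let EU' v : v < n -> E U v = (v == b) || (v == 0).
Proof. by move=> vn; rewrite EU // orbC. Qed.

Let b0' : b != 0. Proof. by rewrite eq_sym. Qed.
Let aU := bottom_nbr nm bf n0 bn b0 EU.
Let bU := bottom_nbr nm bf bn n0 b0' EU'.

Let Un : U < n - 1.
Proof. by case: aU => _ _ _ /(_ erefl); lia. Qed.

Let g_last : 1 < g (n - 1) < M.
Proof.
have [_ _ _ _ [/(_ ltac:(lia)) e0 _]] := bf.
by have := @gM (n - 1); lia.
Qed.

(** 0 is a non-ear: U is not n - 1, as U0 is not a side, and the spoke at n - 1 does not end at 1.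
    Afterwards [b] is the only neighbour of [U]. *)
Lemma drop_zero : nt E (fun v => 0 < v < n).
Proof.
apply: (nt_min nV (c := 0) (a := 1) (b := n - 1)) => //=; try lia.
by rewrite Ef /arc_rel; lia.
Qed.

Lemma zero_low_false s : U < s < n - 1 -> b != s.
Proof.
move=> Us; apply/eqP => bs.
have n1 : nt E (fun v => (0 < v < n) && ~~ (U < v < n - 1)).
  apply: (fan_down (a := U) (b := n - 1) drop_zero) => //=; try lia.
  by move=> x xn Ux; rewrite Ef /arc_rel; lia.
by have := bottom_isolated nm EU n1 ltac:(cbv beta; lia) ltac:(cbv beta; lia); lia.
Qed.

Lemma zero_high_false s : M <= s < U -> b != s.
Proof.
move=> Us; apply/eqP => bs; case: bU => ? ? ? _.
have [_ _ _ _ [_ /(_ ltac:(lia)) eM]] := bf.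
have gM1 := @gM (M + 1).
have [sM|sM] := eqVneq s M; last first.
  have n1 : nt E (fun v => (0 < v < n) && ~~ (M < v < U)).
    apply: (fan_up (a := M) (b := U) drop_zero) => //=; try lia.
    by move=> x xn Ux; rewrite Ef /arc_rel; have := @gM x; lia.
  by have := bottom_isolated nm EU n1 ltac:(cbv beta; lia) ltac:(cbv beta; lia); lia.
have n2 : nt E (fun v => (0 < v < n) && (v != M)).
  apply: (nt_mid drop_zero (a := M - 1) (c := M) (b := M + 1)) => //=; try lia.
    by move=> w wn; case: (ltngtP w M) => h; [constructor 1|constructor 3|constructor 2]; lia.
  by rewrite Ef /arc_rel; lia.
by have := bottom_isolated nm EU n2 ltac:(cbv beta; lia) ltac:(cbv beta; lia); lia.
Qed.

Lemma zero_top_false : 0 < b < M -> False.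
Proof.
move=> bM.
have [s [/andP[Ms sn] sU] [[Us bs]|[sU' bs]]] := bottom_sat nm bf bn n0 b0' EU' bM.
  by apply: (bottom_right nm bf n0 bn b0 EU (s := s)); lia.
have gs := @gM s.
(* With 0 gone, only [b] matters at [U], and the zigzag of [U] and [s] over the arc 1..M with
   turning point g s + 1 avoids it. *)
have n1 : nt E (fun v => (0 < v < n) && ~~ (U < v < n - 1)).
  apply: (fan_up (a := U) (b := n - 1) drop_zero) => //=; try lia.
  by move=> x xn Ux; rewrite Ef /arc_rel; lia.
have n2 : nt E (fun v => 0 < v <= U).
  apply: (nt_max n1 (a := 1) (b := U) (c := n - 1)) => //=; try lia.
  by rewrite Ef /arc_rel; lia.
have n3 : nt E (fun v => (0 < v <= U) && ~~ (M < v < s)).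
  apply: (fan_up (a := M) (b := s) n2) => //=; try lia.
  by move=> x xn Ux; rewrite Ef /arc_rel; have := @gM x; lia.
have n4 : nt E (fun v => [|| 0 < v <= M, v == s | v == U]).
  apply: (fan_up (a := s) (b := U) n3) => //=; try lia.
  by move=> x xn Ux; rewrite Ef /arc_rel; have := @gM x; lia.
have n5 : nt E (fun v => [|| g s + 1 <= v <= M, v == s | v == U]).
  apply: (fan_last (h := g s + 1) (z := U) n4) => //=; try lia.
  by move=> x xn Ux; rewrite Ef /arc_rel; lia.
have n6 : nt E (fun v => (g s + 1 <= v <= M) || (v == s)).
  apply: (nt_max n5 (a := g s + 1) (b := s) (c := U)) => //=; try lia.
  by rewrite Ef /arc_rel; lia.
apply: (last_column _ n6); first by lia.
by move=> x xM; rewrite Ef /arc_rel; lia.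
Qed.

(** Only b = n - 1 is left, and this is a bouquet with centre 1, k = U and k' = n - 1. A lower
    vertex v between them has its spoke to 1: otherwise 0 and then n - 1 could be cut off, the
    latter along 1v, isolating [U]. *)
Lemma bottom_zero : shape3 n E.
Proof.
have bl : b = n - 1.
  case: bU => ? _ _ _.
  have [bM|bM] := ltnP b M; first by case: zero_top_false; lia.
  have [bU1|bU1] := ltnP b U.
    by have := @zero_high_false b; rewrite eqxx bM bU1 => /(_ isT).
  have [//|bl] := eqVneq b (n - 1).
  by have := @zero_low_false b; rewrite eqxx => H; have := H ltac:(lia).
have g1 v : U < v < n - 1 -> g v = 1.
  move=> vU; have gv := @gM v; apply/eqP/negPn/negP => g1.
  have n1 : nt E (fun v' => (0 < v' < n) && ~~ (v < v' < n - 1)).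
    apply: (fan_up (a := v) (b := n - 1) drop_zero) => //=; try lia.
    by move=> x xn Ux; rewrite Ef /arc_rel; have := @gM x; lia.
  have n2 : nt E (fun v' => 0 < v' <= v).
    apply: (nt_max n1 (a := 1) (b := v) (c := n - 1)) => //=; try lia.
    by rewrite Ef /arc_rel; lia.
  by have := bottom_isolated nm EU n2 ltac:(cbv beta; lia) ltac:(cbv beta; lia); lia.
case: bU => ? ? ? _; have [_ _ _ co _] := bf.
have g2 : g (n - 1) = 2.
  by have := g1 (n - 2) ltac:(lia); have := co (n - 2) (n - 1); lia.
exists M, 1, U, (n - 1), (fun v => if v == U then 0 else g v); split; first by lia.
- move=> y yn; case: eqVneq => [yU|yU]; first by split; lia.
  have := @gM y; have := g1 y => ? ?.
  by split => *; try lia; subst y; lia.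
- move=> y y' My yy' y'n H'; case: eqVneq => [y'U|y'U]; case: eqVneq => [yU|yU]; try lia.
  by apply: co.
- move=> x y xy yn; rewrite Ef // /arc_rel; case: leqP => yM; first by lia.
  by have := @gM y; case: eqVneq => [yU|yU] ; lia.
Qed.

End BottomZero.

Lemma bottom_form_mr n M U g E : symmetric E -> bottom_form n M U g E ->
  bottom_form n M (mr n M U) (fun y => M - g (mr n M y)) (pull E (mr n M)).
Proof.
move=> Es [MU EE gM co [e0 eM]].
have [mU eU] := @mr_low n M U ltac:(lia).
have inv y : M < y < n -> y != mr n M U -> mr n M y != U by rtlia.
split; first by lia.
- move=> x y xy yn xU yU; rewrite /pull /arc_rel.
  have [yM|yM] := leqP y M.
    by rewrite !mr_top; try lia; rewrite Es EE /arc_rel; lia.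
  have [m1 e1] := @mr_low n M y ltac:(lia).
  have gy := gM _ m1 (inv y ltac:(lia) yU).
  have [xM|xM] := leqP x M.
    by rewrite mr_top // EE /arc_rel; lia.
  have [m2 e2] := @mr_low n M x ltac:(lia).
  have gx := gM _ m2 (inv x ltac:(lia) xU).
  by rewrite Es EE /arc_rel; lia.
- move=> y yn yU; have [m1 e1] := @mr_low n M y ltac:(lia).
  by have := gM _ m1 (inv y yn yU); lia.
- move=> y y' My yy' y'n yU y'U.
  have [m1 e1] := @mr_low n M y ltac:(lia); have [m2 e2] := @mr_low n M y' ltac:(lia).
  have i1 := inv y ltac:(lia) yU; have i2 := inv y' ltac:(lia) y'U.
  have := gM _ m1 i1; have := gM _ m2 i2; have := co (mr n M y') (mr n M y); lia.
- split=> h.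
    have e : mr n M (n - 1) = M + 1 by rtlia.
    rewrite e; have := gM (M + 1); have := eM; lia.
  have e : mr n M (M + 1) = n - 1 by rtlia.
  rewrite e; have := gM (n - 1); have := e0; lia.
Qed.

Lemma shape3_classified n E : 0 < n -> shape3 n E -> classified n E.
Proof.
move=> n0 s; exists 0 => //; cbv zeta; apply: (@shape_ext n E); last by right; right.
move=> x y xn yn; rewrite /pull; have -> : rt n 0 x = x by rtlia.
by have -> : rt n 0 y = y by rtlia.
Qed.

(** Saturation applied to either edge at [U] yields a spoke too far from the other end. Depending on
    their sides of [U], one of them violates [bottom_left] or [bottom_right], or both together
    violate [bottom_between]. *)
Lemma bottom_tops n M U g E a b : near_min n E -> bottom_form n M U g E ->
  a < b -> 0 < a -> b < M -> (forall v, v < n -> E U v = (v == a) || (v == b)) -> False.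
Proof.
move=> nm bf ab a0 bM EU.
have EU' v : v < n -> E U v = (v == b) || (v == a) by move=> vn; rewrite EU // orbC.
have MU := bottom_arc bf.
have an : a < n by lia. have bn : b < n by lia.
have nab : a != b by lia. have nba : b != a by lia.
have aM : 0 < a < M by lia. have bM' : 0 < b < M by lia.
have [s [sn sU] H] := bottom_sat nm bf an bn nab EU aM.
have [t [tn tU] H'] := bottom_sat nm bf bn an nba EU' bM'.
case: H => -[Us gs]; last by apply: (bottom_left nm bf an bn nab EU (s := s)); lia.
case: H' => -[Ut gt]; first by apply: (bottom_right nm bf an bn nab EU (s := t)); lia.
by apply: (bottom_between nm bf an bn nab EU (s := s) (s' := t)); lia.
Qed.

Lemma bottom_classified n M U g E a b : near_min n E -> bottom_form n M U g E ->
  a < b < n -> (forall v, v < n -> E U v = (v == a) || (v == b)) -> classified n E.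
Proof.
move=> nm bf abn EU; have MU := bottom_arc bf; have Es := nm_sym nm.
have EU' v : v < n -> E U v = (v == b) || (v == a) by move=> vn; rewrite EU // orbC.
have an : a < n by lia. have bn : b < n by lia.
have nab : a != b by lia. have nba : b != a by lia.
have [a0|a0] := eqVneq a 0.
  subst a; apply: shape3_classified; first by lia.
  exact: (bottom_zero nm bf (b := b)).
(* The reflection x -> M - x turns this into the case of an edge to 0. *)
have [aM|aM] := boolP ((a == M) || (b == M)).
  have Mn : M < n by lia.
  apply: (classified_mr Es Mn); apply: shape3_classified; first by lia.
  have inv := @mr_inv n M; have low := @mr_lt n M.
  pose c := if a == M then b else a.
  have EUc v : v < n -> E U v = (v == M) || (v == c).
    by move=> vn; rewrite EU // /c; move: aM; case: eqVneq => h ; lia.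
  have cn : c < n by rewrite /c; case: ifP; lia.
  have cM : c != M by rewrite /c; move: aM; case: eqVneq; lia.
  apply: (bottom_zero (near_min_mr Mn nm) (bottom_form_mr Es bf) (b := mr n M c)).
  - lia.
  - exact: low.
  - by move: (mr_spec n M c); lia.
  - move=> v vn; rewrite /pull inv //; last by lia.
    rewrite EUc ?low //; move: (mr_spec n M c) (mr_spec n M v); lia.
have [Ma|Ma] := ltnP M a.
  by case: (bottom_low nm bf an bn nab EU Ma); lia.
have [Mb|Mb] := ltnP M b.
  by apply: shape3_classified; [lia|apply: (bottom_mixed nm bf an bn nab EU); lia].
by case: (bottom_tops nm bf (a := a) (b := b) _ _ _ EU); lia.
Qed.

(* The arc 0..P contains one inserted vertex U; the indices [f y] ignore U. *)
Definition top_form (n P U : nat) (f : nat -> nat) (E : rel nat) : Prop :=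
  [/\ 4 <= P < n /\ 0 < U < P,
      forall x y, x < y -> y < n -> x != U -> y != U -> E x y =
        (if y <= P then y == x + 2 + (x < U < y) else x == f y + (U <= f y)),
      forall y, P < y < n -> 0 < f y < P - 1 &
      compatible n P f].

(** The sum 2n - 2 loses twice the degree of [c] and must stay at least 2n - 6. The rotation starts
    the labels right after [c], so [c] is last. *)
Lemma near_min_drop n E c : near_min n E -> c < n -> nonear n E c ->
  deg_in n E c <= 2 /\
  (2 <= deg_in n E c -> tight (n - 1) (pull E (rt n (rt n 1 c)))).
Proof.
move=> [Es Ei nV _ ds _] cn ne; have n4 := nt_min_size nV.
have n2 : 2 < n by lia.
have rn : rt n 1 c < n by apply: rt_lt; lia.
have nV' := nt_rt rn nV.
have e1 : rt n (rt n 1 c) (n - 1) = c by rtlia.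
have e2 : rt n (rt n 1 c) (n - 2) = rt n (n - 1) c by rtlia.
have e0 : rt n (rt n 1 c) 0 = rt n 1 c by rtlia.
have nE : ~~ pull E (rt n (rt n 1 c)) 0 (n - 2) by rewrite /pull e0 e2 Es.
have nV2 := nt_drop_last n2 nV' nE.
have Fs : symmetric (pull E (rt n (rt n 1 c))) by apply: pull_sym.
have Fi : irreflexive (pull E (rt n (rt n 1 c))) by apply: pull_irr.
have lb := deg_sum_lb Fs Fi nV2.
have := deg_sum_recr (n - 1) Fs Fi.
have -> : (n - 1).+1 = n by lia.
rewrite deg_sum_rt // deg_in_rt // e1 => dE.
by split=> [|d2]; [|split => //]; lia.
Qed.

Lemma nt_drop n E c a b : nt E (fun v => v < n) -> ~~ E a b ->
  a < c < b -> b < n -> (c == a.+1) && (b == c.+1) ->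
  nt E (fun v => (v < n) && (v != c)).
Proof.
move=> nV nE acb bn e; apply: (nt_mid nV (a := a) (c := c) (b := b)) => //=; try lia.
by move=> w wn; case: (ltngtP w c) => h; [constructor 1|constructor 3|constructor 2]; lia.
Qed.

(** * The inserted vertex lies inside the arc *)

Section Top.

Variables (n P U : nat) (f : nat -> nat) (E : rel nat).
Hypotheses (nm : near_min n E) (tf : top_form n P U f E).
Let Es : symmetric E := nm_sym nm.
Let Ei : irreflexive E := nm_irr nm.
Let nV : nt E (fun v => v < n) := nm_nt nm.

Lemma top_bounds : 4 <= P < n /\ 0 < U < P. Proof. by case: tf. Qed.

Lemma top_range y : P < y < n -> 0 < f y < P - 1.
Proof. by case: tf => _ _ + _; apply. Qed.

Lemma top_edge_arc x y : x < y -> y <= P -> x != U -> y != U ->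
  E x y = (y == x + 2 + (x < U < y)).
Proof. by case: tf => ? EE _ _ xy yP xU yU; rewrite EE ?yP //; lia. Qed.

Lemma top_edge_spoke x y : x < y -> P < y < n -> x != U ->
  E x y = (x == f y + (U <= f y)).
Proof.
case: tf => ? EE _ _ xy yP xU; rewrite EE //; try lia.
by have -> : (y <= P) = false by lia.
Qed.

(** Without the chord from U to U - 2, the vertex U - 1 is a non-ear. Its arc edges to U - 3 and U +
    2 exhaust its degree, so it receives no spoke and its deletion leaves a tight blocker. There U +
    1, and U - 2 if U >= 4, has two arc edges and must be an ear. *)
Lemma top_gap : 3 <= U <= P - 3 -> ~~ E U (U - 2) ->
  [/\ forall y, P < y < n -> f y != U - 1, E U (U + 2) & 4 <= U -> E U (U - 3)].
Proof.
move=> U3 nE; have [Pn UP] := top_bounds.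
have Un : U - 1 < n by lia.
have rU : rt n 1 (U - 1) = U by rtlia.
have ne : nonear n E (U - 1).
  rewrite /nonear rU; have -> : rt n (n - 1) (U - 1) = U - 2 by rtlia.
  by rewrite Es.
have nb1 : E (U - 1) (U + 2) by rewrite top_edge_arc; lia.
have nb2 : E (U - 1) (U - 3) by rewrite Es top_edge_arc; lia.
have [d2] := near_min_drop nm Un ne; rewrite rU.
set F := pull E (rt n U) => t.
have {}t : tight (n - 1) F by apply: t; apply: deg_in_ge2 nb1 nb2; lia.
have Fs : symmetric F by apply: pull_sym.
have Fi : irreflexive F by apply: pull_irr.
(* In [F] the labels start at U: U + i becomes i, and U - k becomes n - k. *)
have Fn k i : k <= U -> 0 < k -> i < n - U -> F (n - k) i = E (U - k) (U + i).
  by move=> kU k0 iU; rewrite /F /pull; congr (E _ _); rtlia.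
split.
- move=> y yn; apply/negP => /eqP fy.
  have nb3 : E (U - 1) y by rewrite top_edge_spoke; lia.
  by have := deg_in_ge3 _ _ _ _ _ _ nb1 nb2 nb3; move/(_ n); lia.
- apply/negPn/negP => nE2.
  have d1 : deg_in (n - 1) F 1 = 1.
    apply: tight_nonear_deg => //; first by lia.
    rewrite /nonear; have -> : rt (n - 1) (n - 1 - 1) 1 = 0 by rtlia.
    have -> : rt (n - 1) 1 1 = 2 by rtlia.
    rewrite /F /pull; have -> : rt n U 0 = U by rtlia.
    by have -> : rt n U 2 = U + 2 by rtlia.
  have n1 : F 1 3.
    rewrite /F /pull; have -> : rt n U 1 = U + 1 by rtlia.
    have -> : rt n U 3 = U + 3 by rtlia.
    by rewrite top_edge_arc; lia.
  have n2 : F 1 (n - 2) by rewrite Fs Fn ?top_edge_arc; lia.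
  by have := deg_in1_uniq d1 _ _ n1 n2; lia.
- move=> U4; apply/negPn/negP => nE2.
  have d1 : deg_in (n - 1) F (n - 2) = 1.
    apply: tight_nonear_deg => //; first by lia.
    rewrite /nonear; have -> : rt (n - 1) (n - 1 - 1) (n - 2) = n - 3 by rtlia.
    have -> : rt (n - 1) 1 (n - 2) = 0 by rtlia.
    by rewrite Fn ?addn0 1?Es; lia.
  have n1 : F (n - 2) (n - 4).
    rewrite /F /pull; have -> : rt n U (n - 2) = U - 2 by rtlia.
    have -> : rt n U (n - 4) = U - 4 by rtlia.
    by rewrite Es top_edge_arc; lia.
  have n2 : F (n - 2) 1 by rewrite Fn ?top_edge_arc; lia.
  by have := deg_in1_uniq d1 _ _ n1 n2; lia.
Qed.

Variables (a b : nat).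
Hypotheses (an : a < n) (bn : b < n) (ab : a != b).
Hypothesis EU : forall v, v < n -> E U v = (v == a) || (v == b).

(* Two crossing spokes to the two arc neighbours of U would open a triangulation
   which passes between them through U. *)
Lemma top_no_swap y y' : a < P -> b < P -> P < y -> y < y' -> y' < n ->
  ~ (f y = U - 1 /\ f y' = U).
Proof.
have [Pn UP] := top_bounds.
move=> aP bP Py yy' y'n [fy fy'].
have EUy z : P <= z < n -> E U z = false by move=> zn; rewrite EU; lia.
have low x z : (x == 0) || (P <= x) -> P < z < n -> x < z -> ~~ E x z.
  by move=> xP zn xz; rewrite top_edge_spoke; have := @top_range z; lia.
apply: (@stair2 E P y y' U); try lia.
- suff: nt E (fun v => [|| v <= P, v == y, v == y | v == y']).
    by apply: nt_ext => v; lia.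
  apply: (keep3 (n := n) nV) => //=; try lia.
  + by move=> x xn xp; apply: low; lia.
  + by move=> x xn xp; apply: low; lia.
  + by move=> x xn xp; apply: low; lia.
- move=> x xh; have [->|xU] := eqVneq x U; first by rewrite EUy; lia.
  by rewrite top_edge_spoke; lia.
- move=> x xh; have [->|xU] := eqVneq x U; first by rewrite EUy; lia.
  by rewrite top_edge_spoke; lia.
Qed.

(** Insertion of U raises the indices from U on by one. This can break compatibility only for the
    indices U - 1 and U, the pair excluded by [top_no_swap]. *)
Lemma top_shape1 : 3 <= U <= P - 3 -> a = U - 2 -> b = U + 2 -> shape1 n E.
Proof.
have [Pn UP] := top_bounds.
move=> U3 aU bU; exists P, U, (fun y => f y + (U <= f y)); split; try lia.
- by move=> y yn; have := top_range yn; lia.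
- move=> y y' Py yy' y'n; have [_ _ _ co] := tf; have := co y y' Py yy' y'n.
  by have := @top_no_swap y y' ltac:(lia) ltac:(lia) Py yy' y'n; lia.
- move=> x y xy yn; have [xU|xU] := eqVneq x U.
    by rewrite xU EU //; case: (leqP y P) => ?; have := @top_range y; lia.
  have [yU|yU] := eqVneq y U.
    rewrite yU Es EU; try lia.
    have -> : U <= P by lia.
    by lia.
  case: (leqP y P) => yP; first by rewrite top_edge_arc; lia.
  by rewrite top_edge_spoke; lia.
Qed.

(** Here l is the non-ear U - 1 and l + 1 is U. Spokes miss the former by [top_gap] and the latter
    by the definition of the indices. *)
Lemma top_shape2 : 4 <= U <= P - 3 -> a = U - 3 -> b = U + 2 -> shape2 n E.
Proof.
move=> U3 aU bU; have [Pn UP] := top_bounds.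
have [fU _ _] := top_gap ltac:(lia) ltac:(rewrite EU; lia).
exists P, (U - 1), (fun y => f y + (U <= f y)); split; try lia.
- by move=> y yn; have := top_range yn; have := fU _ yn; lia.
- move=> y y' Py yy' y'n; have [_ _ _ co] := tf; have := co y y' Py yy' y'n.
  by have := fU y ltac:(lia); have := fU y' ltac:(lia); lia.
- move=> x y xy yn; have [xU|xU] := eqVneq x U.
    rewrite xU EU //; have yr := @top_range y; case: (leqP y P) => yP; last by lia.
    have -> : (U == U - 1 - 2) = false by lia.
    have -> : (U == U - 1 - 1) = false by lia.
    have -> : (U == U - 1) = false by lia.
    by rewrite !andFb !orFb; lia.
  have [yU|yU] := eqVneq y U.
    rewrite yU Es EU; try lia.
    have -> : U <= P by lia.
    have -> : (U == U - 1) = false by lia.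
    have -> : (U == U - 1 + 2) = false by lia.
    have -> : (U == U - 1 + 3) = false by lia.
    by rewrite !andbF !orFb; lia.
  case: (leqP y P) => yP.
    have -> : (y == U - 1 + 1) = false by lia.
    have -> : (x == U - 1 + 1) = false by lia.
    rewrite top_edge_arc // andbF !orFb /=.
    case: (ltnP x U) => xU' /=; last by lia.
    by case: (ltnP U y) => yU' /=; lia.
  by rewrite top_edge_spoke; lia.
Qed.

End Top.

(** The ends of the arc were non-ears before U was inserted; P - 2 is the last inner index when U is
    not counted. *)
Definition maximal_top (n P : nat) (f : nat -> nat) : Prop :=
  P < n - 1 -> (f P.+1 != P - 2) && (f (n - 1) != 1).

Lemma top_no_one n P f y : (forall y, P < y < n -> 0 < f y < P - 1) ->
  compatible n P f -> f (n - 1) != 1 -> f (n - 1) != 2 -> P < y < n -> f y != 1.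
Proof.
move=> fr co f1 f2 yn; apply/eqP => fy; have [e|yl] := eqVneq y (n - 1).
  by move: f1; rewrite -e fy.
by have := co y (n - 1) ltac:(lia) ltac:(lia) ltac:(lia); have := fr (n - 1); lia.
Qed.

(** No spoke ends at 2 by [top_gap], hence none at 1. Deleting the non-ear 2 leaves 0 with no
    possible neighbour but 3. So 0, 1, 2 are joined to 3, 4, 5, and with the edge 02 they form a
    bouquet once the labels start at 3. *)
Lemma top_shape3 n P f E a b : near_min n E -> top_form n P 3 f E -> maximal_top n P f ->
  a < n -> b < n -> a != b -> (forall v, v < n -> E 3 v = (v == a) || (v == b)) ->
  6 <= P -> ~~ E 3 1 -> shape3 n (pull E (rt n 3)).
Proof.
move=> nm tf mx an bn ab EU P6 nE; have [Pn _] := top_bounds tf.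
have Es := nm_sym nm.
have arc := top_edge_arc tf; have spoke := top_edge_spoke tf.
have P3 : 2 < 3 <= P - 3 by lia.
have [fU e5 _] := top_gap nm tf P3 nE.
have fr := top_range tf.
have [_ _ _ co] := tf.
have f3 y : P < y < n -> 3 <= f y.
  move=> yn; have [f1 f2] : f (n - 1) != 1 /\ f (n - 1) != 2.
    split; last by apply: fU; lia.
    by have := mx ltac:(lia); case/andP.
  by have := top_no_one fr co f1 f2 yn; have := fU _ yn; have := fr _ yn; lia.
have e0 : E 3 0.
  have nV := nm_nt nm.
  have n1 : nt E (fun v => (v < n) && (v != 2)).
    by apply: (nt_drop (a := 1) (b := 3) nV); rewrite 1?Es //; lia.
  have [x /andP[xn x2]] : exists2 x, (x < n) && (x != 2) & E 0 x.
    by apply: (nt_neighbour (n := n) n1 Es) => /=; lia.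
  have [->|x3] := eqVneq x 3; first by rewrite Es.
  have [->|x0] := eqVneq x 0; first by rewrite (nm_irr nm).
  have [xP|xP] := leqP x P; first by rewrite arc; lia.
  by rewrite spoke; try lia; have := fr x; lia.
have EUf v : v < n -> E 3 v = (v == 0) || (v == 5).
  by move=> vn; move: e0 e5; rewrite !EU //; lia.
exists (P - 3), 1, (n - 3), (n - 1),
  (fun y => if y == n - 3 then 0 else if y == n - 2 then 1 else
            if y == n - 1 then 2 else f (y + 3) - 2); split; first by lia.
- move=> y yn; case: eqVneq => [h|h1]; first by split; lia.
  case: eqVneq => [h|h2]; first by split; lia.
  case: eqVneq => [h|h3]; first by split; lia.
  by have := fr (y + 3) ltac:(lia); have := f3 (y + 3) ltac:(lia); split; lia.
- move=> y y' Py yy' y'n H.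
  have -> : (y' == n - 3) = false by lia.
  have -> : (y' == n - 2) = false by lia.
  have -> : (y' == n - 1) = false by lia.
  have -> : (y == n - 3) = false by lia.
  have -> : (y == n - 2) = false by lia.
  have -> : (y == n - 1) = false by lia.
  have := co (y + 3) (y' + 3) ltac:(lia) ltac:(lia) ltac:(lia).
  by have := f3 (y + 3) ltac:(lia); have := f3 (y' + 3) ltac:(lia); lia.
- move=> x y xy yn; rewrite /pull.
  have [y3|y3] := ltnP y (n - 3).
    have -> : rt n 3 x = x + 3 by rtlia.
    have -> : rt n 3 y = y + 3 by rtlia.
    have -> : (y == n - 3) = false by lia.
    have -> : (y == n - 2) = false by lia.
    have -> : (y == n - 1) = false by lia.
    have [->|x0] := eqVneq x 0.
      rewrite EUf; last by lia.
      by case: leqP => ?; [lia|have := f3 (y + 3); lia].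
    case: leqP => yP; first by rewrite arc; lia.
    by rewrite spoke; have := f3 (y + 3); lia.
  have -> : (y <= P - 3) = false by lia.
  have ey : rt n 3 y = y + 3 - n by rtlia.
  have gy : (if y == n - 3 then 0 else if y == n - 2 then 1 else
            if y == n - 1 then 2 else f (y + 3) - 2) = y + 3 - n.
    by case: eqVneq => [|?]; [lia|]; case: eqVneq => [|?]; [lia|]; case: eqVneq; lia.
  rewrite gy ey.
  have [x3|x3] := ltnP x (n - 3).
    have -> : rt n 3 x = x + 3 by rtlia.
    have -> : (x == n - 3) = false by lia.
    have [->|x0] := eqVneq x 0; first by rewrite EUf; lia.
    rewrite Es; have [xP|xP] := leqP (x + 3) P; first by rewrite arc; lia.
    by rewrite spoke; have := f3 (x + 3); lia.
  have -> : rt n 3 x = x + 3 - n by rtlia.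
  by rewrite arc; lia.
Qed.

(** 1 and 2 are twins with neighbours 4 and [s], so the relation does not reveal which was inserted.
    With labels starting at 2, the bouquet runs from k = s - 2 to k' = n - 1, the old vertex 1, with
    centre the old vertex 3. *)
Lemma pair_shape n P s f E : symmetric E -> 4 <= P < s -> s < n ->
  (forall y, P < y < n -> y != s -> 2 <= f y < P - 1) ->
  (forall y, s < y < n -> f y = 2) ->
  compatible s P f ->
  (forall x y, x < y -> y < n -> E x y =
     if y <= P then y == x + 2 + (x < 2)
     else if y == s then (x == 1) || (x == 2) else x == f y + 1) ->
  shape3 n (pull E (rt n 2)).
Proof.
move=> Es Ps sn fr f2 co EE.
have arc x y : x < y -> y <= P -> E x y = (y == x + 2 + (x < 2)).
  by move=> xy yP; rewrite EE ?yP //; lia.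
have spoke x y : x < y -> P < y < n -> y != s -> E x y = (x == f y + 1).
  move=> xy yP ys; rewrite EE //; try lia.
  by rewrite (negbTE ys); have -> : (y <= P) = false by lia.
have spoke' x : x < s -> E x s = (x == 1) || (x == 2).
  move=> xs; rewrite EE //; try lia.
  by rewrite eqxx; have -> : (s <= P) = false by lia.
exists (P - 2), 1, (s - 2), (n - 1),
  (fun y => if y == s - 2 then 0 else if y == n - 2 then 1 else
            if y == n - 1 then 2 else f (y + 2) - 1); split; first by lia.
- move=> y yn; case: eqVneq => [h|h1]; first by split; lia.
  case: eqVneq => [h|h2]; first by split; lia.
  case: eqVneq => [h|h3]; first by split; lia.
  by have := fr (y + 2) ltac:(lia) ltac:(lia); have := f2 (y + 2); split; lia.
- move=> y y' Py yy' y'n H.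
  have -> : (y' == s - 2) = false by lia.
  have -> : (y' == n - 2) = false by lia.
  have -> : (y' == n - 1) = false by lia.
  have -> : (y == s - 2) = false by lia.
  have -> : (y == n - 2) = false by lia.
  have -> : (y == n - 1) = false by lia.
  have := co (y + 2) (y' + 2) ltac:(lia) ltac:(lia) ltac:(lia).
  have := fr (y + 2) ltac:(lia) ltac:(lia); have := fr (y' + 2) ltac:(lia) ltac:(lia).
  by lia.
- move=> x y xy yn; rewrite /pull.
  have [y3|y3] := ltnP y (n - 2).
    have -> : rt n 2 x = x + 2 by rtlia.
    have -> : rt n 2 y = y + 2 by rtlia.
    have -> : (y == n - 2) = false by lia.
    have -> : (y == n - 1) = false by lia.
    case: (leqP y (P - 2)) => yP; first by rewrite arc; lia.
    case: (eqVneq y (s - 2)) => ys.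
      have -> : y + 2 = s by lia.
      by rewrite spoke'; lia.
    by rewrite spoke; try lia; have := fr (y + 2) ltac:(lia) ltac:(lia); lia.
  have -> : (y <= P - 2) = false by lia.
  have ey : rt n 2 y = y + 2 - n by rtlia.
  have gy : (if y == s - 2 then 0 else if y == n - 2 then 1 else
            if y == n - 1 then 2 else f (y + 2) - 1) = y + 3 - n.
    by case: eqVneq => [|?]; [lia|]; case: eqVneq => [|?]; [lia|]; case: eqVneq; lia.
  rewrite gy ey.
  have [x3|x3] := ltnP x (n - 2); last first.
    have -> : rt n 2 x = x + 2 - n by rtlia.
    by rewrite arc; lia.
  have -> : rt n 2 x = x + 2 by rtlia.
  rewrite Es; have [xP|xP] := leqP (x + 2) P; first by rewrite arc; lia.
  have [xs|xs] := eqVneq (x + 2) s; first by rewrite xs spoke'; lia.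
  by rewrite spoke; try lia; have := fr (x + 2) ltac:(lia) xs; lia.
Qed.

Lemma deg2_neighbours n E U : deg_in n E U = 2 -> exists a b,
  a < b < n /\ forall v, v < n -> E U v = (v == a) || (v == b).
Proof.
move=> d2; pose A := [set v : 'I_n | E U v].
have : #|A| == 2.
  by rewrite -d2 /deg_in -sum1_card big_mkcond /=; apply/eqP/eq_bigr => v _; rewrite inE; case: (E U v).
case/cards2P => x [y [xy Axy]].
have EU v : v < n -> E U v = (v == x) || (v == y).
  move=> vn; have := congr1 (fun B : {set 'I_n} => Ordinal vn \in B) Axy.
  by rewrite !inE.
have xy' : val x != val y by [].
have [xn yn] := (ltn_ord x, ltn_ord y).
case: (ltngtP x y) => [h|h|/eqP h]; last by rewrite (negbTE xy') in h.
- by exists x, y; rewrite h yn.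
- by exists y, x; rewrite h xn; split=> // v vn; rewrite EU // orbC.
Qed.

(** * The inserted vertex is next to an end of the arc or one step further *)

(** With the edge 13, the arc can start at 1 instead of 0, and 0 becomes a lower vertex with spoke
    to 3; the other edge at 1 would then be redundant. *)
Lemma left_no_third n P f E : near_min n E -> top_form n P 1 f E ->
  deg_in n E 1 = 2 -> ~~ E 1 3.
Proof.
move=> nm tf d2; have [a [b [abn EU]]] := deg2_neighbours d2.
have [Pn _] := top_bounds tf; have fr := top_range tf.
have arc := top_edge_arc tf; have spoke := top_edge_spoke tf.
have Es := nm_sym nm; apply/negP => E13.
have [c [cn c3 E1c c0]] : exists c, [/\ c < n, c != 3, E 1 c & 0 < c].
  have s1 := nm_side nm (ltac:(lia) : 0 < n); have e1 : rt n 1 0 = 1 by rtlia.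
  rewrite e1 Es in s1.
  have h3 := EU 3; rewrite E13 in h3.
  have Ea : E 1 a by rewrite EU ?eqxx //; lia.
  have Eb : E 1 b by rewrite EU ?eqxx ?orbT //; lia.
  have pos z : E 1 z -> 0 < z by case: z => // E0; move: s1; rewrite E0.
  have [a3|a3] := eqVneq a 3; [exists b|exists a];
    split; try exact: pos; try done; lia.
have n1 : 1 < n by lia.
have nm1 := near_min_rt n1 nm.
have e y : y < n - 1 -> rt n 1 y = y + 1 by move=> yn; rtlia.
apply: (nm_sat nm1 (x := 0) (y := c - 1)); try lia.
  by rewrite /pull !e; try lia; have -> : c - 1 + 1 = c by lia.
have [_ _ _ co] := tf.
apply: (@arc_nt _ (P - 1) n (fun y => if y == n - 1 then 2 else f (y + 1))).
- by move=> x y; rewrite /del (nm_sym nm1); congr (_ && ~~ _); lia.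
- move=> x xP; rewrite /del /pull !e; try lia.
  have [->|x0] := eqVneq x 0; first by rewrite E13; lia.
  by rewrite arc; lia.
- move=> y yn; rewrite /del /pull; case: eqVneq => [->|yl].
    have -> : rt n 1 (n - 1) = 0 by rtlia.
    by rewrite e; try lia; rewrite Es arc; lia.
  have := fr (y + 1) ltac:(lia) => fy.
  by rewrite !e; try lia; rewrite spoke; lia.
- move=> y y' Py yy' y'n; have -> : (y == n - 1) = false by lia.
  have := fr (y + 1) ltac:(lia) => fy.
  by case: eqVneq => y'l; [lia|apply: co; lia].
- by lia.
- by move=> y yn; case: eqVneq => h; [lia|have := fr (y + 1); lia].
Qed.

(** The other vertex 3 - U of the pair 1, 2 is a non-ear, so 4 and [s] are its only neighbours.
    After its deletion [s] needs the edge to U, and U needs the edge to 4, since otherwise 3 could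
    be cut off too and 0 would be isolated. Thus U is a twin of 3 - U. *)
Lemma near_left n P U f E s : near_min n E -> top_form n P U f E ->
  deg_in n E U = 2 -> 0 < U <= 2 -> ~~ E (2 - U) (4 - U) -> ~~ E 0 U ->
  P < s < n -> f s = 1 -> shape3 n (pull E (rt n 2)).
Proof.
move=> nm tf d2 UU ear E0U sn fs; have [a [b [abn EU]]] := deg2_neighbours d2.
have [Pn UP] := top_bounds tf; have fr := top_range tf.
have arc := top_edge_arc tf; have spoke := top_edge_spoke tf.
have [_ _ _ co] := tf.
have Es := nm_sym nm; have nV := nm_nt nm.
have [nb1 nb2] : E (3 - U) 4 /\ E (3 - U) s.
  by split; [rewrite arc; lia|rewrite spoke; lia].
have ne : nonear n E (3 - U).
  rewrite /nonear; have -> : rt n (n - 1) (3 - U) = 2 - U by rtlia.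
  by have -> : rt n 1 (3 - U) = 4 - U by rtlia.
have [dw _] := near_min_drop nm (ltac:(lia) : 3 - U < n) ne.
have uniq y : P < y < n -> f y = 1 -> y = s.
  move=> yn fy; have [//|ys] := eqVneq y s.
  have nb3 : E (3 - U) y by rewrite spoke; lia.
  have := deg_in_ge3 _ _ _ _ _ _ nb1 nb2 nb3; move/(_ n); lia.
have n1 : nt E (fun v => (v < n) && (v != 3 - U)).
  by apply: (nt_drop (a := 2 - U) (b := 4 - U) nV ear); lia.
have EUs : E U s.
  have [x /andP[xn x2]] : exists2 x, (x < n) && (x != 3 - U) & E s x.
    by apply: (nt_neighbour (n := n) n1 Es) => /=; lia.
  have [->|xU] := eqVneq x U; first by rewrite Es.
  have [xs|xs] := ltnP x s; first by rewrite Es spoke; lia.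
  have [->|xs'] := eqVneq x s; first by rewrite (nm_irr nm).
  by rewrite spoke; try lia; have := fr x; lia.
have EU4 : E U 4.
  apply/negPn/negP => n4.
  have n2 : nt E (fun v => (v < n) && (v != 3 - U) && (v != 3)).
    apply: (nt_mid n1 (a := U) (c := 3) (b := 4)) => //=; try lia.
    by move=> w wn; case: (ltngtP w 3) => h; [constructor 1|constructor 3|constructor 2]; lia.
  have [x /andP[/andP[xn x2] x3]] : exists2 x, (x < n) && (x != 3 - U) && (x != 3) & E 0 x.
    by apply: (nt_neighbour (n := n) n2 Es) => /=; lia.
  have [->|x0] := eqVneq x 0; first by rewrite (nm_irr nm).
  have [->|xU] := eqVneq x U; first by rewrite (negbTE E0U).
  have [xP|xP] := leqP x P; first by rewrite arc; lia.
  by rewrite spoke; try lia; have := fr x; lia.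
have EU' v : v < n -> E U v = (v == 4) || (v == s).
  by move=> vn; have := EU 4; have := EU s; rewrite EU4 EUs EU; lia.
apply: (@pair_shape n P s f) => //; try lia.
- by move=> y yn ys; have := uniq y yn; have := fr y yn; lia.
- move=> y yn; have := uniq y; have := fr y; have := co s y ltac:(lia) ltac:(lia) ltac:(lia); lia.
- by move=> y y' Py yy' y's; apply: co; lia.
- move=> x y xy yn; have f2 : P < y -> y != s -> 2 <= f y.
    by move=> Py ys; have := uniq y; have := fr y; lia.
  have [xU|xU] := eqVneq x U.
    rewrite xU EU' //; case: (leqP y P) => yP; first by lia.
    by case: (eqVneq y s) => ys; [lia|have := f2 yP ys; lia].
  have [yU|yU] := eqVneq y U.
    rewrite yU Es EU'; try lia.
    have -> : U <= P by lia.
    by lia.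
  case: (leqP y P) => yP; first by rewrite arc; lia.
  rewrite spoke; try lia.
  by case: (eqVneq y s) => ys; [rewrite ys fs|have := f2 yP ys]; lia.
Qed.

(* Here removing 0 leaves two disjoint runs of ears unless the arc is as short
   as possible. *)
Lemma left_touching n P f E s : near_min n E -> top_form n P 2 f E ->
  maximal_top n P f -> deg_in n E 2 = 2 -> E 0 2 -> P < s < n -> f s = 1 -> shape3 n E.
Proof.
move=> nm tf mx d2 E02 sn fs; have [a [b [abn EU]]] := deg2_neighbours d2.
have [Pn _] := top_bounds tf; have fr := top_range tf.
have arc := top_edge_arc tf; have spoke := top_edge_spoke tf.
have [_ _ _ co] := tf.
have Es := nm_sym nm; have Ei := nm_irr nm.
have /andP[_ fl] := mx ltac:(lia).
have sl : s != n - 1 by apply: contraNneq fl => <-; rewrite fs.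
have n1 : 1 < n by lia.
have ne : nonear n E 0.
  rewrite /nonear; have -> : rt n (n - 1) 0 = n - 1 by rtlia.
  have -> : rt n 1 0 = 1 by rtlia.
  by rewrite Es spoke; lia.
have nl : n - 2 + 1 = n - 1 by lia.
have E03 : E 0 3 by rewrite arc; lia.
have [_] := near_min_drop nm (ltac:(lia) : 0 < n) ne.
have -> : rt n 1 0 = 1 by rtlia.
set F := pull E (rt n 1) => t.
have {}t : tight (n - 1) F by apply: t; apply: deg_in_ge2 E02 E03; lia.
have Fs : symmetric F by apply: pull_sym.
have Fi : irreflexive F by apply: pull_irr.
have Fn i j : i < n - 1 -> j < n - 1 -> F i j = E (i + 1) (j + 1).
  by move=> ik jk; rewrite /F /pull; congr (E _ _); rtlia.
(* Otherwise 1 would be a non-ear of the tight remainder with the two neighbours 4 and [s]. *)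
have E2l : E 2 (n - 1).
  apply/negPn/negP => nE2.
  have d1 : deg_in (n - 1) F 0 = 1.
    apply: tight_nonear_deg => //; first by lia.
    rewrite /nonear; have -> : rt (n - 1) (n - 1 - 1) 0 = n - 2 by rtlia.
    have -> : rt (n - 1) 1 0 = 1 by rtlia.
    by rewrite Fn; try lia; rewrite Es; have -> : n - 2 + 1 = n - 1 by lia.
  have m1 : F 0 3 by rewrite Fn ?arc; lia.
  have m2 : F 0 (s - 1).
    by rewrite Fn; try lia; rewrite subnK ?spoke; lia.
  by have := deg_in1_uniq d1 _ _ m1 m2; lia.
have EU' v : v < n -> E 2 v = (v == 0) || (v == n - 1).
  by move=> vn; have := EU 0; have := EU (n - 1); rewrite E2l Es E02 EU; lia.
have ne1 : nonear (n - 1) F 1.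
  rewrite /nonear; have -> : rt (n - 1) (n - 1 - 1) 1 = 0 by rtlia.
  have -> : rt (n - 1) 1 1 = 2 by rtlia.
  by rewrite Fn ?arc; lia.
(* In the remainder 2 is a non-ear joined to n - 1, so n - 1 must be an ear. *)
have e1 : E 1 (n - 2).
  apply/negPn/negP => nE.
  have : ~~ F 1 (n - 2).
    apply: (tight_nonear_edge Fs Fi t _ _ ne1); try lia.
    rewrite /nonear; have -> : rt (n - 1) (n - 1 - 1) (n - 2) = n - 3 by rtlia.
    have -> : rt (n - 1) 1 (n - 2) = 0 by rtlia.
    by rewrite Fn; try lia; rewrite Es; have -> : n - 3 + 1 = n - 2 by lia.
  by rewrite Fn; try lia; rewrite nl E2l.
have Pn2 : P < n - 2 by lia.
have f2 : f (n - 2) = 1 by move: e1; rewrite spoke; lia.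
have fl2 : f (n - 1) = 2.
  by have := co (n - 2) (n - 1) ltac:(lia) ltac:(lia) ltac:(lia); have := fr (n - 1); lia.
(* The old vertex 3 is a non-ear of the remainder and is already joined to n - 1; this excludes the
   arc edge 35 and all further spokes to 3. *)
have d3 : deg_in (n - 1) F 2 = 1.
  apply: tight_nonear_deg => //; first by lia.
  rewrite /nonear; have -> : rt (n - 1) (n - 1 - 1) 2 = 1 by rtlia.
  have -> : rt (n - 1) 1 2 = 3 by rtlia.
  by rewrite Fn ?EU'; lia.
have m1 : F 2 (n - 2).
  by rewrite Fn; try lia; rewrite nl spoke; lia.
have P4 : P = 4.
  apply/eqP; rewrite eqn_leq; apply/andP; split; last by lia.
  rewrite leqNgt; apply/negP => P5.
  have m2 : F 2 4 by rewrite Fn ?arc; lia.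
  by have := deg_in1_uniq d3 _ _ m1 m2; lia.
have f1 y : P < y < n - 1 -> f y = 1.
  move=> yn; have := fr y ltac:(lia) => fy.
  have [//|fy1] := eqVneq (f y) 1.
  have m2 : F 2 (y - 1).
    by rewrite Fn; try lia; rewrite subnK ?spoke; lia.
  by have := deg_in1_uniq d3 _ _ m1 m2; lia.
exists 2, 1, 3, (n - 1), (fun y => if y == 3 then 0 else if y == n - 1 then 2 else 1).
split; first by lia.
- move=> y yn; case: eqVneq => [h|h]; first by split; lia.
  by case: eqVneq => [h'|h']; split; lia.
- move=> y y' Py yy' y'n H; have -> : (y == 3) = false by lia.
  have -> : (y' == n - 1) = false by lia.
  by case: eqVneq; case: eqVneq; lia.
- move=> x y xy yn; have [x2|x2] := eqVneq x 2.
    rewrite x2 EU' //; case: (leqP y 2) => y2; first by lia.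
    by case: (eqVneq y 3) => [h|h]; [|case: (eqVneq y (n - 1)) => h']; lia.
  have [y2|y2] := eqVneq y 2; first by rewrite y2 Es EU' /=; lia.
  have [yP|yP] := leqP y P.
    rewrite arc //; case: (leqP y 2) => ?; first by lia.
    by case: (eqVneq y 3) => [h|h]; [|case: (eqVneq y (n - 1)) => h']; lia.
  rewrite spoke; try lia; case: (leqP y 2) => ?; first by lia.
  have -> : (y == 3) = false by lia.
  by case: (eqVneq y (n - 1)) => h; [rewrite h fl2|rewrite f1]; lia.
Qed.

(** As no spoke ends at 1, the arc may start there: the old 0, joined to 3, becomes a lower vertex,
    and the inserted vertex moves to position 1. *)
Lemma left_shift n P f E : top_form n P 2 f E -> symmetric E -> 5 <= P ->
  (forall y, P < y < n -> f y != 1) ->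
  top_form n (P - 1) 1 (fun y => if y == n - 1 then 1 else f (y + 1) - 1) (pull E (rt n 1)).
Proof.
move=> tf Es P5 f1; have [Pn _] := top_bounds tf; have fr := top_range tf.
have arc := top_edge_arc tf; have spoke := top_edge_spoke tf.
have [_ _ _ co] := tf.
have e y : y < n - 1 -> rt n 1 y = y + 1 by move=> yn; rtlia.
have el : rt n 1 (n - 1) = 0 by rtlia.
split; first by lia.
- move=> x y xy yn x1 y1; rewrite /pull (e x); last by lia.
  case: (eqVneq y (n - 1)) => [->|yl].
    have -> : (n - 1 <= P - 1) = false by lia.
    rewrite el Es; have [xP|xP] := leqP (x + 1) P; first by rewrite arc; lia.
    by rewrite spoke; try lia; have := fr (x + 1); lia.
  rewrite (e y); last by lia.
  case: (leqP y (P - 1)) => yP; first by rewrite arc; lia.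
  by have := fr (y + 1) ltac:(lia); have := f1 (y + 1) ltac:(lia); rewrite spoke; lia.
- move=> y yn; case: eqVneq => h; first by lia.
  by have := fr (y + 1) ltac:(lia); have := f1 (y + 1) ltac:(lia); lia.
- move=> y y' Py yy' y'n; have -> : (y == n - 1) = false by lia.
  have := fr (y + 1) ltac:(lia); have := f1 (y + 1) ltac:(lia).
  case: (eqVneq y' (n - 1)) => h; first by lia.
  by have := co (y + 1) (y' + 1) ltac:(lia) ltac:(lia) ltac:(lia); lia.
Qed.

(** As no spoke ends at 2, the arc may start there; the old 0 becomes the lower vertex n - 2 and the
    inserted vertex 1 becomes n - 1, which lies outside the arc. *)
Lemma left_bottom n P f E : top_form n P 1 f E -> symmetric E -> 5 <= P ->
  maximal_top n P f -> (forall y, P < y < n -> f y != 1) ->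
  bottom_form n (P - 2) (n - 1) (fun y => if y == n - 2 then 1 else f (y + 2) - 1)
    (pull E (rt n 2)).
Proof.
move=> tf Es P5 mx f1; have [Pn _] := top_bounds tf; have fr := top_range tf.
have arc := top_edge_arc tf; have spoke := top_edge_spoke tf.
have [_ _ _ co] := tf.
have e y : y < n - 2 -> rt n 2 y = y + 2 by move=> yn; rtlia.
have el : rt n 2 (n - 2) = 0 by rtlia.
split; first by lia.
- move=> x y xy yn xl yl; rewrite /pull (e x) /arc_rel; last by lia.
  case: (eqVneq y (n - 2)) => [->|y2].
    rewrite el Es; have [xP|xP] := leqP (x + 2) P; first by rewrite arc; lia.
    by rewrite spoke; try lia; have := fr (x + 2); lia.
  rewrite (e y); last by lia.
  have [yP|yP] := leqP (y + 2) P; first by rewrite arc; lia.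
  by have := fr (y + 2) ltac:(lia); have := f1 (y + 2) ltac:(lia); rewrite spoke; lia.
- move=> y yn yl; case: eqVneq => h; first by lia.
  by have := fr (y + 2) ltac:(lia); have := f1 (y + 2) ltac:(lia); lia.
- move=> y y' Py yy' y'n yl y'l; have -> : (y == n - 2) = false by lia.
  have := fr (y + 2) ltac:(lia); have := f1 (y + 2) ltac:(lia).
  case: (eqVneq y' (n - 2)) => h; first by lia.
  by have := co (y + 2) (y' + 2) ltac:(lia) ltac:(lia) ltac:(lia); lia.
- split; first by rewrite eqxx.
  move=> h; case: (eqVneq (P - 2 + 1) (n - 2)) => h'; first by lia.
  have /andP[] := mx ltac:(lia); have -> : P - 2 + 1 + 2 = P.+1 by lia.
  by have := fr P.+1 ltac:(lia); have := f1 P.+1 ltac:(lia); lia.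
Qed.

Lemma left_classified n P U f E : near_min n E -> top_form n P U f E ->
  maximal_top n P f -> deg_in n E U = 2 -> 6 <= n -> U <= 2 -> classified n E.
Proof.
move=> nm tf mx d2 n6 U2; have [Pn UP] := top_bounds tf; have fr := top_range tf.
have Es := nm_sym nm.
have n1 : 1 < n by lia. have n2 : 2 < n by lia. have n0 : 0 < n by lia.
have [s|no] : (exists2 s, P < s < n & f s = 1) \/ (forall y, P < y < n -> f y != 1).
  case: (boolP [exists s : 'I_n, (P < s) && (f s == 1)]) => [/existsP[s /andP[Ps /eqP fs]]|].
    by left; exists s; rewrite // Ps ltn_ord.
  move/existsPn => no; right=> y /andP[Py yn].
  by have := no (Ordinal yn); rewrite /= Py.
- case: s => s sn fs.
  have [U1|U1] := eqVneq U 1.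
    subst U; apply: (classified_rt n2); apply: shape3_classified => //.
    apply: (near_left nm tf d2 _ _ _ sn fs) => //.
      exact: left_no_third nm tf d2.
    by have := nm_side nm n0; have -> : rt n 1 0 = 1 by rtlia.
  have {}U2 : U = 2 by lia.
  subst U; have [E02|E02] := boolP (E 0 2).
    by apply: shape3_classified => //; apply: (left_touching nm tf mx d2 E02 sn fs).
  apply: (classified_rt n2); apply: shape3_classified => //.
  exact: (near_left nm tf d2 _ _ _ sn fs).
(* For P = 4 the only index other than 1 is 2 = P - 2, which maximality forbids at [P.+1]. *)
have P5 : 5 <= P.
  have [//|P4] := leqP 5 P.
  have P4' : P = 4 by lia.
  have fP := fr P.+1 ltac:(lia); have noP := no P.+1 ltac:(lia).
  by have := mx ltac:(lia); rewrite P4' in fP noP *; lia.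
have [U1|U1] := eqVneq U 1.
  subst U; apply: (classified_rt n2).
  have bf := left_bottom tf Es P5 mx no.
  have nm2 := near_min_rt n2 nm.
  have d : deg_in n (pull E (rt n 2)) (n - 1) = 2.
    by rewrite deg_in_rt //; have -> : rt n 2 (n - 1) = 1 by rtlia.
  have [a [b [ab EU]]] := deg2_neighbours d.
  exact: (bottom_classified nm2 bf ab EU).
have {}U2 : U = 2 by lia.
subst U; have tf' := left_shift tf Es P5 no.
have nm' := near_min_rt n1 nm.
have d : deg_in n (pull E (rt n 1)) 1 = 2.
  by rewrite deg_in_rt //; have -> : rt n 1 1 = 2 by rtlia.
apply: (classified_rt n1); apply: (classified_rt n2); apply: shape3_classified => //.
apply: (near_left (s := n - 1) nm' tf' d) => //.
- exact: left_no_third nm' tf' d.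
- by have := nm_side nm' n0; have -> : rt n 1 0 = 1 by rtlia.
- by lia.
- by rewrite eqxx.
Qed.

Lemma top_form_mr n P U f E : symmetric E -> top_form n P U f E ->
  top_form n P (P - U) (fun y => P - 1 - f (mr n P y)) (pull E (mr n P)).
Proof.
move=> Es tf; have [Pn UP] := top_bounds tf; have fr := top_range tf.
have arc := top_edge_arc tf; have spoke := top_edge_spoke tf.
have [_ _ _ co] := tf.
split; first by lia.
- move=> x y xy yn xU yU; rewrite /pull; case: (leqP y P) => yP.
    by rewrite !mr_top; try lia; rewrite Es arc; lia.
  have [m1 e1] := @mr_low n P y ltac:(lia).
  have gy := fr _ m1.
  have [xP|xP] := leqP x P.
    by rewrite mr_top // spoke; lia.
  have [m2 e2] := @mr_low n P x ltac:(lia).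
  have gx := fr _ m2.
  by rewrite Es spoke; lia.
- move=> y yn; have [m1 e1] := mr_low yn.
  by have := fr _ m1; lia.
- move=> y y' Py yy' y'n.
  have [m1 e1] := @mr_low n P y ltac:(lia); have [m2 e2] := @mr_low n P y' ltac:(lia).
  have := fr _ m1; have := fr _ m2; have := co (mr n P y') (mr n P y); lia.
Qed.

Lemma maximal_top_mr n P f : P < n -> (forall y, P < y < n -> 0 < f y < P - 1) ->
  maximal_top n P f -> maximal_top n P (fun y => P - 1 - f (mr n P y)).
Proof.
move=> Pn fr mx Pn1; have /andP[m1 m2] := mx Pn1.
have -> : mr n P P.+1 = n - 1 by rtlia.
have -> : mr n P (n - 1) = P.+1 by rtlia.
by have := fr P.+1 ltac:(lia); have := fr (n - 1) ltac:(lia); lia.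
Qed.

Lemma gap_classified n P U f E : near_min n E -> top_form n P U f E ->
  maximal_top n P f -> deg_in n E U = 2 -> 3 <= U <= P - 3 -> ~~ E U (U - 2) ->
  classified n E.
Proof.
move=> nm tf mx d2 U3 nE; have [a [b [abn EU]]] := deg2_neighbours d2.
have [Pn UP] := top_bounds tf.
have an : a < n by lia. have bn : b < n by lia. have ab : a != b by lia.
have [Ueq|U4] := eqVneq U 3.
  subst U; have n3 : 3 < n by lia.
  apply: (classified_rt n3); apply: shape3_classified; first by lia.
  by apply: (top_shape3 nm tf mx an bn ab EU) => //; lia.
have [_ e2 /(_ ltac:(lia)) e3] := top_gap nm tf U3 nE.
have U4' : 4 <= U <= P - 3 by lia.
rewrite !EU in e2 e3; try lia.
exists 0; first by lia.
cbv zeta; apply: (@shape_ext n E).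
  move=> x y xn yn; rewrite /pull; have -> : rt n 0 x = x by rtlia.
  by have -> : rt n 0 y = y by rtlia.
by right; left; apply: (top_shape2 nm tf an bn ab EU U4'); lia.
Qed.

Lemma top_classified n P U f E : near_min n E -> top_form n P U f E ->
  maximal_top n P f -> deg_in n E U = 2 -> 6 <= n -> classified n E.
Proof.
move=> nm tf mx d2 n6; have [Pn UP] := top_bounds tf; have fr := top_range tf.
have Es := nm_sym nm; have Pn' : P < n by lia.
have nm' := near_min_mr Pn' nm; have tf' := top_form_mr Es tf.
have mx' := maximal_top_mr Pn' fr mx.
have mU : mr n P (P - U) = U by rtlia.
have d2' : deg_in n (pull E (mr n P)) (P - U) = 2 by rewrite deg_in_mr // mU.
have [U2|U2] := leqP U 2; first exact: (left_classified nm tf mx d2).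
have [U2'|U2'] := leqP (P - U) 2.
  by apply: (classified_mr Es Pn'); apply: (left_classified nm' tf' mx' d2').
have [el|el] := boolP (E U (U - 2)); last first.
  by apply: (gap_classified nm tf mx d2) => //; lia.
have [er|er] := boolP (E U (U + 2)); last first.
  apply: (classified_mr Es Pn'); apply: (gap_classified nm' tf' mx' d2'); first by lia.
  by rewrite /pull mU; have -> : mr n P (P - U - 2) = U + 2 by rtlia.
have [a [b [abn EU]]] := deg2_neighbours d2.
have an : a < n by lia. have bn : b < n by lia. have ab : a != b by lia.
rewrite !EU in el er; try lia.
exists 0; first by lia.
cbv zeta; apply: (@shape_ext n E).
  move=> x y xn yn; rewrite /pull; have -> : rt n 0 x = x by rtlia.
  by have -> : rt n 0 y = y by rtlia.
by left; apply: (top_shape1 nm tf an bn ab EU); lia.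
Qed.

(** The deleted vertex carries label n - 1 in [F], hence U after the rotation; labels beyond U are
    one larger than in the smaller polygon. *)
Lemma inserted_edge n M U r f (F : rel nat) : r < n - 1 -> U = n - 1 - r ->
  std (n - 1) M f (pull F (rt (n - 1) r)) ->
  forall x y, x < y -> y < n -> x != U -> y != U ->
    pull F (rt n r) x y = arc_rel M f (x - (U < x)) (y - (U < y)).
Proof.
move=> rn Ur [_ EE _ _] x y xy yn xU yU; rewrite -EE; try lia.
rewrite /pull; congr (F _ _).
  have [xU'|xU'] := ltnP U x; first by have -> : x - true = x - 1 by []; rtlia.
  by rewrite subn0; rtlia.
have [xU'|xU'] := ltnP U y; first by have -> : y - true = y - 1 by []; rtlia.
by rewrite subn0; rtlia.
Qed.

Lemma near_min_classified n U E : near_min n E -> U < n -> nonear n E U ->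
  deg_in n E U = 2 -> classified n E.
Proof.
move=> nm Un ne d2; have n4 := nt_min_size (nm_nt nm).
have [_ /(_ ltac:(lia)) t] := near_min_drop nm Un ne.
have rn : rt n 1 U < n by rtlia.
apply: (classified_rt rn).
have lastU : rt n (rt n 1 U) (n - 1) = U by rtlia.
have dl : deg_in n (pull E (rt n (rt n 1 U))) (n - 1) = 2 by rewrite deg_in_rt // lastU.
have nel : ~~ pull E (rt n (rt n 1 U)) (n - 2) 0.
  rewrite /pull; have -> : rt n (rt n 1 U) (n - 2) = rt n (n - 1) U by rtlia.
  by have -> : rt n (rt n 1 U) 0 = rt n 1 U by rtlia.
move: (near_min_rt rn nm) dl nel t.
move: (pull E _) => F {nm d2 ne Un rn lastU E U} nm d2 ne t.
have n5 : 5 <= n by have := nt_min_size t.1; lia.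
have Fs := nm_sym nm; have Fi := nm_irr nm.
have side x : x.+1 < n -> ~~ F x x.+1.
  by move=> xn; have := nm_side nm (ltnW xn); have -> : rt n 1 x = x.+1 by rtlia.
have [e5|n6] := eqVneq n 5.
  have [a [b [ab EU]]] := deg2_neighbours d2.
  subst n; apply: (bottom_classified (M := 3) (U := 4) (g := id) nm _ ab EU).
  have nb x : x < 4 -> exists2 y, y < 4 & F x y.
    by move=> x4; apply: (nt_neighbour (n := 4) t.1 Fs).
  have f03 : F 0 3 = false by rewrite Fs; apply/negbTE.
  have [[f01 f12] f23] := (negbTE (side 0 isT), negbTE (side 1 isT), negbTE (side 2 isT)).
  have f02 : F 0 2.
    have [y y4] := nb 0 isT; case: y y4 => [|[|[|[|y]]]] //; by rewrite ?Fi ?f01 ?f03.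
  have f13 : F 1 3.
    have [y y4] := nb 1 isT; case: y y4 => [|[|[|[|y]]]] //; rewrite ?Fi ?f12 //.
    by rewrite Fs f01.
  split=> //; try by move=> *; lia.
  move=> x y xy y5 x4 y4; have {y5 y4} : y < 4 by lia.
  by case: y xy => [|[|[|[|y]]]] // xy _; case: x xy x4 => [|[|[|x]]].
have side' x : x < n - 1 -> ~~ F x (rt (n - 1) 1 x).
  move=> xn; have [xe|xe] := eqVneq x (n - 2).
    have -> : rt (n - 1) 1 x = 0 by rtlia.
    by rewrite xe.
  have -> : rt (n - 1) 1 x = x.+1 by rtlia.
  by apply: side; lia.
have [r [M [f [rn s mx]]]] := tight_std (ltac:(lia) : 5 <= n - 1) Fs Fi t side'.
have rn' : r < n by lia.
apply: (classified_rt rn').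
have nmG := near_min_rt rn' nm; pose U := n - 1 - r.
have EE := inserted_edge rn (erefl U) s.
have dG : deg_in n (pull F (rt n r)) U = 2.
  rewrite deg_in_rt //; have -> : rt n r U = n - 1 by rewrite /U; rtlia.
  exact: d2.
have U1 : 0 < U < n by rewrite /U; lia.
have [Mn _ fM co] := s.
(* For U <= M the vertex was inserted between U - 1 and U on the arc, which now ends at [M.+1]. *)
have [MU|MU] := ltnP M U.
  have [a [b [ab EU]]] := deg2_neighbours dG.
  apply: (bottom_classified (M := M) (g := fun y => f (y - (U < y))) nmG _ ab EU).
  split; first by lia.
  - move=> x y xy yn xU yU; rewrite EE // /arc_rel.
    have [yM|yM] := leqP y M.
      have -> : (U < y) = false by lia.
      have -> : (U < x) = false by lia.
      by rewrite !subn0; lia.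
    have gy : 0 < f (y - (U < y)) < M by apply: fM; lia.
    by move: gy; set z := f _; lia.
  - by move=> y yn yU; apply: fM; lia.
  - by move=> y y' My yy' y'n yU y'U; apply: co; lia.
  - split=> h.
      have /andP[_ m2] := mx ltac:(lia).
      have -> : (U < n - 1) = true by lia.
      by have -> : n - 1 - true = n - 1 - 1 by [].
    have /andP[m1 _] := mx ltac:(lia).
    have -> : (U < M + 1) = false by lia.
    by rewrite subn0 addn1.
apply: (top_classified (P := M.+1) (U := U) (f := fun y => f (y - 1)) nmG) => //; last by lia.
- split; first by lia.
  + move=> x y xy yn xU yU; rewrite EE // /arc_rel.
    case: (leqP y M.+1) => yM.
      have -> : (M < y - (U < y)) = false by lia.
      by rewrite andFb orbF; lia.
    have -> : (U < y) = true by lia.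
    have gy : 0 < f (y - 1) < M by apply: fM; lia.
    have -> : y - true = y - 1 by [].
    by move: gy; set z := f _; lia.
  + by move=> y yn; have := fM (y - 1) ltac:(lia); lia.
  + by move=> y y' My yy' y'n; apply: co; lia.
Qed.

(** * Triangulations as sets of diagonals *)

Lemma btwC a v b : btw a v b = btw b v a.
Proof. by rewrite /btw orbC. Qed.

Lemma crs_swapl a b c d : crs a b c d = crs b a c d.
Proof. by rewrite /crs ![btw a _ _]btwC. Qed.

Lemma crs_swapr a b c d : crs a b c d = crs a b d c.
Proof. by rewrite /crs eq_sym. Qed.

Definition apart (a b c d : nat) : bool := [&& c != a, c != b, d != a & d != b].

Lemma crsC a b c d : apart a b c d -> crs a b c d = crs c d a b.
Proof.
rewrite /apart /crs /btw.
by case: (ltngtP c a) => // ?; case: (ltngtP c b) => // ?; case: (ltngtP d a) => // ?;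
  case: (ltngtP d b) => //= ?; lia.
Qed.

(** Distinguishes the diagonals of [V] from its sides. *)
Definition sep (V : pred nat) (a b : nat) : Prop :=
  exists c d, [/\ V c, V d, apart a b c d & crs a b c d].

Definition triangulates (E T : rel nat) (V : pred nat) : Prop :=
  [/\ symmetric T,
      forall a b, T a b -> [/\ V a, V b, a != b, ~~ E a b & sep V a b],
      forall a b c d, T a b -> T c d -> apart a b c d -> ~~ crs a b c d &
      forall a b, V a -> V b -> a != b -> sep V a b -> ~~ T a b ->
        exists c d, [/\ T c d, apart a b c d & crs a b c d]].

Lemma triangulates_small E (V : pred nat) x y z :
  (forall v, V v -> [\/ v = x, v = y | v = z]) -> triangulates E (fun _ _ => false) V.
Proof.
move=> sm; split=> // a b Va Vb ab [c [d [Vc Vd dis cr]]] _; exfalso.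
have cd : c != d by apply: contraTneq cr => ->; rewrite /crs eqxx.
move: ab dis cd; rewrite /apart.
by case: (sm _ Va) => ->; case: (sm _ Vb) => ->; rewrite ?eqxx //;
  case: (sm _ Vc) => ->; rewrite ?eqxx //; case: (sm _ Vd) => ->; rewrite ?eqxx ?andbF.
Qed.

Lemma ear_swap V c a b : ear V c a b -> ear V c b a.
Proof.
case=> Vc Va Vb dis cr; split=> //; first by rewrite eq_sym; move: dis; case/and3P=> -> -> ->.
by move=> v Vv vc vb va; rewrite crs_swapl; apply: cr.
Qed.

(** [c] and [a] are consecutive in [V], so a chord ending at neither cannot separate them. *)
Lemma ear_same_side V c a b x y : ear V c a b -> V x -> V y ->
  x != a -> x != c -> y != a -> y != c -> x != y -> btw x c y = btw x a y.
Proof.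
case=> Vc Va Vb /and3P[ab ca cb] cr Vx Vy xa xc ya yc xy.
have hx := cr x Vx xc xa; have hy := cr y Vy yc ya.
have [xb|xb] := eqVneq x b.
  have {}hy := hy ltac:(by rewrite -xb eq_sym); subst b; move: hy.
  rewrite /crs /btw.
  by case: (ltngtP a x) ab => // ? _; case: (ltngtP c a) ca => // ? _;
    case: (ltngtP c x) cb => //= ? _; lia.
have {}hx := hx xb.
have [yb|yb] := eqVneq y b.
  subst b; move: hx; rewrite /crs /btw.
  by case: (ltngtP a y) ab => // ? _; case: (ltngtP c a) ca => // ? _;
    case: (ltngtP c y) cb => //= ? _; lia.
have {}hy := hy yb; move: hx hy; rewrite /crs /btw.
by case: (ltngtP a b) ab => // ? _; case: (ltngtP c a) ca => // ? _;
  case: (ltngtP c b) cb => //= ? _; lia.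
Qed.

Lemma ear_side_nsep V c a b : ear V c a b -> ~ sep V c a.
Proof.
move=> e [p [q [Vp Vq /and4P[pc pa qc qa] cr]]].
have [pq|pq] := eqVneq p q; first by move: cr; rewrite pq /crs eqxx.
have := ear_same_side e Vp Vq pa pc qa qc pq.
move: cr; rewrite crsC; last by rewrite /apart pc pa qc qa.
by rewrite /crs => /negP + h; apply; rewrite h.
Qed.

Lemma sepC V a b : sep V a b -> sep V b a.
Proof.
case=> c [d [Vc Vd /and4P[h1 h2 h3 h4] cr]]; exists c, d; split=> //.
  by rewrite /apart h1 h2 h3 h4.
by rewrite crs_swapl.
Qed.

(** The chord ab is added to a triangulation of [V']; the fourth vertex [w] makes it a diagonal. For
    maximality, a diagonal at [c] crosses ab, while any other diagonal of [V] apart from ab is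
    already one of [V']. *)
Lemma ear_triangulates E T (V V' : pred nat) c a b w : symmetric E ->
  ear V c a b -> ~~ E a b -> (forall v, V' v = V v && (v != c)) ->
  V w -> w != c -> w != a -> w != b ->
  triangulates E T V' ->
  triangulates E (fun x y => [|| T x y, (x == a) && (y == b) | (x == b) && (y == a)]) V.
Proof.
move=> Es e nE V'E Vw wc wa wb [Ts Te Tc Tm].
have [Vc Va Vb /and3P[ab ca cb] cr] := e.
have crw v : V v -> v != c -> v != a -> v != b -> btw a v b = ~~ btw a c b.
  by move=> Vv vc va vb; have := cr v Vv vc va vb; rewrite /crs; case: btw; case: btw.
have V'V v : V' v -> V v by rewrite V'E => /andP[].
have V'c v : V' v -> v != c by rewrite V'E => /andP[].
have sepV x y : sep V' x y -> sep V x y.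
  by case=> p [q [/V'V Vp /V'V Vq dd cc]]; exists p, q.
have sab : sep V a b.
  by exists c, w; split=> //; [rewrite /apart ca cb wa wb|apply: cr].
have nocross x y : T x y -> apart a b x y -> ~~ crs a b x y.
  case/Te=> Vx Vy _ _ _ /and4P[xa xb ya yb].
  by rewrite /crs (crw x) ?(crw y) ?eqxx //; auto.
have apC x y : apart x y a b -> apart a b x y.
  by rewrite /apart ![a == _]eq_sym ![b == _]eq_sym; case/and4P=> -> -> -> ->.
have nocross' x y : T x y -> apart x y a b -> ~~ crs x y a b.
  by move=> Txy d; rewrite crsC // nocross //; apply: apC.
have apS x y x' y' : apart x y x' y' -> apart x y y' x'.
  by rewrite /apart; case/and4P=> -> -> -> ->.
have apS' x y x' y' : apart x y x' y' -> apart y x x' y'.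
  by rewrite /apart; case/and4P=> -> -> -> ->.
split.
- by move=> x y; rewrite Ts; congr (_ || _); rewrite orbC ![(_ == b) && _]andbC.
- move=> x y /or3P[/Te[Vx Vy xy nExy sxy]|/andP[/eqP-> /eqP->]|/andP[/eqP-> /eqP->]].
  + by split; auto.
  + by split.
  + by split=> //; rewrite 1?eq_sym 1?Es //; apply: sepC.
- move=> x y x' y' /or3P[Txy|/andP[/eqP-> /eqP->]|/andP[/eqP-> /eqP->]];
    case/or3P=> [Txy'|/andP[/eqP-> /eqP->]|/andP[/eqP-> /eqP->]] dd;
    try by case/and4P: dd; rewrite ?eqxx.
  + exact: Tc.
  + exact: nocross'.
  + by rewrite crs_swapr; apply: nocross'; auto.
  + exact: nocross.
  + by rewrite crs_swapl; apply: nocross; auto.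
have cside y : V y -> c != y -> sep V c y -> apart c y a b /\ crs c y a b.
  move=> Vy cy s.
  have ya : y != a by apply/eqP => h; apply: (ear_side_nsep e); rewrite -h.
  have yb : y != b by apply/eqP => h; apply: (ear_side_nsep (ear_swap e)); rewrite -h.
  have d : apart a b c y by rewrite /apart ca cb ya yb.
  have d' : apart c y a b.
    by rewrite /apart ![a == _]eq_sym ![b == _]eq_sym ca cb ya yb.
  by rewrite crsC //; split=> //; apply: cr => //; rewrite eq_sym.
move=> x y Vx Vy xy sxy; rewrite !negb_or => /and3P[nT n1 n2].
have [xc|xc] := eqVneq x c.
  subst x; have [d1 d2] := cside y Vy xy sxy.
  by exists a, b; split=> //; rewrite !eqxx orbT.
have [yc|yc] := eqVneq y c.
  subst y; have [d1 d2] := cside x Vx ltac:(by rewrite eq_sym) (sepC sxy).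
  by exists a, b; split; [rewrite !eqxx orbT|auto|rewrite crs_swapl].
have V'x : V' x by rewrite V'E Vx.
have V'y : V' y by rewrite V'E Vy.
suff s' : sep V' x y.
  have [p [q [Tpq d1 d2]]] := Tm x y V'x V'y xy s' nT.
  by exists p, q; rewrite Tpq.
(* replace c by whichever of its neighbours a, b is not an end of the chord *)
have rep q : V q -> q != c -> apart x y c q -> crs x y c q -> sep V' x y.
  move=> Vq qc /and4P[cx cy qx qy] crq.
  have use z z' : ear V c z z' -> z != x -> z != y -> sep V' x y.
    move=> e' zx zy; exists z, q; have [_ Vz _ /and3P[_ cz _] _] := e'.
    split; first by rewrite V'E Vz eq_sym.
    - by rewrite V'E Vq.
    - by rewrite /apart zx zy qx qy.
    move: crq; rewrite /crs (ear_same_side e' Vx Vy) //; by rewrite eq_sym.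
  have [ax|ax] := eqVneq a x.
    have [yb|yb] := eqVneq y b; first by rewrite ax yb !eqxx in n1.
    by apply: (use b a (ear_swap e)); rewrite ?ax 1?eq_sym // -ax.
  have [ay|ay] := eqVneq a y; last by apply: (use a b e).
  have [xb|xb] := eqVneq x b; first by rewrite ay xb !eqxx in n2.
  by apply: (use b a (ear_swap e)); rewrite 1?eq_sym // -ay.
case: sxy => p [q [Vp Vq dd cc]].
have pq : p != q by apply: contraTneq cc => ->; rewrite /crs eqxx.
have [pc|pc] := eqVneq p c; first by subst p; apply: (rep q) => //; rewrite eq_sym.
have [qc|qc] := eqVneq q c.
  by subst q; apply: (rep p) => //; [auto|rewrite crs_swapr].
by exists p, q; rewrite !V'E Vp Vq.
Qed.

Lemma tri_triangulates E (V : pred nat) n : symmetric E -> tri E V ->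
  (forall v, V v -> v < n) -> exists T, triangulates E T V.
Proof.
move=> Es; elim=> {V} [V x y z sm _|V V' c a b e nE V'E _ IH Vn].
  by exists (fun _ _ => false); apply: triangulates_small sm.
case: (boolP [exists w : 'I_n, [&& V w, w != c :> nat, w != a :> nat & w != b :> nat]]); last first.
  move/existsPn => no; exists (fun _ _ => false).
  apply: (@triangulates_small E V a b c) => v Vv.
  have := no (Ordinal (Vn v Vv)); rewrite /= Vv /=.
  have [->|vc] := eqVneq v c; first by constructor 3.
  have [->|va] := eqVneq v a; first by constructor 1.
  by have [->|vb] := eqVneq v b; first by constructor 2.
case/existsP=> w /and4P[Vw wc wa wb].
have V'n v : V' v -> v < n by rewrite V'E => /andP[/Vn].
have [T tT] := IH V'n.
by eexists; apply: (ear_triangulates Es e nE V'E Vw wc wa wb tT).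
Qed.

(** * Sets of diagonals as relations *)

Definition rel_of (n : nat) (B : {set {set 'I_n}}) : rel nat :=
  fun x y => [&& x < n, y < n, x != y & ed n x y \in B].

Lemma edC n a b : ed n a b = ed n b a.
Proof. by apply/setP => x; rewrite !inE orbC. Qed.

Lemma in_ed n a b (x : 'I_n) : a < n -> b < n ->
  (x \in ed n a b) = (x == a :> nat) || (x == b :> nat).
Proof. by move=> an bn; rewrite inE !modn_small. Qed.

Lemma ed_ord n (a b : 'I_n) : ed n a b = [set a; b].
Proof. by apply/setP => x; rewrite in_ed // !inE. Qed.

Lemma ed_eq n a b c d : a < n -> b < n -> c < n -> d < n ->
  (ed n a b == ed n c d) = ((a == c) && (b == d)) || ((a == d) && (b == c)).
Proof.
move=> an bn cn dn; apply/eqP/idP => [e|/orP[]/andP[/eqP-> /eqP->] //]; last exact: edC.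
have m x (xn : x < n) : (x == a) || (x == b) = (x == c) || (x == d).
  have := congr1 (fun A : {set 'I_n} => Ordinal xn \in A) e.
  by rewrite /= !in_ed.
have := m a an; have := m b bn; have := m c cn; have := m d dn.
by rewrite !eqxx ?orbT /=; lia.
Qed.

Lemma is_diagP n (e : {set 'I_n}) :
  reflect (exists a b, [/\ a.+1 < b, b < n, ~~ ((a == 0) && (b == n.-1)) & e = ed n a b])
          (is_diag e).
Proof.
apply: (iffP existsP) => [[a /existsP[b /and3P[/eqP-> ab h]]]|[a [b [ab bn h ->]]]].
  by exists a, b; rewrite ltn_ord ed_ord.
have an : a < n by lia.
exists (Ordinal an); apply/existsP; exists (Ordinal bn).
by rewrite -ed_ord eqxx ab h.
Qed.

Lemma interleaveP n a b c d : a < n -> b < n -> c < n -> d < n ->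
  interleave (ed n a b) (ed n c d) =
  [|| (a < c < b) && (b < d), (a < d < b) && (b < c), (b < c < a) && (a < d) |
      (b < d < a) && (a < c)].
Proof.
move=> an bn cn dn; apply/idP/idP.
  case/existsP=> a' /existsP[b' /existsP[c' /existsP[d' /and5P[]]]].
  rewrite -!ed_ord !ed_eq ?ltn_ord // => h1 h2 h3 h4 h5.
  by case/orP: h1 => /andP[/eqP-> /eqP->]; case/orP: h2 => /andP[/eqP-> /eqP->];
    rewrite h3 h4 h5 ?orbT.
have H x y z t (xn : x < n) (yn : y < n) (zn : z < n) (tn : t < n) :
    x < z -> z < y -> y < t -> interleave (ed n x y) (ed n z t).
  move=> xz zy yt; apply/existsP; exists (Ordinal xn); apply/existsP; exists (Ordinal yn).
  apply/existsP; exists (Ordinal zn); apply/existsP; exists (Ordinal tn).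
  by rewrite -!ed_ord !eqxx xz zy yt.
case/or4P=> /andP[/andP[h1 h2] h3].
- exact: H.
- by rewrite (edC n c); apply: H.
- by rewrite (edC n a); apply: H.
- by rewrite (edC n a) (edC n c); apply: H.
Qed.

Lemma crossP n a b c d : a < n -> b < n -> c < n -> d < n -> a != b -> c != d ->
  cross (ed n a b) (ed n c d) = apart a b c d && crs a b c d.
Proof.
move=> an bn cn dn ab cd; rewrite /cross !interleaveP // /apart /crs /btw.
by case: (ltngtP a b) ab => // ? _; case: (ltngtP c d) cd => // ? _;
  case: (ltngtP c a) => // ?; case: (ltngtP c b) => // ?; case: (ltngtP d a) => // ?;
  case: (ltngtP d b) => //= ?; lia.
Qed.

Lemma rel_of_sym n (B : {set {set 'I_n}}) : symmetric (rel_of B).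
Proof. by move=> x y; rewrite /rel_of edC eq_sym; case: (x < n); case: (y < n). Qed.

Lemma sep_polygon n a b : sep (fun v => v < n) a b -> a < b -> b < n ->
  a.+1 < b /\ ~~ ((a == 0) && (b == n.-1)).
Proof.
by case=> c [d [cn dn]]; rewrite /apart /crs /btw => h cr ab bn; move: h cr; lia.
Qed.

Lemma blocker_nt n (B : {set {set 'I_n}}) : is_blocker B ->
  nt (rel_of B) (fun v => v < n).
Proof.
case=> Bd blk t.
have [T [Ts Te Tc Tm]] := tri_triangulates (@rel_of_sym n B) t (fun _ => id).
pose TT := [set e : {set 'I_n} | [exists a : 'I_n, exists b : 'I_n, T a b && (e == ed n a b)]].
have inTT a b : T a b -> ed n a b \in TT.
  move=> Tab; have [an bn _ _ _] := Te _ _ Tab.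
  by rewrite inE; apply/existsP; exists (Ordinal an); apply/existsP; exists (Ordinal bn); rewrite Tab eqxx.
have TTP e : e \in TT -> exists a b, T a b /\ e = ed n a b.
  by rewrite inE => /existsP[a /existsP[b /andP[Tab /eqP->]]]; exists a, b.
have [|e [eB /TTP[a [b [Tab eE]]]]] := blk TT; last first.
  have [an bn ab nE _] := Te _ _ Tab.
  by move: nE; rewrite /rel_of an bn ab -eE eB.
split=> [e /TTP[a [b [Tab ->]]]|].
  have [an bn ab _ s] := Te _ _ Tab.
  apply/is_diagP; case: (ltngtP a b) => h; last by rewrite h eqxx in ab.
    by have [h1 h2] := sep_polygon s h bn; exists a, b.
  by have [h1 h2] := sep_polygon (sepC s) h an; exists b, a; rewrite edC.
split=> [e e' /TTP[a [b [Tab ->]]] /TTP[c [d [Tcd ->]]]|].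
  have [an bn ab _ _] := Te _ _ Tab; have [cn dn cd _ _] := Te _ _ Tcd.
  by rewrite crossP //; apply/negP => /andP[ap]; apply/negP; apply: Tc.
move=> e /is_diagP[a [b [ab bn h ->]]] nT.
have an : a < n by lia.
have ab' : a != b by lia.
have s : sep (fun v => v < n) a b.
  have [a0|a0] := eqVneq a 0.
    by exists a.+1, b.+1; split; rewrite ?/apart ?/crs ?/btw; lia.
  by exists a.+1, 0; split; rewrite ?/apart ?/crs ?/btw; lia.
have [|c [d [Tcd ap cr]]] := Tm a b an bn ab' s.
  by apply: contra nT => /inTT.
exists (ed n c d); first exact: inTT.
have [cn dn cd _ _] := Te _ _ Tcd.
by rewrite crossP // ap cr.
Qed.

(** * Ear removal along a given triangulation *)

Section TriangulationToTri.

Variables (n : nat) (B T : {set {set 'I_n}}).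
Hypotheses (tT : is_triangulation T) (BT : forall e, e \in B -> e \notin T).

Let tn a b := (b == a.+1) || (ed n a b \in T).

(** The third vertex of the triangle over ab. Take the largest [c] joined to [a]; a diagonal of [T]
    crossing cb would cross ab or ac, or start at [a] and end beyond [c]. *)
Lemma apex a b : a.+1 < b -> b < n -> tn a b \/ (a = 0 /\ b = n.-1) ->
  exists2 c, a < c < b & tn a c /\ tn c b.
Proof.
have [Td [Tc Tm]] := tT; move=> ab bn tab.
have ex : exists c, (a < c < b) && tn a c by exists a.+1; rewrite /tn eqxx; lia.
have ub c : (a < c < b) && tn a c -> c <= b by lia.
case: (ex_maxnP ex ub) => c /andP[acb tac] cm; exists c => //; split=> //.
rewrite /tn; have [//|cb] := eqVneq b c.+1.
apply/negPn/negP => ncb.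
have dcb : is_diag (ed n c b) by apply/is_diagP; exists c, b; split=> //; lia.
have [e eT] := Tm _ dcb ncb.
have /is_diagP[x [y [xy yn _ eE]]] := Td _ eT.
rewrite eE in eT *; rewrite crossP; try lia.
rewrite /apart /crs /btw => cr.
have nc a' b' : a' < b' -> b' < n -> ed n a' b' \in T -> ~ (apart a' b' x y && crs a' b' x y).
  move=> ab' bn' e'T h; have := Tc _ _ e'T eT.
  by rewrite crossP ?h //; lia.
have h1 : ~ (a < x < b /\ b < y) /\ ~ (x < a /\ a < y < b).
  case: tab => [/orP[|abT]|]; try lia.
  by have := nc a b _ bn abT; rewrite /apart /crs /btw; lia.
have h2 : ~ (a < x < c /\ c < y).
  case/orP: tac => [|acT]; first lia.
  by have := nc a c _ _ acT; rewrite /apart /crs /btw; lia.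
have h3 : ~ (x = a /\ c < y < b).
  case=> xa cy; have := cm y; rewrite /tn -xa eT orbT; lia.
by lia.
Qed.

(** The part of the polygon over ab is removed ear by ear: the parts over cb and ac, then the apex
    [c] itself. [k] bounds b - a for the induction. *)
Lemma fill_in k a b (V V' : pred nat) : b - a <= k -> a < b -> b < n -> tn a b ->
  (forall v, a <= v <= b -> V v) -> (forall v, V' v = V v && ~~ (a < v < b)) ->
  tri (rel_of B) V' -> tri (rel_of B) V.
Proof.
elim: k a b V V' => [|k IH] a b V V' bak ab bn tab Vab V'E t; first by lia.
have [b1|b1] := eqVneq b a.+1.
  by apply: tri_ext t => v; rewrite V'E; lia.
have ab1 : a.+1 < b by lia.
have [c acb [tac tcb]] := apex ab1 bn (or_introl tab).
have abT : ed n a b \in T by move: tab; rewrite /tn (negbTE b1).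
apply: (IH c b V (fun v => V v && ~~ (c < v < b))) => //; try lia.
  by move=> v vb; apply: Vab; lia.
apply: (IH a c _ (fun v => V v && ~~ (c < v < b) && ~~ (a < v < c))) => //; try lia.
  by move=> v vb; rewrite Vab; lia.
apply: (@tri_ear _ _ V' c a b) => //.
- split; rewrite ?Vab /=; try lia.
  by move=> v /andP[/andP[Vv h1] h2] *; rewrite /crs /btw; lia.
- by rewrite /rel_of; apply/negP => /and4P[_ _ _ /BT]; rewrite abT.
- by move=> v; rewrite V'E; case: (V v) => //=; lia.
Qed.

Lemma triangulation_tri : 3 <= n -> tri (rel_of B) (fun v => v < n).
Proof.
move=> n3.
have [c c0 [t0 t1]] := @apex 0 n.-1 ltac:(lia) ltac:(lia) (or_intror (conj erefl erefl)).
apply: (@fill_in n c n.-1 _ (fun v => (v <= c) || (v == n.-1)) _ _ _ t1); try lia.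
apply: (@fill_in n 0 c _ (fun v => [|| v == 0, v == c | v == n.-1]) _ _ _ t0); try lia.
apply: (@tri_small _ _ 0 c n.-1) => v /or3P[]/eqP->.
- by constructor 1.
- by constructor 2.
- by constructor 3.
Qed.

End TriangulationToTri.

Lemma nt_blocker n (B : {set {set 'I_n}}) : (forall e, e \in B -> is_diag e) ->
  nt (rel_of B) (fun v => v < n) -> is_blocker B.
Proof.
move=> Bd nB; split=> // T tT.
case: (boolP [exists e, (e \in B) && (e \in T)]) => [/existsP[e /andP[eB eT]]|].
  by exists e.
move/existsPn => no; have n4 := nt_min_size nB; case: nB.
apply: (triangulation_tri tT); last by lia.
by move=> e eB; have := no e; rewrite eB.
Qed.

Lemma rel_ofE n (B : {set {set 'I_n}}) x y : (forall e, e \in B -> is_diag e) ->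
  x < n -> y < n -> rel_of B x y = (ed n x y \in B).
Proof.
move=> Bd xn yn; rewrite /rel_of xn yn /=; have [->|//] := eqVneq x y.
apply/esym/negP => /Bd /is_diagP[a [b [ab bn _ /eqP]]].
by rewrite ed_eq; lia.
Qed.

Lemma deg_in_rel_of n (B : {set {set 'I_n}}) (u : 'I_n) : (forall e, e \in B -> is_diag e) ->
  deg_in n (rel_of B) u = deg B u.
Proof.
move=> Bd; rewrite /deg_in /deg.
have inj : injective (fun v : 'I_n => ed n u v).
  by move=> v w /eqP; rewrite ed_eq // => h; apply: val_inj => /=; lia.
have -> : #|[set e in B | u \in e]| = #|[set v : 'I_n | ed n u v \in B]|.
  rewrite -(card_imset _ inj); apply: eq_card => e; rewrite inE; apply/andP/imsetP.
    case=> eB; case/is_diagP: (Bd _ eB) => a [b [ab bn _ eE]].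
    have an : a < n by lia.
    rewrite eE in_ed // => /orP[] /eqP ua.
      by exists (Ordinal bn); rewrite ?inE /= -?ua ?eE // ua -eE.
    exists (Ordinal an); rewrite ?inE /=; first by rewrite ua edC -eE.
    by rewrite ua edC.
  by case=> v; rewrite inE => eB ->; rewrite in_ed // eqxx.
rewrite -sum1_card [RHS]big_mkcond /=; apply: eq_bigr => v _.
by rewrite inE rel_ofE //; case: (_ \in B).
Qed.

Lemma deg_sum_rel_of n (B : {set {set 'I_n}}) : (forall e, e \in B -> is_diag e) ->
  deg_sum n (rel_of B) = #|B|.*2.
Proof.
move=> Bd; rewrite /deg_sum; under eq_bigr => u _ do rewrite deg_in_rel_of //.
rewrite /deg; under eq_bigr => u _ do rewrite -sum1_card big_mkcond /=.
rewrite exchange_big /= -muln2 -sum_nat_const big_mkcond [RHS]big_mkcond /=.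
apply: eq_bigr => e _; under eq_bigr => u _ do rewrite inE.
case eB: (e \in B); last by rewrite big1.
case/is_diagP: (Bd _ eB) => a [b [ab bn _ eE]].
have an : a < n by lia.
rewrite -big_mkcond sum1_card; rewrite eE.
rewrite (_ : ed n a b = [set Ordinal an; Ordinal bn]); last by rewrite -ed_ord.
by rewrite cards2 -val_eqE /=; case: eqVneq => //; lia.
Qed.

Lemma near_min_of_blocker n (B : {set {set 'I_n}}) : 0 < n ->
  nk_blocker (n - 1) B -> near_min n (rel_of B).
Proof.
move=> n0 [[Bd blk] [sat cB]].
have nB := blocker_nt (conj Bd blk).
have n4 := nt_min_size nB.
split.
- exact: rel_of_sym.
- by move=> x; rewrite /rel_of eqxx !andbF.
- exact: nB.
- move=> x xn; apply/negP => /and4P[_ rn _ /Bd /is_diagP[a [b [ab bn h /eqP]]]].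
  rewrite ed_eq; try lia.
  by move: (rt_spec n 1 x) h; lia.
- by rewrite deg_sum_rel_of // cB; lia.
- move=> x y xn yn Exy nd.
  have eB : ed n x y \in B by move: Exy; rewrite rel_ofE.
  apply: (sat _ eB); apply: nt_blocker; first by move=> e /setD1P[_ /Bd].
  apply: nt_mono nd => a b an bn; rewrite /del /rel_of => /andP[/and4P[_ _ ab abB] h].
  rewrite an bn ab in_setD1 abB andbT ed_eq //.
Qed.

(** * From the shapes to the three types *)

Lemma ed_eq_lt n x y a b : x < y < n -> a < b < n ->
  (ed n x y == ed n a b) = (x == a) && (y == b).
Proof. by move=> xy ab; rewrite ed_eq; lia. Qed.

Lemma ed_eq_gt n x y a b : x < y < n -> b < a < n ->
  (ed n x y == ed n a b) = (x == b) && (y == a).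
Proof. by move=> xy ab; rewrite edC ed_eq; lia. Qed.

Lemma in_edges n (Q : pred nat) f g e :
  (e \in edges n Q f g) = [exists j : 'I_n, Q j && (e == ed n (f j) (g j))].
Proof. by rewrite inE. Qed.

Lemma in_edges_arc n (Q : pred nat) x y : (forall j, Q j -> j + 2 < n) -> x < y < n ->
  (ed n x y \in edges n Q id (fun j => j + 2)) = Q x && (y == x + 2).
Proof.
move=> Qn xy; rewrite in_edges; apply/existsP/andP => [[j /andP[Qj]]|[Qx yx]].
  by rewrite ed_eq_lt //; [move/andP=> [/eqP-> /eqP->]|have := Qn _ Qj; lia].
have xn : x < n by lia.
by exists (Ordinal xn); rewrite /= Qx (eqP yx) eqxx.
Qed.

Lemma in_edges_spokes n (Q : pred nat) p i x y :
  (forall j, Q j -> p + j < n /\ i j < p + j) -> x < y < n ->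
  (ed n x y \in edges n Q (fun j => p + j) i) =
  [&& p <= y, Q (y - p) & x == i (y - p)].
Proof.
move=> Qn xy; rewrite in_edges; apply/existsP/and3P => [[j /andP[Qj]]|[py Qy xi]].
  have := Qn _ Qj => h; rewrite ed_eq_gt //; last by lia.
  move=> /andP[/eqP-> /eqP->]; have -> : p + j - p = j by lia.
  by rewrite Qj eqxx leq_addr.
have jn : y - p < n by lia.
exists (Ordinal jn); rewrite /= Qy -(eqP xi).
have -> : p + (y - p) = y by lia.
by rewrite edC eqxx.
Qed.

(** Makes it sufficient to compare sets on [ed n x y] with x < y. *)
Definition proper n (B : {set {set 'I_n}}) : Prop :=
  forall e, e \in B -> exists x y, x < y < n /\ e = ed n x y.

Lemma proper_ed n x y : x < n -> y < n -> x != y -> exists a b, a < b < n /\ ed n x y = ed n a b.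
Proof.
move=> xn yn; case: (ltngtP x y) => // h _; [exists x, y|exists y, x]; split=> //.
- by rewrite h.
- by rewrite h.
- exact: edC.
Qed.

Lemma proper_edges n (Q : pred nat) f g :
  (forall j, Q j -> [&& f j < n, g j < n & f j != g j]) -> proper (edges n Q f g).
Proof.
move=> H e; rewrite in_edges => /existsP[j /andP[Qj /eqP->]].
by have /and3P[h1 h2 h3] := H _ Qj; apply: proper_ed.
Qed.

Lemma properU n (B C : {set {set 'I_n}}) : proper B -> proper C -> proper (B :|: C).
Proof. by move=> pB pC e /setUP[/pB|/pC]. Qed.

Lemma proper1 n x y : x < n -> y < n -> x != y -> proper [set ed n x y].
Proof. by move=> xn yn xy e /set1P->; apply: proper_ed. Qed.

Lemma proper_eq n (B C : {set {set 'I_n}}) : proper B -> proper C ->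
  (forall x y, x < y < n -> (ed n x y \in B) = (ed n x y \in C)) -> B = C.
Proof.
move=> pB pC BC; apply/setP => e; apply/idP/idP.
  by move=> eB; have [x [y [xy eE]]] := pB _ eB; rewrite eE -(BC _ _ xy) -eE.
by move=> eB; have [x [y [xy eE]]] := pC _ eB; rewrite eE (BC _ _ xy) -eE.
Qed.

Lemma no_crossing n P g y y' : compatible n P g -> (forall y, P < y < n -> g y <= P) ->
  P < y < n -> P < y' < n -> dist2 (g y) (g y') ->
  ~~ cross (ed n y (g y)) (ed n y' (g y')).
Proof.
move=> co gP yn y'n; have gy := gP _ yn; have gy' := gP _ y'n.
rewrite crossP; try lia.
rewrite /dist2 /apart /crs /btw; case: (ltngtP y y') => h; last by rewrite h; lia.
  by have := co y y'; lia.
by have := co y' y; lia.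
Qed.

Section Types.

Variables (n : nat) (C : {set {set 'I_n}}) (F : rel nat).
Hypothesis pC : proper C.
Hypothesis CF : forall x y, x < y < n -> (ed n x y \in C) = F x y.

Lemma type1_of_shape1 : shape1 n F -> type1 C.
Proof.
case=> P [l [g [Pn lP gP co FE]]].
have gP' y : P < y < n -> g y <= P by move/gP; lia.
exists (P - 2), l, (fun j => g (P + j)); have eP j : P - 2 + 2 + j = P + j by lia.
split; [lia|lia| | |].
- by move=> j jn /=; have := gP (P + j); lia.
- by move=> j1 j2 jn1 jn2 /= d; rewrite !eP; apply: (no_crossing co gP' _ _ d); lia.
apply: proper_eq => //.
  repeat apply: properU; try (apply: proper1; lia).
    by apply: proper_edges => j /= Qj; lia.
  by apply: proper_edges => j /= Qj; rewrite !eP; have := gP (P + j); lia.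
move=> x y xy; rewrite CF // FE; try lia.
rewrite !in_setU !in_set1 in_edges_arc // => [|j /=]; last by lia.
rewrite in_edges_spokes // => [|j /=]; last by have := gP (P + j); lia.
rewrite !ed_eq_lt //; try lia.
have eP2 : P - 2 + 2 = P by lia.
rewrite eP2; case: (leqP y P) => yP.
  have -> : [&& P <= y, 0 < y - P <= n - 3 - (P - 2) & x == g (P + (y - P))] = false by lia.
  rewrite orbF.
  have -> : ((x + 3 <= l) || (l + 1 <= x <= P - 2)) && (y == x + 2) =
            (y == x + 2) && ((y < l) || (l < x)) by lia.
  by rewrite !orbA.
have -> : P + (y - P) = y by lia.
have yl : (y == l) = false by lia.
have yl1 : (y == l + 1) = false by lia.
have yl2 : (y == l + 2) = false by lia.
by rewrite yl yl1 yl2 !andbF !orFb; lia.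
Qed.

Lemma type2_of_shape2 : shape2 n F -> type2 C.
Proof.
case=> P [l [g [Pn lP gP co FE]]].
have gP' y : P < y < n -> g y <= P by move/gP; lia.
exists (P - 2), l, (fun j => g (P + j)); have eP j : P - 2 + 2 + j = P + j by lia.
split; [lia|lia| | |].
- by move=> j jn /=; have := gP (P + j); lia.
- by move=> j1 j2 jn1 jn2 /= d; rewrite !eP; apply: (no_crossing co gP' _ _ d); lia.
apply: proper_eq => //.
  repeat apply: properU; try (apply: proper1; lia).
    by apply: proper_edges => j /= Qj; lia.
  by apply: proper_edges => j /= Qj; rewrite !eP; have := gP (P + j); lia.
move=> x y xy; rewrite CF // FE; try lia.
rewrite !in_setU !in_set1 in_edges_arc // => [|j /=]; last by lia.
rewrite in_edges_spokes // => [|j /=]; last by have := gP (P + j); lia.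
rewrite !ed_eq_lt //; try lia.
have eP2 : P - 2 + 2 = P by lia.
rewrite eP2; case: (leqP y P) => yP.
  have -> : [&& P <= y, 0 < y - P <= n - 3 - (P - 2) & x == g (P + (y - P))] = false by lia.
  rewrite orbF.
  have -> : ((x + 3 <= l) || (l + 2 <= x <= P - 2)) && (y == x + 2) =
            (y == x + 2) && ((y < l) || (l + 1 < x)) by lia.
  by rewrite !orbA.
have -> : P + (y - P) = y by lia.
have yl : (y == l) = false by lia.
have yl1 : (y == l + 1) = false by lia.
have yl2 : (y == l + 2) = false by lia.
have yl3 : (y == l + 3) = false by lia.
by rewrite yl yl1 yl2 yl3 !andbF !orFb; lia.
Qed.

Lemma type3_of_shape3 : shape3 n F -> type3 C.
Proof.
case=> P [l [k [k' [g [Pk gP co FE]]]]].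
have P2 : 2 <= P by clear - Pk; lia.
have eP j : P - 2 + 2 + j = P + j by lia.
have gP' y : P < y < n -> g y <= P.
  move/gP=> [h1 h2 h3 h4 h5].
  case: (ltngtP y k) => [/h1|yk|/h2]; try (clear h1 h2 h3 h4 h5; lia).
  case: (ltngtP y k') => [yk'|/h5|/h4]; try (clear h1 h2 h3 h4 h5; lia).
  by rewrite h3 ?yk //; clear h1 h2 h3 h4 h5; lia.
exists l, (P - 2), k, (k' - k), (fun j => g (P + j)) => idxL idxR.
have Ly j : idxL j -> P < P + j < k by rewrite /idxL; lia.
have Ry j : idxR j -> k' < P + j < n by rewrite /idxR; lia.
have LRy j : idxL j || idxR j -> P < P + j < n /\ (P + j < k \/ k' < P + j).
  by case/orP => [/Ly|/Ry]; lia.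
(* Both sides of the bouquet together: the new case y < k, k' < y' has g y >= l >= g y'. *)
have co' y y' : P < y -> y < y' -> y' < n -> y < k \/ k' < y -> y' < k \/ k' < y' ->
    g y' <= g y + 1.
  move=> Py yy' y'n yk y'k; have [y'k'|y'k'] := ltnP y' k; first by apply: co; auto.
  have [yk'|yk'] := ltnP k' y; first by apply: co; auto.
  have [gy _ _ _ _] := gP y ltac:(lia); have [_ _ _ _ gy'] := gP y' ltac:(lia).
  by have := gy ltac:(lia); have := gy' ltac:(lia); lia.
split; first by lia.
- by move=> j /Ly jk /=; case: (gP (P + j)); lia.
- by move=> j /Ry jk /=; case: (gP (P + j)); lia.
- move=> j1 j2 /LRy[h1 h1'] /LRy[h2 h2'] /=; rewrite !eP.
  have gy := gP' _ h1; have gy' := gP' _ h2.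
  rewrite crossP; try lia.
  have := co' (P + j1) (P + j2); have := co' (P + j2) (P + j1).
  move: (g (P + j1)) (g (P + j2)) gy gy' => g1 g2 gy gy'; rewrite /dist2 /apart /crs /btw.
  case: (ltngtP j1 j2) => h; last by rewrite h; lia.
    by move=> _ /(_ ltac:(lia) ltac:(lia) ltac:(lia) h1' h2'); lia.
  by move=> /(_ ltac:(lia) ltac:(lia) ltac:(lia) h2' h1') H _; lia.
apply: proper_eq => //.
  repeat apply: properU; try (apply: proper1; lia).
  - by apply: proper_edges => j /= Qj; lia.
  - by apply: proper_edges => j /= Qj; lia.
  - by apply: proper_edges => j /= Qj; lia.
  - by apply: proper_edges => j /= /Ly Qj; rewrite !eP; have := gP' (P + j); lia.
  - by apply: proper_edges => j /= /Ry Qj; rewrite !eP; have := gP' (P + j); lia.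
move=> x y xy; rewrite CF // FE; try lia.
rewrite !in_setU !in_set1 !in_edges_arc // => [|j /=|j /=]; [|clear - Pk; lia|clear - Pk; lia].
rewrite !in_edges_spokes // => [|j /Ry|j /Ly|j /=]; try lia.
- rewrite (ed_eq_lt (a := l - 1)) //; last by lia.
  rewrite (ed_eq_gt (a := k)) //; last by lia.
  rewrite (ed_eq_gt (a := k + (k' - k))) //; last by lia.
  rewrite (ed_eq_lt (a := k)) //; last by lia.
  have -> : P - 2 + 2 = P by lia.
  have -> : k + (k' - k) = k' by lia.
  case: (leqP y P) => yP.
    have yk : (y == k) = false by lia.
    have yk' : (y == k') = false by lia.
    have ky : (k <= y) = false by lia.
    rewrite yk yk' ky !andbF !orbF /idxL /idxR.
    have -> : [&& P <= y, 0 < y - P <= k - (P - 2) - 3 & x == g (P + (y - P))] = false by lia.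
    have -> : [&& P <= y, k + (k' - k) - (P - 2) - 1 <= y - P <= n - 3 - (P - 2)
               & x == g (P + (y - P))] = false by lia.
    by lia.
  have [g1 g2 g3 g4 g5] := gP y ltac:(lia).
  have -> : P + (y - P) = y by lia.
  have yl : (y == l + 1) = false by lia.
  have -> : (l <= x <= P - 2) && (y == x + 2) = false by lia.
  have -> : (x + 2 <= l) && (y == x + 2) = false by lia.
  have Py : P <= y by lia.
  rewrite yl Py andbF /= !orbF /idxL /idxR [(k <= y) && _]andbA.
  have -> : (k <= y) && (0 < y - k <= k' - k - 1) = (k < y) && (y < k').
    by clear - Pk; lia.
  have -> : (0 < y - P <= k - (P - 2) - 3) = (y < k) by clear - Pk yP P2; lia.
  have -> : (k + (k' - k) - (P - 2) - 1 <= y - P <= n - 3 - (P - 2)) = (k' < y).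
    by clear - Pk yP xy P2; lia.
  case: (ltngtP y k) => yk.
  + have -> : (y == k') = false by lia.
    have -> : (k' < y) = false by lia.
    by rewrite !andbF !andFb !orbF.
  + case: (ltngtP y k') => yk' /=; rewrite ?andbF ?orbF ?andbT ?orFb //.
      by rewrite g3 ?yk.
    by rewrite g4.
  + have -> : (y == k') = false by lia.
    have -> : (k' < y) = false by lia.
    by rewrite !andbF !andFb !orbF !andbT g2.
- by move=> h; have := gP' (P + j); lia.
- by move=> h; have := gP' (P + j); lia.
Qed.

End Types.

(** * Rotating sets of diagonals *)

Lemma rotE_ed n s a b : a < n -> b < n ->
  rotE s (ed n a b) = ed n ((a + s) %% n) ((b + s) %% n).
Proof.
move=> an bn; apply/setP => y; rewrite inE [RHS]inE !modn_mod.
apply/existsP/orP => [[x]|].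
  by rewrite in_ed // => /andP[/orP[]/eqP xa /eqP ya]; [left|right]; rewrite ya /= xa.
case=> /eqP e; [exists (Ordinal an)|exists (Ordinal bn)]; by rewrite in_ed // eqxx ?orbT e /=.
Qed.

Lemma rt_back n r x : r < n -> x < n -> (rt n r x + (n - r)) %% n = x.
Proof.
move=> rn xn; case: (rt_spec n r x) => -[h ->].
  have -> : x + r + (n - r) = x + n by lia.
  by rewrite modnDr modn_small.
have -> : x + r - n + (n - r) = x by lia.
by rewrite modn_small.
Qed.

(** Reading labels through the rotation by r means moving the edges by the inverse rotation, n -
    r. *)
Lemma rotB_ed n r (B : {set {set 'I_n}}) : r < n -> proper B ->
  proper (rotB (n - r) B) /\
  forall x y, x < n -> y < n ->
    (ed n x y \in rotB (n - r) B) = (ed n (rt n r x) (rt n r y) \in B).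
Proof.
move=> rn pB.
have im x y : x < n -> y < n -> rotE (n - r) (ed n (rt n r x) (rt n r y)) = ed n x y.
  by move=> xn yn; rewrite rotE_ed ?rt_lt // !rt_back.
have sur e : e \in B -> exists x y, [/\ x < n, y < n, x != y & e = ed n (rt n r x) (rt n r y)].
  move=> eB; have [a [b [ab eE]]] := pB _ eB.
  exists (rt n (rt n (n - r) 0) a), (rt n (rt n (n - r) 0) b).
  have i a' : a' < n -> rt n r (rt n (rt n (n - r) 0) a') = a' by move=> ?; rtlia.
  rewrite !i; try lia; split=> //; rtlia.
split.
  move=> e /imsetP[e0 /sur[x [y [xn yn xy ->]]] ->]; rewrite im //.
  exact: proper_ed.
move=> x y xn yn; apply/imsetP/idP => [[e0 eB]|eB]; last by eexists; [exact: eB|rewrite im].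
have [a [b [an bn ab eE]]] := sur _ eB; rewrite eE im // in eB *.
by move/eqP; rewrite ed_eq // => /orP[]/andP[/eqP-> /eqP->] //; rewrite edC.
Qed.

Lemma rt_modn n r x : r < n -> x < n -> (x + r) %% n = rt n r x.
Proof.
move=> rn xn; case: (rt_spec n r x) => -[h ->]; first by rewrite modn_small.
by rewrite -[in LHS](subnK h) modnDr modn_small //; lia.
Qed.

Theorem theorem4p11 (n : nat) (B : {set {set 'I_n}}) :
  nk_blocker (n - 1) B ->
  (exists u : 'I_n, deg B u = 2 /\ ed n (u + n - 1) (u + 1) \notin B) ->
  exists r : nat, type1 (rotB r B) \/ type2 (rotB r B) \/ type3 (rotB r B).
Proof.
move=> blk [u [d2 nu]].
have un := ltn_ord u.
have n0 : 0 < n by apply: leq_ltn_trans un.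
have [[Bd _] _] := blk.
have nm := near_min_of_blocker n0 blk.
have pB : proper B.
  by move=> e /Bd /is_diagP[a [b [ab bn _ ->]]]; exists a, b; split=> //; lia.
have n4 := nt_min_size (nm_nt nm).
have ne : nonear n (rel_of B) u.
  apply: contra nu; rewrite /nonear => /and4P[_ _ _].
  suff -> : ed n (rt n (n - 1) u) (rt n 1 u) = ed n (u + n - 1) (u + 1) by [].
  have -> : u + n - 1 = u + (n - 1) by lia.
  rewrite -!rt_modn //; try lia.
  by apply/setP => v; rewrite !inE !modn_mod.
have d2' : deg_in n (rel_of B) u = 2 by rewrite deg_in_rel_of.
have [r rn sh] := near_min_classified nm un ne d2'.
have [pC CE] := rotB_ed rn pB.
have CF x y : x < y < n -> (ed n x y \in rotB (n - r) B) = pull (rel_of B) (rt n r) x y.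
  by move=> xy; rewrite CE ?/pull ?rel_ofE ?rt_lt //; lia.
exists (n - r); case: sh => [s|[s|s]].
- by left; apply: type1_of_shape1 s.
- by right; left; apply: type2_of_shape2 s.
- by right; right; apply: type3_of_shape3 s.
Qed.
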